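(* Consider the two-group model without factors described in the context, with nonnull probability $\pi_1\in(0,1)$ not depending on $m$, and $\pi_0=1-\pi_1$. Suppose that $(\varepsilon_{m1},\dots,\varepsilon_{mm})$ has the Toeplitz correlation matrix $$\Gamma^{(m)}_{ij}=I\{i=j\}+\sum_{\ell=1}^M\rho_\ell\,I\{|i-j|=\ell\},$$ where $\rho_1,\dots,\rho_M\in(-1,1)$ are such that $\Gamma^{(m)}$ is positive semidefinite for all $m>M$. Let $\tau_*$ be the unique $t\in(0,1)$ satisfying $t/q=\pi_0t+\pi_1\bar\Phi(\bar\Phi^{-1}(t)-\mu_A)$. Then, as $m\to\infty$, $$\sqrt m\,(\mathrm{FDP}_m-\pi_0q)\xrightarrow{d}\mathcal N\Big(0,\ \frac{\pi_0^2q^2}{\tau_*^2}\Big(\frac{\tau_*}{\pi_0}-\tau_*^2+2\sum_{\ell=1}^M\tilde\rho(\tau_*,\tau_*,\rho_\ell)\Big)\Big).$$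
   Context: Notation: $\Phi$ is the standard normal CDF, $\bar\Phi=1-\Phi$. Fix $q\in(0,1)$, $\mu_A>0$ and a positive integer $M$. Model (no factor component). For each $m$: $H_{m1},\dots,H_{mm}$ are i.i.d. Bernoulli$(\pi_1)$ ($H_{mi}=1$ iff hypothesis $i$ is nonnull), independent of $(\varepsilon_{m1},\dots,\varepsilon_{mm})\sim\mathcal N(0,\Gamma^{(m)})$, where $\Gamma^{(m)}$ is an $m\times m$ correlation matrix (unit diagonal). The $p$-values are $P_{mi}=\bar\Phi(\mu_AH_{mi}+\varepsilon_{mi})$. Benjamini-Hochberg at level $q$: with sorted $p$-values $P_{m(1)}\le\dots\le P_{m(m)}$ and $P_{m(0)}=0$, let $R_m=\max\{j\in\{0,\dots,m\}:P_{m(j)}\le jq/m\}$, $\tau_{\mathrm{BH},m}=P_{m(R_m)}$, $V_m=\sum_{i=1}^mI\{P_{mi}\le\tau_{\mathrm{BH},m},H_{mi}=0\}$, $\mathrm{FDP}_m=V_m/\max\{R_m,1\}$. For $t,s\in[0,1]$ and $|\rho|\le1$, $\tilde\rho(t,s,\rho)=\Pr(Z_1\ge\bar\Phi^{-1}(t),Z_2\ge\bar\Phi^{-1}(s))-ts$, where $(Z_1,Z_2)$ is centered bivariate normal with unit variances and correlation $\rho$. *)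

(* Defs.v *)
From HB Require Import structures.
From mathcomp Require Export all_boot all_order all_algebra.
From mathcomp Require Export all_classical all_reals all_analysis.

Set Implicit Arguments.
Unset Strict Implicit.
Unset Printing Implicit Defensive.

Import Order.TTheory GRing.Theory Num.Theory.
Import numFieldNormedType.Exports.

Local Open Scope classical_set_scope.
Local Open Scope ring_scope.

(* N(mu, v), parametrised by the variance v.  The library's [normal_prob mu s]
   takes the standard deviation, and for s = 0 it is the uniform law on [0, 1]
   instead of the point mass at mu. *)
Definition normal_law (R : realType) (mu v : R) :
    probability (measurableTypeR R) R :=
  if v == 0 then [the probability (measurableTypeR R) R of
                    @dirac _ (measurableTypeR R) mu R]
  else normal_prob mu (Num.sqrt v).

Definition Phi (R : realType) (x : R) : R := fine (normal_prob 0 1 `]-oo, x]).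

Definition Phibar (R : realType) (x : R) : R := 1 - Phi x.

(* Phibar is a decreasing bijection from R onto ]0, 1[; the infimum is its
   inverse there, extended by the values +oo at 0 and -oo at 1. *)
Definition Phibar_inv (R : realType) (t : R) : \bar R :=
  ereal_inf [set x%:E | x in [set x : R | Phibar x <= t]].

(* For |r| <= 1, the centered bivariate normal law with unit variances and
   correlation r, as the law of (X, r X + sqrt (1 - r^2) Y) for independent
   standard normal X and Y. *)
Definition binormal_law (R : realType) (r : R) : set (R * R) -> \bar R :=
  pushforward (normal_prob (0 : R) 1 \x normal_prob (0 : R) 1)%E
    (fun z : R * R => (z.1, r * z.1 + Num.sqrt (1 - r ^+ 2) * z.2)).

Definition rho_tilde (R : realType) (t s r : R) : R :=
  fine (binormal_law r [set z : R * R |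
          (Phibar_inv t <= z.1%:E)%E /\ (Phibar_inv s <= z.2%:E)%E]) - t * s.

Definition psd (R : realType) (n : nat) (A : 'M[R]_n) : Prop :=
  A^T = A /\ forall a : 'rV[R]_n, 0 <= (a *m A *m a^T) 0 0.

(* X ~ N(0, S), with S possibly singular: every linear combination of the
   coordinates is a centered normal variable with the matching variance. *)
Definition centered_gaussian_vector (R : realType) (d : measure_display)
    (T : measurableType d) (P : probability T R) (n : nat)
    (X : 'I_n -> {RV P >-> R}) (S : 'M[R]_n) : Prop :=
  forall (a : 'rV[R]_n) (B : set R), measurable B ->
    P ((fun w => \sum_i a 0 i * X i w) @^-1` B)
    = normal_law 0 ((a *m S *m a^T) 0 0) B.

(* The product rule for subfamilies is the case A i = setT outside of them. *)
Definition mutually_independent (R : realType) (d d' : measure_display)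
    (T : measurableType d) (T' : measurableType d') (P : probability T R)
    (n : nat) (X : 'I_n -> {RV P >-> T'}) : Prop :=
  forall A : 'I_n -> set T', (forall i, measurable (A i)) ->
    P (\bigcap_(i in [set: 'I_n]) (X i @^-1` A i))
    = (\prod_(i < n) P (X i @^-1` A i))%E.

Definition independent_vectors (R : realType) (d d1 d2 : measure_display)
    (T : measurableType d) (T1 : measurableType d1) (T2 : measurableType d2)
    (P : probability T R) (n1 n2 : nat)
    (X : 'I_n1 -> {RV P >-> T1}) (Y : 'I_n2 -> {RV P >-> T2}) : Prop :=
  forall (A : set (n1.-tuple T1)) (B : set (n2.-tuple T2)),
    measurable A -> measurable B ->
    let EX := (fun w => [tuple X i w | i < n1]) @^-1` A in
    let EY := (fun w => [tuple Y i w | i < n2]) @^-1` B in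
    P (EX `&` EY) = (P EX * P EY)%E.

Definition two_group_model (R : realType) (d : measure_display)
    (T : measurableType d) (P : probability T R) (m : nat) (pi1 : R)
    (S : 'M[R]_m) (H : 'I_m -> {RV P >-> bool}) (eps : 'I_m -> {RV P >-> R}) :
    Prop :=
  [/\ forall (i : 'I_m) (B : set bool),
        distribution P (H i) B = bernoulli_prob pi1 B,
      mutually_independent H,
      centered_gaussian_vector eps S
    & independent_vectors H eps].

Definition pvalue (R : realType) (muA : R) (h : bool) (e : R) : R :=
  Phibar (muA * h%:R + e).

Section BenjaminiHochberg.
Context {R : realType} (q : R) {m : nat} (p : 'I_m -> R).

(* The j-th order statistic for 1 <= j <= m, and 0 for j = 0. *)
Definition sorted_pvalue (j : nat) : R :=
  nth 0 (0 :: sort <=%O (codom p)) j.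

Definition BH_rejections : nat :=
  \max_(j < m.+1 | sorted_pvalue j <= j%:R * q / m%:R) j.

Definition BH_threshold : R := sorted_pvalue BH_rejections.

Definition false_rejections (h : 'I_m -> bool) : nat :=
  #|[pred i | (p i <= BH_threshold) && ~~ h i]|.

Definition FDP (h : 'I_m -> bool) : R :=
  (false_rejections h)%:R / (maxn BH_rejections 1)%:R.

End BenjaminiHochberg.

(* rho is used at the lags 1, ..., M only. *)
Definition toeplitz_corr (R : realType) (M : nat) (rho : nat -> R) (m : nat) :
    'M[R]_m :=
  \matrix_(i, j) ((i == j)%:R
    + \sum_(1 <= l < M.+1) rho l * (`|i%:Z - j%:Z|%N == l)%:R).

(* The X n may live on different probability spaces; convergence of the
   distribution functions at every continuity point of the limit. *)
Definition cvg_in_distribution (R : realType) (d : nat -> measure_display)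
    (T : forall n, measurableType (d n)) (P : forall n, probability (T n) R)
    (X : forall n, T n -> R) (mu : probability (measurableTypeR R) R) : Prop :=
  (forall n, measurable_fun [set: T n] (X n)) /\
  forall x : R, {for x, continuous (fun y : R => fine (mu `]-oo, y]%classic))} ->
    (fun n => P n [set w | X n w <= x]) @ \oo --> mu `]-oo, x]%classic.

(* Main.v *)
Require Import Defs.
From mathcomp Require Import all_boot all_order all_algebra.
From mathcomp Require Import all_classical all_reals all_analysis.
From mathcomp Require Import measurable_realfun ring lra zify.
Import Order.TTheory GRing.Theory Num.Theory.
Import numFieldNormedType.Exports.
Local Open Scope classical_set_scope.
Local Open Scope ring_scope.

(** The rejection level t = R q / m solves (number of p-values <= t) = m t / q, and
    the false discovery proportion equals q V(t) / (m t), where V(t) counts the null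
    p-values below t.  Chebyshev bounds on a grid, using that the correlations
    vanish beyond lag M, put t within m^(-2/7) of tau with high probability.  On that
    scale the centred count V(t) - m pi0 t differs from its value at tau by
    o(sqrt m), and the drift m pi0 t cancels in the quotient, so that
    sqrt m (FDP - pi0 q) is asymptotically q / (tau sqrt m) (V(tau) - m pi0 tau).
    This last sum is M-dependent.  Its characteristic function F satisfies
    F'(t) = - sigma^2 t F(t) + O(1 / sqrt m) by Stein's expansion around each summand,
    hence converges to the Gaussian one.

    Independence of far blocks, bivariate tails and Levy's theorem are all obtained
    from trigonometric polynomials: they are closed under products, and the
    indicator of a half-line is a bounded pointwise limit of them. *)

Set Implicit Arguments.
Unset Strict Implicit.

(** * Expectations of bounded random variables *)

(** The noise is known only through the laws of its linear combinations, and its correlation matrix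
    may be singular, so there may be no density to integrate. What this gives directly are the
    expectations of cos (l + th) for linear combinations l; everything about the noise is derived
    from them.

    The exponent 2/7 is a compromise. Only second moments are used, so a union bound over a grid
    costs its size times a Chebyshev bound. Bounding the level above by tau plus a multiple of r
    takes about 1/r points, each failing with probability of order 1/(m r^2): r must be much larger
    than m^(-1/3). Comparing V(t) with V(tau) up to o(sqrt m) takes a mesh of order 1/sqrt m, hence
    about r sqrt m points, each failing with probability of order r: r must be much smaller than
    m^(-1/4). The exponent 2/7 lies between the two, and m^(1/14) turns both r and sqrt m into
    integer powers.

    The differential inequality for F is solved by the same lemma that computes the characteristic
    function of the normal law, where the error is zero. *)

Definition bmeas (d : measure_display) (T : measurableType d) (R : realType)
    (f : T -> R) : Prop :=
  measurable_fun setT f /\ exists C : R, forall w, `|f w| <= C.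

Definition Ex (d : measure_display) (T : measurableType d) (R : realType)
    (P : probability T R) (f : T -> R) : R := Rintegral P setT f.

Section BoundedMeasurable.
Context (d : measure_display) (T : measurableType d) (R : realType).
Implicit Types f g : T -> R.

Lemma bmeas_measurable f : bmeas f -> measurable_fun setT f.
Proof. by case. Qed.

Lemma eq_bmeas f g : (forall w, f w = g w) -> bmeas g -> bmeas f.
Proof. by move=> /funext ->. Qed.

Lemma bmeas_cst (c : R) : bmeas (fun _ : T => c).
Proof. by split=> //; exists `|c|. Qed.

Lemma bmeasD f g : bmeas f -> bmeas g -> bmeas (fun w => f w + g w).
Proof.
move=> [mf [C hC]] [mg [D hD]]; split; first exact: measurable_funD.
by exists (C + D) => w; rewrite (le_trans (ler_normD _ _))// lerD.
Qed.

Lemma bmeasM f g : bmeas f -> bmeas g -> bmeas (fun w => f w * g w).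
Proof.
move=> [mf [C hC]] [mg [D hD]]; split; first exact: measurable_funM.
by exists (C * D) => w; rewrite normrM ler_pM.
Qed.

Lemma bmeasZ (c : R) f : bmeas f -> bmeas (fun w => c * f w).
Proof. by apply: bmeasM; exact: bmeas_cst. Qed.

Lemma bmeasN f : bmeas f -> bmeas (fun w => - f w).
Proof.
move=> /(bmeasZ (-1)); apply: eq_bmeas => w.
by rewrite mulN1r.
Qed.

Lemma bmeasB f g : bmeas f -> bmeas g -> bmeas (fun w => f w - g w).
Proof. by move=> bf /bmeasN; exact: bmeasD. Qed.

Lemma bmeasX f n : bmeas f -> bmeas (fun w => f w ^+ n).
Proof.
move=> bf; elim: n => [|n IH].
  by apply: (@eq_bmeas _ (fun=> 1)) => //; exact: bmeas_cst.
apply: (@eq_bmeas _ (fun w => f w * f w ^+ n)); last exact: bmeasM.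
by move=> w; rewrite exprS.
Qed.

Lemma bmeas_norm f : bmeas f -> bmeas (fun w => `|f w|).
Proof.
move=> [mf [C hC]]; split; first exact: (measurableT_comp (@normr_measurable R setT)).
by exists C => w; rewrite normr_id.
Qed.

Lemma bmeas_sum (I : Type) (r : seq I) (Q : pred I) (F : I -> T -> R) :
  (forall i, Q i -> bmeas (F i)) -> bmeas (fun w => \sum_(i <- r | Q i) F i w).
Proof.
move=> h; elim: r => [|i r IH].
  by apply: (@eq_bmeas _ (fun=> 0)); [move=> w; rewrite big_nil|exact: bmeas_cst].
apply: (@eq_bmeas _ (fun w => (if Q i then F i w else 0)
    + \sum_(j <- r | Q j) F j w)) => [w|].
  by rewrite /= big_cons; case: ifP; rewrite ?add0r.
by have [Qi|Qi] := boolP (Q i); apply: bmeasD => //; [exact: h|exact: bmeas_cst].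
Qed.

Lemma bmeas_indic (A : set T) : measurable A -> bmeas (\1_A : T -> R).
Proof.
move=> mA; split; first exact: measurable_indic.
by exists 1 => w; rewrite indicE; case: (_ \in _); rewrite /= ?normr1 ?normr0.
Qed.

Lemma bmeas_cos f : measurable_fun setT f -> bmeas (fun w => cos (f w)).
Proof.
move=> mf; split; last by exists 1 => w; exact: cos_max.
apply: (measurableT_comp _ mf).
by apply: continuous_measurable_fun; exact: continuous_cos.
Qed.

Lemma bmeas_sin f : measurable_fun setT f -> bmeas (fun w => sin (f w)).
Proof.
move=> mf; split; last by exists 1 => w; exact: sin_max.
apply: (measurableT_comp _ mf).
by apply: continuous_measurable_fun; exact: continuous_sin.
Qed.

End BoundedMeasurable.

Section Expectation.
Context (d : measure_display) (T : measurableType d) (R : realType).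
Context (P : probability T R).
Implicit Types f g : T -> R.

Lemma bmeas_integrable f : bmeas f -> P.-integrable setT (EFin \o f).
Proof.
move=> [mf [C hC]]; apply: measurable_bounded_integrable => //.
  by rewrite /= (le_lt_trans (probability_le1 _ _)) ?ltry.
exists C; split; first exact: num_real.
by move=> x Cx w _; apply: le_trans (hC w) _; exact: ltW.
Qed.

Lemma eq_Ex f g : (forall w, f w = g w) -> Ex P f = Ex P g.
Proof. by move=> /funext ->. Qed.

Lemma ExD f g : bmeas f -> bmeas g ->
  Ex P (fun w => f w + g w) = Ex P f + Ex P g.
Proof. by move=> bf bg; apply: RintegralD => //; exact: bmeas_integrable. Qed.

Lemma ExB f g : bmeas f -> bmeas g ->
  Ex P (fun w => f w - g w) = Ex P f - Ex P g.
Proof. by move=> bf bg; apply: RintegralB => //; exact: bmeas_integrable. Qed.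

Lemma ExZ (c : R) f : bmeas f -> Ex P (fun w => c * f w) = c * Ex P f.
Proof. by move=> bf; apply: RintegralZl => //; exact: bmeas_integrable. Qed.

Lemma ExN f : bmeas f -> Ex P (fun w => - f w) = - Ex P f.
Proof.
move=> bf; rewrite -mulN1r -ExZ//.
by apply: eq_Ex => w; rewrite mulN1r.
Qed.

Lemma Ex_cst (c : R) : Ex P (fun _ => c) = c.
Proof. by rewrite /Ex Rintegral_cst//; rewrite [X in fine X](probability_setT P) mulr1. Qed.

Lemma Ex_sum (I : Type) (r : seq I) (Q : pred I) (F : I -> T -> R) :
  (forall i, Q i -> bmeas (F i)) ->
  Ex P (fun w => \sum_(i <- r | Q i) F i w) = \sum_(i <- r | Q i) Ex P (F i).
Proof.
move=> h; elim: r => [|i r IH].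
  by rewrite big_nil -[RHS]Ex_cst; apply: eq_Ex => w; rewrite big_nil.
rewrite /= big_cons; case: ifPn => Qi.
  rewrite -IH -ExD; [|exact: h|exact: bmeas_sum].
  by apply: eq_Ex => w; rewrite /= big_cons Qi.
by rewrite -IH; apply: eq_Ex => w; rewrite /= big_cons (negbTE Qi).
Qed.

Lemma le_Ex f g : bmeas f -> bmeas g -> (forall w, f w <= g w) ->
  Ex P f <= Ex P g.
Proof. by move=> bf bg fg; apply: le_Rintegral => //; exact: bmeas_integrable. Qed.

Lemma Ex_ge0 f : (forall w, 0 <= f w) -> 0 <= Ex P f.
Proof. by move=> f0; apply: Rintegral_ge0. Qed.

Lemma Ex_norm f : bmeas f -> `|Ex P f| <= Ex P (fun w => `|f w|).
Proof. by move=> bf; apply: le_normr_Rintegral => //; exact: bmeas_integrable. Qed.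

Lemma Ex_bound f (C : R) : bmeas f -> (forall w, `|f w| <= C) -> `|Ex P f| <= C.
Proof.
move=> bf hC; rewrite (le_trans (Ex_norm bf))// -[leRHS](Ex_cst C).
by apply: le_Ex => //; [exact: bmeas_norm|exact: bmeas_cst].
Qed.

Lemma Ex_indic (A : set T) : measurable A -> Ex P (\1_A) = fine (P A).
Proof. by move=> mA; rewrite /Ex /Rintegral integral_indic// setIT. Qed.

(** Bounded convergence. That the limit is again [bmeas] is part of the conclusion, so that
    inductions over bounded limits can carry it along. *)
Lemma Ex_cvg (f_ : nat -> T -> R) f (C : R) :
  (forall n, measurable_fun setT (f_ n)) -> (forall n w, `|f_ n w| <= C) ->
  (forall w, f_ n w @[n --> \oo] --> f w) ->
  bmeas f /\ Ex P (f_ n) @[n --> \oo] --> Ex P f.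
Proof.
move=> mf_ hC f_f.
have mf : measurable_fun setT f.
  by apply: (measurable_fun_cvg (h := f_)) => // w _; exact: f_f.
have bf : bmeas f.
  split=> //; exists C => w.
  have hn : `|f_ n w| @[n --> \oo] --> `|f w| by apply: cvg_norm; exact: f_f.
  rewrite -(cvg_lim _ hn)//; apply: limr_le; first by apply: cvgP hn.
  by apply: nearW => n; exact: hC.
split=> //.
rewrite /Ex /Rintegral; apply: fine_cvg; rewrite fineK; last first.
  by apply: integrable_fin_num => //; exact: bmeas_integrable.
have := @dominated_cvg _ _ _ P setT measurableT
  (fun n w => (f_ n w)%:E) (EFin \o f) (cst C%:E).
apply => //.
- by move=> n; exact/measurable_EFinP.
- by move=> w _; apply: cvg_EFin; [exact: nearW|exact: f_f].
- by apply: bmeas_integrable; exact: bmeas_cst.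
- by move=> n w _; rewrite lee_fin.
Qed.

Lemma Ex_markov (f : T -> R) (A : set T) (a : R) : measurable A -> bmeas f ->
  0 < a -> (forall w, 0 <= f w) -> (forall w, A w -> a <= f w) ->
  fine (P A) <= Ex P f / a.
Proof.
move=> mA bf a0 f0 hA; rewrite ler_pdivlMr// mulrC -Ex_indic// -ExZ; last first.
  exact: bmeas_indic.
apply: le_Ex => //; first by apply: bmeasZ; exact: bmeas_indic.
move=> w; rewrite indicE; have [/set_mem/hA|_] := boolP (w \in A).
  by rewrite mulr1.
by rewrite mulr0.
Qed.

End Expectation.

(** * Trigonometric polynomials and their bounded limits *)

Section Closures.
Context (T : Type) (R : realType).
Implicit Types (f g : T -> R) (G S : (T -> R) -> Prop).

Inductive span G : (T -> R) -> Prop :=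
| span_gen f : G f -> span G f
| span_add f g : span G f -> span G g -> span G (fun x => f x + g x)
| span_scale (c : R) f : span G f -> span G (fun x => c * f x).

(** The closure is inductive because the indicator of a half-line is reached by three nested limits.
    An identity between expectations passes through each of them by bounded convergence, so this
    closure plays the part of a monotone class. *)
Inductive blim S : (T -> R) -> Prop :=
| blim_base f : S f -> blim S f
| blim_lim (C : R) (u : nat -> T -> R) f : (forall n, blim S (u n)) ->
    (forall n x, `|u n x| <= C) -> (forall x, u n x @[n --> \oo] --> f x) ->
    blim S f.

Definition mul_closed S := forall f g, S f -> S g -> S (fun x => f x * g x).

Lemma eq_span G f g : (forall x, f x = g x) -> span G g -> span G f.
Proof. by move=> /funext ->. Qed.

Lemma eq_blim S f g : (forall x, f x = g x) -> blim S g -> blim S f.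
Proof. by move=> /funext ->. Qed.

Lemma span_mul G : (forall f g, G f -> G g -> span G (fun x => f x * g x)) ->
  mul_closed (span G).
Proof.
move=> hG f g sf sg; elim: sf => {f} [f Gf|f1 f2 _ h1 _ h2|c f _ h].
- elim: sg => {g} [g Gg|g1 g2 _ h1 _ h2|c g _ h]; first exact: hG.
  + by apply: eq_span (span_add h1 h2) => x; rewrite mulrDr.
  + by apply: eq_span (span_scale c h) => x; rewrite mulrCA.
- by apply: eq_span (span_add h1 h2) => x; rewrite mulrDl.
- by apply: eq_span (span_scale c h) => x; rewrite mulrA.
Qed.

Lemma blim_bounded S : (forall f, S f -> exists C : R, forall x, `|f x| <= C) ->
  forall f, blim S f -> exists C : R, forall x, `|f x| <= C.
Proof.
move=> hS f; elim=> {f} [f /hS //|C u f _ _ hC uf]; exists C => x.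
have hn : `|u n x| @[n --> \oo] --> `|f x| by apply: cvg_norm; exact: uf.
rewrite -(cvg_lim _ hn)//; apply: limr_le; first by apply: cvgP hn.
by apply: nearW => n; exact: hC.
Qed.

(** Nested inductions: for [f] in [S] the limit is taken in [g], and the limit in [f] is then taken
    against every [g] of the closure. Boundedness of the factor held fixed keeps the products
    uniformly bounded. *)
Lemma blim_mul S : (forall f, S f -> exists C : R, forall x, `|f x| <= C) ->
  mul_closed S -> mul_closed (blim S).
Proof.
move=> bS mS f g bf; elim: bf g => {f} [f Sf g|C u f bu IH hC uf g bg].
  elim=> {g} [g Sg|C u g bu IH hC ug]; first exact/blim_base/mS.
  have [D hD] := bS _ Sf.
  apply: (@blim_lim S (D * C) (fun n x => f x * u n x)) => //.
    by move=> n x; rewrite normrM ler_pM.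
  by move=> x; apply: cvgMr; exact: ug.
have [D hD] := blim_bounded bS bg.
apply: (@blim_lim S (C * D) (fun n x => u n x * g x)) => //.
- by move=> n; exact: IH.
- by move=> n x; rewrite normrM ler_pM.
- by move=> x; apply: cvgMl; exact: uf.
Qed.

End Closures.

Section ClosureExpectation.
Context (R : realType).

Lemma span_bmeas (d : measure_display) (T : measurableType d)
    (G : (T -> R) -> Prop) :
  (forall f, G f -> bmeas f) -> forall f, span G f -> bmeas f.
Proof.
move=> hG f; elim=> {f} [f /hG //|f g _ bf _ bg|c f _ bf]; first exact: bmeasD.
exact: bmeasZ.
Qed.

Lemma blim_bmeas (d : measure_display) (T : measurableType d)
    (S : (T -> R) -> Prop) :
  (forall f, S f -> bmeas f) -> forall f, blim S f -> bmeas f.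
Proof.
move=> hS f bf.
have bS g : S g -> exists C : R, forall x, `|g x| <= C by move=> /hS[].
split; last exact: (blim_bounded bS bf).
elim: bf => {f} [f /hS[]//|C u f _ mu _ uf].
by apply: (measurable_fun_cvg (h := u)) => // x _; exact: uf.
Qed.

Section TwoLaws.
Context (T : Type) (d1 d2 : measure_display).
Context (T1 : measurableType d1) (T2 : measurableType d2).
Context (P1 : probability T1 R) (P2 : probability T2 R).
Context (X1 : T1 -> T) (X2 : T2 -> T).

Lemma span_eq_law (G : (T -> R) -> Prop) :
  (forall f, G f -> bmeas (f \o X1)) -> (forall f, G f -> bmeas (f \o X2)) ->
  (forall f, G f -> Ex P1 (f \o X1) = Ex P2 (f \o X2)) ->
  forall f, span G f ->
  [/\ bmeas (f \o X1), bmeas (f \o X2) & Ex P1 (f \o X1) = Ex P2 (f \o X2)].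
Proof.
move=> b1 b2 hG f; elim=> {f} [f Gf|f g _ [bf1 bf2 ef] _ [bg1 bg2 eg]|c f _ [bf1 bf2 ef]].
- by split; [exact: b1|exact: b2|exact: hG].
- split; [exact: bmeasD bf1 bg1|exact: bmeasD bf2 bg2|].
  by rewrite [LHS](ExD P1 bf1 bg1) ef eg [RHS](ExD P2 bf2 bg2).
- split; [exact: bmeasZ bf1|exact: bmeasZ bf2|].
  by rewrite [LHS](ExZ P1 c bf1) ef [RHS](ExZ P2 c bf2).
Qed.

(** With trigonometric polynomials for [S], this is how equal characteristic functions yield equal
    tail probabilities. The maps [X1] and [X2] let the two laws live on different spaces. *)
Lemma blim_eq_law (S : (T -> R) -> Prop) :
  (forall f, S f ->
    [/\ bmeas (f \o X1), bmeas (f \o X2) & Ex P1 (f \o X1) = Ex P2 (f \o X2)]) ->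
  forall f, blim S f ->
  [/\ bmeas (f \o X1), bmeas (f \o X2) & Ex P1 (f \o X1) = Ex P2 (f \o X2)].
Proof.
move=> hS f; elim=> {f} [f /hS//|C u f _ IH hC uf].
have [b1 c1] : bmeas (f \o X1) /\ Ex P1 (u n \o X1) @[n --> \oo] --> Ex P1 (f \o X1).
  apply: (@Ex_cvg _ _ _ P1 (fun n => u n \o X1) _ C) => [n|n w|w].
  - by have [[]] := IH n.
  - exact: hC.
  - exact: uf.
have [b2 c2] : bmeas (f \o X2) /\ Ex P2 (u n \o X2) @[n --> \oo] --> Ex P2 (f \o X2).
  apply: (@Ex_cvg _ _ _ P2 (fun n => u n \o X2) _ C) => [n|n w|w].
  - by have [_ []] := IH n.
  - exact: hC.
  - exact: uf.
split=> //; apply: cvg_unique c2 => //.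
apply: cvg_trans c1; apply: near_eq_cvg; apply: nearW => n.
by have [_ _ ->] := IH n.
Qed.

End TwoLaws.

Section Independence.
Context (d : measure_display) (T : measurableType d) (P : probability T R).
Implicit Types S G : (T -> R) -> Prop.

(** Independence as a factorisation of expectations: in this form both closures preserve it, in one
    argument at a time. *)
Definition indep_class S S' := forall f g, S f -> S' g ->
  Ex P (fun w => f w * g w) = Ex P f * Ex P g.

Lemma indep_classC S S' : indep_class S S' -> indep_class S' S.
Proof.
move=> h f g Sf Sg; rewrite mulrC -h//.
by apply: eq_Ex => w; rewrite mulrC.
Qed.

Let span_indepl G S : (forall f, G f -> bmeas f) -> (forall f, S f -> bmeas f) ->
  indep_class G S -> indep_class (span G) S.
Proof.
move=> bG bS h f g sf Sg; have bg := bS _ Sg.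
elim: sf => {f} [f Gf|f1 f2 s1 h1 s2 h2|c f sf hf]; first exact: h.
- have b1 := span_bmeas bG s1; have b2 := span_bmeas bG s2.
  rewrite ExD// mulrDl -h1 -h2 -ExD; [|exact: bmeasM|exact: bmeasM].
  by apply: eq_Ex => w; rewrite mulrDl.
- have bf := span_bmeas bG sf.
  rewrite ExZ// -mulrA -hf -ExZ; last exact: bmeasM.
  by apply: eq_Ex => w; rewrite mulrA.
Qed.

Lemma span_indep G G' :
  (forall f, G f -> bmeas f) -> (forall f, G' f -> bmeas f) ->
  indep_class G G' -> indep_class (span G) (span G').
Proof.
move=> bG bG' h; apply: span_indepl => //; first exact: span_bmeas.
by apply: indep_classC; apply: span_indepl => //; exact: indep_classC.
Qed.

Let blim_indepl S S' : (forall f, S f -> bmeas f) -> (forall f, S' f -> bmeas f) ->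
  indep_class S S' -> indep_class (blim S) S'.
Proof.
move=> bS bS' h f g sf Sg; have [mg [D hD]] := bS' _ Sg.
elim: sf => {f} [f Sf|C u f bu IH hC uf]; first exact: h.
have mu n : measurable_fun setT (u n) by apply/bmeas_measurable/(blim_bmeas bS).
have [bf cf] := Ex_cvg P mu hC uf.
have [_ cfg] : bmeas (fun w => f w * g w) /\ Ex P (fun w => u n w * g w) @[n --> \oo] --> Ex P (fun w => f w * g w).
  apply: (@Ex_cvg _ _ _ P (fun n w => u n w * g w) _ (C * D)) => [n|n w|w].
  - exact: measurable_funM.
  - by rewrite normrM ler_pM.
  - by apply: cvgMl; exact: uf.
apply: (cvg_unique _ cfg) => //.
rewrite (_ : (fun n => _) = fun n => Ex P (u n) * Ex P g); first exact: cvgMl.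
by apply/funext => n; exact: IH.
Qed.

Lemma blim_indep S S' :
  (forall f, S f -> bmeas f) -> (forall f, S' f -> bmeas f) ->
  indep_class S S' -> indep_class (blim S) (blim S').
Proof.
move=> bS bS' h; apply: blim_indepl => //; first exact: blim_bmeas.
by apply: indep_classC; apply: blim_indepl => //; exact: indep_classC.
Qed.

End Independence.
End ClosureExpectation.

(** * Sharpening a wave into a step by a polynomial *)

Section Sigmoid.
Context (R : realType).
Implicit Types u v z : R.

Definition smoothstep u : R := 3 * u ^+ 2 - 2 * u ^+ 3.

Lemma smoothstep_itv u : 0 <= u <= 1 -> 0 <= smoothstep u <= 1.
Proof.
move=> /andP[u0 u1]; rewrite /smoothstep.
have -> : 3 * u ^+ 2 - 2 * u ^+ 3 = u ^+ 2 * (3 - 2 * u) by ring.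
apply/andP; split; first by rewrite mulr_ge0 ?sqr_ge0//; lra.
have -> : u ^+ 2 * (3 - 2 * u) = 1 - (1 - u) ^+ 2 * (1 + 2 * u) by ring.
by rewrite lerBlDr lerDl mulr_ge0 ?sqr_ge0//; lra.
Qed.

Lemma smoothstep_onem u : smoothstep (1 - u) = 1 - smoothstep u.
Proof. by rewrite /smoothstep; ring. Qed.

Lemma iter_smoothstep_itv n u : 0 <= u <= 1 -> 0 <= iter n smoothstep u <= 1.
Proof. by move=> hu; elim: n => //= n IH; exact: smoothstep_itv. Qed.

Lemma iter_smoothstep_onem n u :
  iter n smoothstep (1 - u) = 1 - iter n smoothstep u.
Proof. by elim: n => //= n ->; rewrite smoothstep_onem. Qed.

Lemma iter_smoothstep_lo z : 0 <= z < 1 / 2 ->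
  exists2 r : R, 0 <= r < 1 &
    forall n u, 0 <= u <= z -> 0 <= iter n smoothstep u <= r ^+ n.
Proof.
move=> /andP[z0 z1]; exists (z * (3 - 2 * z)).
  by apply/andP; split; [rewrite mulr_ge0//; lra|nra].
set r := z * (3 - 2 * z).
have r0 : 0 <= r by rewrite mulr_ge0//; lra.
have r1 : r <= 1 by rewrite /r; nra.
move=> n u /andP[u0 uz].
suff /andP[/andP[h0 hz] hr] : (0 <= iter n smoothstep u <= z) &&
  (iter n smoothstep u <= r ^+ n) by rewrite h0.
elim: n => [|n /= /andP[/andP[h0 hz] hr]] /=.
  by rewrite u0 uz expr0/=; lra.
set v := iter n smoothstep u in h0 hz hr *.
have hv : smoothstep v <= r * v.
  have -> : smoothstep v = (v * (3 - 2 * v)) * v by rewrite /smoothstep; ring.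
  rewrite ler_wpM2r// /r -subr_ge0.
  have -> : z * (3 - 2 * z) - v * (3 - 2 * v) = (z - v) * (3 - 2 * (z + v)) by ring.
  by rewrite mulr_ge0//; lra.
have [|s0 _] := andP (@smoothstep_itv v _); first by apply/andP; split=> //; lra.
rewrite s0/= exprS; apply/andP; split.
  by rewrite (le_trans hv)// (le_trans _ hz)// ler_piMl.
by rewrite (le_trans hv)// ler_wpM2l.
Qed.

Lemma iter_smoothstep_hi z : 0 <= z < 1 / 2 ->
  exists2 r : R, 0 <= r < 1 &
    forall n u, 1 - z <= u <= 1 -> 1 - r ^+ n <= iter n smoothstep u <= 1.
Proof.
move=> /iter_smoothstep_lo[r hr h]; exists r => // n u /andP[u0 u1].
have /andP[h0 h1] : 0 <= iter n smoothstep (1 - u) <= r ^+ n.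
  by apply: h; apply/andP; split; lra.
move: h0 h1; rewrite iter_smoothstep_onem => h0 h1.
by apply/andP; split; lra.
Qed.

(* The cubic 3u^2 - 2u^3 attracts [0, 1/2[ to 0 and ]1/2, 1] to 1: iterating this
   polynomial turns a wave into a step and keeps trigonometric polynomials among
   themselves. *)
Lemma cvg_iter_smoothstep u : 0 <= u <= 1 ->
  iter n smoothstep u @[n --> \oo] -->
    (if u < 1 / 2 then 0 else if 1 / 2 < u then 1 else 1 / 2 : R).
Proof.
move=> /andP[u0 u1]; case: ltP => [ul|].
  have [|r /andP[r0 r1] h] := @iter_smoothstep_lo u; first by rewrite u0.
  apply: (@squeeze_cvgr _ _ _ _ (fun=> 0) (fun n => r ^+ n)).
  - by apply: nearW => n; apply: h; rewrite u0 lexx.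
  - exact: cvg_cst.
  - by apply: cvg_expr; rewrite ger0_norm.
rewrite le_eqVlt => /predU1P[<-|uh].
  rewrite ltxx (_ : (fun n => _) = fun=> 1 / 2); first exact: cvg_cst.
  apply/funext => n; elim: n => //= n ->; rewrite /smoothstep; field; lra.
rewrite uh.
have [|r /andP[r0 r1] h] := @iter_smoothstep_hi (1 - u).
  by apply/andP; split; lra.
apply: (@squeeze_cvgr _ _ _ _ (fun n => 1 - r ^+ n) (fun=> 1)).
- by apply: nearW => n; apply: h; apply/andP; split; lra.
- rewrite -[X in _ --> X]subr0; apply: cvgB; first exact: cvg_cst.
  by apply: cvg_expr; rewrite ger0_norm.
- exact: cvg_cst.
Qed.

End Sigmoid.

Section Trigonometric.
Context (T : Type) (R : realType).
Implicit Types (f g l : T -> R) (V : (T -> R) -> Prop).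

(** The free phase [th] covers sines as well, so that real functions do the work of complex
    exponentials. *)
Definition cosgen V f :=
  exists2 l, V l & exists th : R, f = fun w => cos (l w + th).

Definition trig V := span (cosgen V).

(** Sums and differences of phases are what the product-to-sum formula for cosines produces; the
    zero phase gives the constants. *)
Definition phase_space V :=
  [/\ V (fun _ => 0), forall f g, V f -> V g -> V (fun x => f x + g x)
    & forall f g, V f -> V g -> V (fun x => f x - g x)].

Lemma trig_mul V : phase_space V -> mul_closed (trig V).
Proof.
move=> [_ VD VB]; apply: span_mul => f g [l Vl [a ->]] [k Vk [b ->]].
have h1 : trig V (fun w => cos (l w + k w + (a + b))).
  by apply: span_gen; exists (fun w => l w + k w); [exact: VD|exists (a + b)].
have h2 : trig V (fun w => cos (l w - k w + (a - b))).
  by apply: span_gen; exists (fun w => l w - k w); [exact: VB|exists (a - b)].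
apply: eq_span (span_scale (1 / 2) (span_add h1 h2)) => x.
have -> : l x + k x + (a + b) = (l x + a) + (k x + b) by ring.
have -> : l x - k x + (a - b) = (l x + a) - (k x + b) by ring.
by move: (l x + a) (k x + b) => u v; rewrite cosD cosB; field.
Qed.

Lemma trig_cst V (c : R) : phase_space V -> trig V (fun _ => c).
Proof.
move=> [V0 _ _].
have h : trig V (fun w => cos (0 + 0)).
  by apply: span_gen; exists (fun _ => 0) => //; exists 0.
by apply: eq_span (span_scale c h) => x; rewrite addr0 cos0 mulr1.
Qed.

Lemma trig_bounded V f : trig V f -> exists C : R, forall x, `|f x| <= C.
Proof.
elim=> {f} [f [l _ [th ->]]|f g _ [C hC] _ [D hD]|c f _ [C hC]].
- by exists 1 => x; exact: cos_max.
- by exists (C + D) => x; rewrite (le_trans (ler_normD _ _))// lerD.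
- by exists (`|c| * C) => x; rewrite normrM ler_wpM2l.
Qed.

Lemma trig_iter V f n : phase_space V -> trig V f ->
  trig V (fun w => iter n (@smoothstep R) (f w)).
Proof.
move=> hV tf; elim: n => //= n IH.
set g := fun w => iter n _ (f w) in IH.
have h2 := trig_mul hV IH IH; have h3 := trig_mul hV h2 IH.
apply: eq_span (span_add (span_scale 3 h2) (span_scale (-2) h3)) => x.
by rewrite /smoothstep -/(g x); ring.
Qed.

(** At distance less than pi L from [c], this wave lies above 1/2 exactly to the right of [c]. *)
Definition wave (c L y : R) : R := (1 + sin ((y - c) / L)) / 2.

Lemma wave_itv c L y : 0 <= wave c L y <= 1.
Proof.
rewrite /wave; have := sin_geN1 ((y - c) / L); have := sin_le1 ((y - c) / L).
by move=> h1 h2; apply/andP; split; lra.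
Qed.

Lemma trig_wave V l (c L : R) : phase_space V ->
  (forall k : R, V (fun w => k * l w)) -> trig V (fun w => wave c L (l w)).
Proof.
move=> hV Vl.
have h : trig V (fun w => cos (L^-1 * l w + (- c / L - pi / 2))).
  by apply: span_gen; exists (fun w => L^-1 * l w) => //; exists (- c / L - pi / 2).
apply: eq_span (span_scale (1 / 2) (span_add (trig_cst 1 hV) h)) => x.
rewrite /wave -cosBpihalf.
have -> : (l x - c) / L - pi / 2 = L^-1 * l x + (- c / L - pi / 2) by ring.
by field.
Qed.

Let half_step (c y : R) : R :=
  if y < c then 0 else if c < y then 1 else 1 / 2.

(** Two successive limits: iterating the cubic turns the wave into a square wave, then letting its
    period grow sends every jump other than the one at [c] to infinity. The value 1/2 at [c] is the
    fixed point of the cubic between its two attractors. *)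
Let blim_half_step V l (c : R) : phase_space V ->
  (forall k : R, V (fun w => k * l w)) ->
  blim (trig V) (fun w => half_step c (l w)).
Proof.
move=> hV Vl.
pose lim1 (u : R) : R := if u < 1 / 2 then 0 else if 1 / 2 < u then 1 else 1 / 2.
have lim1_bnd u : `|lim1 u| <= 1.
  rewrite /lim1; case: ifP => _; first by rewrite normr0.
  by case: ifP => _; rewrite ?normr1// ger0_norm; lra.
apply: (@blim_lim _ _ _ 1 (fun k w => lim1 (wave c k.+1%:R (l w)))) => //.
  move=> k; apply: (@blim_lim _ _ _ 1
      (fun n w => iter n (@smoothstep R) (wave c k.+1%:R (l w)))).
  - by move=> n; apply: blim_base; apply: trig_iter => //; exact: trig_wave.
  - move=> n x; have /andP[h0 h1] := iter_smoothstep_itv n (wave_itv c k.+1%:R (l x)).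
    by rewrite ger0_norm.
  - by move=> x; apply: cvg_iter_smoothstep; exact: wave_itv.
move=> x; set y := l x.
apply: (@cvg_trans _ (half_step c y @[k --> \oo])); last exact: cvg_cst.
apply: near_eq_cvg.
have piy : \forall k \near \oo, `|y - c| < pi * (k.+1%:R : R).
  near=> k; rewrite mulrC -ltr_pdivrMr ?pi_gt0//.
  apply: (@lt_le_trans _ _ k%:R); last by rewrite ler_nat.
  near: k; exact: nbhs_infty_gtr.
near=> k.
have hk : `|y - c| < pi * (k.+1%:R : R) by near: k.
have k0 : (0 : R) < k.+1%:R by rewrite ltr0n.
rewrite /half_step /lim1 /wave.
case: (ltgtP y c) => yc.
- have s0 : 0 < sin ((c - y) / k.+1%:R).
    apply: sin_gt0_pi; rewrite divr_gt0 ?subr_gt0//= ltr_pdivrMr//.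
    by move: hk; rewrite distrC gtr0_norm// subr_gt0.
  have sE : sin ((y - c) / k.+1%:R) = - sin ((c - y) / k.+1%:R).
    by rewrite -sinN -mulNr opprB.
  by rewrite sE ifT//; lra.
- have s0 : 0 < sin ((y - c) / k.+1%:R).
    apply: sin_gt0_pi; rewrite divr_gt0 ?subr_gt0//= ltr_pdivrMr//.
    by move: hk; rewrite gtr0_norm// subr_gt0.
  have h1 : ((1 + sin ((y - c) / k.+1%:R)) / 2 < 1 / 2 :> R) = false.
    by apply/negbTE; rewrite -leNgt; lra.
  by rewrite h1 ifT//; lra.
- by rewrite yc subrr mul0r sin0 addr0 ltxx.
Unshelve. all: by end_near. Qed.

Lemma blim_step V l (c : R) : phase_space V ->
  (forall k : R, V (fun w => k * l w)) ->
  blim (trig V) (fun w => ((c <= l w)%R)%:R).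
Proof.
move=> hV Vl.
(* Approaching [c] from the left puts [c] itself strictly above each jump, so the limit is 1 there
   instead of 1/2. *)
apply: (@blim_lim _ _ _ 1 (fun k w => half_step (c - k.+1%:R^-1) (l w))).
- by move=> k; exact: blim_half_step.
- move=> k x; rewrite /half_step; case: ifP => _; first by rewrite normr0.
  by case: ifP => _; rewrite ?normr1// ger0_norm; lra.
move=> x; set y := l x.
apply: (@cvg_trans _ (((c <= y)%R)%:R @[k --> \oo])); last exact: cvg_cst.
apply: near_eq_cvg.
have [cy|yc] := leP c y.
  apply: nearW => k.
  have : (0 : R) < k.+1%:R^-1 by rewrite invr_gt0 ltr0n.
  rewrite /half_step; move: (k.+1%:R^-1) => e e0.
  have h1 : (y < c - e) = false by apply/negbTE; rewrite -leNgt; lra.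
  have h2 : c - e < y by lra.
  by rewrite h1 h2.
near=> k.
have hk : (c - y)^-1 < k.+1%:R :> R.
  apply: (@lt_le_trans _ _ k%:R); last by rewrite ler_nat.
  near: k; exact: nbhs_infty_gtr.
rewrite /half_step ifT//.
have : k.+1%:R^-1 < c - y by rewrite invf_plt ?posrE ?subr_gt0 ?ltr0n.
by move: (k.+1%:R^-1) => e he; lra.
Unshelve. all: by end_near. Qed.

End Trigonometric.

(** * The characteristic function of the normal law *)

Section GaussianODE.
Context (R : realType).

Lemma is_derive_affine (a b x : R) : is_derive x 1 (fun y : R => y * a + b) a.
Proof.
have h : is_derive x 1 (a *: (@id R^o) + cst b) (a *: 1 + 0 : R^o).
  by apply: is_deriveD.
rewrite addr0 /GRing.scale/= mulr1 in h.
rewrite (_ : (fun y => _) = (a *: (@id R^o) + cst b))//.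
by apply/funext => y; rewrite mulrC.
Qed.

Lemma is_derive_cos_affine (a b x : R) :
  is_derive x 1 (fun y : R => cos (y * a + b)) (- (a * sin (x * a + b))).
Proof.
have := @is_derive1_comp R cos (fun y : R => y * a + b) x _ _
  (is_derive_cos _) (is_derive_affine a b x).
by rewrite mulNr [sin _ * a]mulrC.
Qed.

Lemma is_derive_sin_affine (a b x : R) :
  is_derive x 1 (fun y : R => sin (y * a + b)) (a * cos (x * a + b)).
Proof.
have := @is_derive1_comp R sin (fun y : R => y * a + b) x _ _
  (is_derive_sin _) (is_derive_affine a b x).
by rewrite [cos _ * a]mulrC.
Qed.

Lemma is_deriveM' (f g : R -> R) (x df dg : R) :
  is_derive x 1 f df -> is_derive x 1 g dg ->
  is_derive x 1 (fun y => f y * g y) (df * g x + f x * dg).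
Proof.
move=> hf hg; have h := is_deriveM hf hg.
by apply: is_derive_eq h _; rewrite /GRing.scale/=; ring.
Qed.

Lemma is_derive_exp_sqr (a x : R) :
  is_derive x 1 (fun y : R => expR (a * y ^+ 2)) (2 * a * x * expR (a * x ^+ 2)).
Proof.
have hq : is_derive x 1 (fun y : R => a * y ^+ 2) (a * (2 * x)).
  have h := is_deriveM' (is_derive_affine a 0 x) (is_derive_affine 1 0 x).
  rewrite (_ : (fun y => _) = (fun y : R => (y * a + 0) * (y * 1 + 0))).
    by apply: is_derive_eq h _; ring.
  by apply/funext => y; ring.
have := @is_derive1_comp R expR (fun y : R => a * y ^+ 2) x _ _
  (is_derive_expR _) hq.
by move=> h; apply: is_derive_eq h _; ring.
Qed.

(* [F e^{v t^2/2}] has derivative at most [K e^{v t^2/2}]. *)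
Lemma gauss_ode (F F' : R -> R) (v K T : R) : 0 <= v -> 0 <= T ->
  (forall t : R, is_derive t 1 F (F' t)) ->
  (forall t : R, 0 <= t <= T -> `|F' t + v * t * F t| <= K) ->
  `|F T - F 0 * expR (- (v * T ^+ 2 / 2))| <= K * T.
Proof.
move=> v0 T0 dF hK.
pose G t := F t * expR (v / 2 * t ^+ 2).
have dG (t : R) : is_derive t 1 G ((F' t + v * t * F t) * expR (v / 2 * t ^+ 2)).
  apply: is_derive_eq (is_deriveM' (dF t) (is_derive_exp_sqr (v / 2) t)) _.
  by field.
have cG : {within `[0, T], continuous G}.
  apply: derivable_within_continuous => t _.
  by have [] := dG t.
have [c c0T] := MVT_segment T0 (fun t _ => dG t) cG.
move: c0T; rewrite in_itv/= => /andP[c0 cT].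
rewrite /G expr0n/= mulr0 expR0 mulr1 subr0 => GT.
set E := expR (v / 2 * T ^+ 2) in GT.
have E0 : 0 < E by exact: expR_gt0.
have -> : expR (- (v * T ^+ 2 / 2)) = E^-1.
  by rewrite -expRN; congr expR; ring.
have -> : F T - F 0 * E^-1 = (F T * E - F 0) / E by rewrite mulrBl mulfK ?gt_eqF.
rewrite GT normrM (gtr0_norm (_ : 0 < E^-1)) ?invr_gt0// ler_pdivrMr//.
rewrite normrM (ger0_norm T0) [leRHS]mulrAC; apply: ler_wpM2r => //.
rewrite normrM (gtr0_norm (expR_gt0 _)); apply: ler_pM => //.
  by apply: hK; rewrite c0.
by rewrite ler_expR ler_wpM2l ?divr_ge0// lerXn2r.
Qed.

End GaussianODE.

Section NormalCharacteristicFunction.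
Context (R : realType).
Local Notation mu := (@lebesgue_measure R).

(** The Radon-Nikodym derivative and [normal_pdf] have the same integral over every measurable set,
    hence agree almost everywhere. *)
Lemma integral_normal_prob (m s : R) (f : R -> \bar R) :
  (normal_prob m s).-integrable setT f ->
  (\int[normal_prob m s]_x f x = \int[mu]_x (f x * (normal_pdf m s x)%:E))%E.
Proof.
move=> intf; have mf := measurable_int _ intf.
rewrite -(Radon_Nikodym_change_of_variables (normal_prob_dominates m s))//.
apply: ae_eq_integral => //.
- apply: emeasurable_funM => //; apply: (measurable_int mu).
  by apply: Radon_Nikodym_integrable; exact: normal_prob_dominates.
- apply: emeasurable_funM => //=; apply/measurableT_comp => //=.
  exact: measurable_normal_pdf.
- apply: ae_eqe_mul2l => /=.
  rewrite Radon_NikodymE//=; first exact: normal_prob_dominates.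
  move=> dom; case: cid => /= h [h1 h2 h3].
  apply: integral_ae_eq => //=.
  + by apply/measurableT_comp =>//; exact: measurable_normal_pdf.
  + by move=> E E01 mE; rewrite -h3.
Qed.

Lemma Ex_normal_prob (m s : R) (f : R -> R) : bmeas (f : measurableTypeR R -> R) ->
  Ex (normal_prob m s) f = \int[mu]_x (f x * normal_pdf m s x).
Proof.
move=> bf; rewrite /Ex /Rintegral integral_normal_prob//.
exact: (bmeas_integrable (normal_prob m s) bf).
Qed.

Context (s : R) (s0 : 0 < s).
Let p := normal_pdf 0 s.
Let v := s ^+ 2.
Let v0 : 0 < v. Proof. exact: exprn_gt0. Qed.

Let pE x : p x = normal_peak s * expR (- (2 * v)^-1 * x ^+ 2).
Proof.
rewrite /p normal_pdfE ?gt_eqF// /normal_fun subr0; congr (_ * expR _).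
by rewrite mulNr mulrC -mulNr -mulr_natl invrM ?unitfE ?gt_eqF//; field; rewrite gt_eqF.
Qed.

Let p_ge0 x : 0 <= p x. Proof. exact: normal_pdf_ge0. Qed.

Let integrable_p : mu.-integrable setT (EFin \o p).
Proof. exact: integrable_normal_pdf. Qed.

Let mp : measurable_fun setT p. Proof. exact: measurable_normal_pdf. Qed.

Let integrable_xp : mu.-integrable setT (fun x => (`|x| * p x)%:E).
Proof.
(* Half of the Gaussian exponent is kept as a density of variance 2v. The other half absorbs |x| <=
   1 + x^2: with y = x^2 / (4v), both 1 and y are at most exp(y), whence the factor 1 + 4v. *)
pose s' := Num.sqrt 2 * s.
have s'0 : 0 < s' by rewrite mulr_gt0// sqrtr_gt0.
pose C := (1 + 4 * v) * (normal_peak s / normal_peak s').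
apply: (@le_integrable _ _ _ mu _ measurableT _
  (fun x => (C * normal_pdf 0 s' x)%:E)).
- apply/measurable_EFinP; apply: measurable_funM => //.
- move=> x _; rewrite /= lee_fin.
  have C0 : 0 <= C.
    rewrite mulr_ge0// ?divr_ge0 ?normal_peak_ge0//.
    by rewrite addr_ge0// mulr_ge0// ltW.
  rewrite (ger0_norm (_ : 0 <= `|x| * p x)) ?mulr_ge0//.
  have CC : 0 <= C * normal_pdf 0 s' x by apply: mulr_ge0 => //; exact: normal_pdf_ge0.
  rewrite (ger0_norm CC).
  rewrite normal_pdfE ?gt_eqF// pE /C /normal_fun subr0.
  have q0 := @normal_peak_gt0 R s' (lt0r_neq0 s'0).
  have -> : (1 + 4 * v) * (normal_peak s / normal_peak s') *
     (normal_peak s' * expR (- x ^+ 2 / (s' ^+ 2 *+ 2))) =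
     normal_peak s * ((1 + 4 * v) * expR (- x ^+ 2 / (s' ^+ 2 *+ 2))).
    by field; rewrite gt_eqF.
  rewrite mulrCA ler_wpM2l ?normal_peak_ge0//.
  have -> : - x ^+ 2 / (s' ^+ 2 *+ 2) = - (4 * v)^-1 * x ^+ 2.
    rewrite /s' exprMn sqr_sqrtr// -/v -mulr_natl.
    by field; rewrite gt_eqF.
  have -> : - (2 * v)^-1 * x ^+ 2 = - (4 * v)^-1 * x ^+ 2 - (4 * v)^-1 * x ^+ 2.
    by field; rewrite gt_eqF.
  rewrite !mulNr expRD [leLHS]mulrA; apply: ler_wpM2r; first exact: expR_ge0.
  rewrite expRN ler_pdivrMr ?expR_gt0//.
  set y := (4 * v)^-1 * x ^+ 2.
  have hx : x ^+ 2 = 4 * v * y by rewrite /y mulrA divff ?mul1r// gt_eqF// mulr_gt0.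
  have y0 : 0 <= y by rewrite mulr_ge0 ?sqr_ge0// invr_ge0 mulr_ge0// ltW.
  have ye : 1 + y <= expR y by exact: expR_ge1Dx.
  have xle : `|x| <= 1 + x ^+ 2.
    rewrite -real_normK ?num_real//; have := normr_ge0 x; nra.
  apply: (le_trans xle); rewrite hx.
  have v4 : 0 <= 4 * v by rewrite mulr_ge0// ltW.
  rewrite [leRHS]mulrDl mul1r; apply: lerD.
    by apply: le_trans ye; rewrite lerDl.
  by apply: ler_wpM2l => //; apply: le_trans ye; rewrite lerDr.
- exact: (integrableZl measurableT C (integrable_normal_pdf 0 s')).
Qed.

Let mlin t th : measurable_fun [set: R] (fun x : R => t * x + th).
Proof.
by apply: measurable_funD => //; apply: measurable_funM.
Qed.

Let mcos t th : measurable_fun [set: R] (fun x : R => cos (t * x + th)).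
Proof. exact: bmeas_measurable (bmeas_cos (mlin t th)). Qed.

Let msin t th : measurable_fun [set: R] (fun x : R => sin (t * x + th)).
Proof. exact: bmeas_measurable (bmeas_sin (mlin t th)). Qed.

Let icos t th : mu.-integrable setT (fun x => (cos (t * x + th) * p x)%:E).
Proof.
apply: (@le_integrable _ _ _ mu _ measurableT _ (EFin \o p)) => //.
  by apply/measurable_EFinP; apply: measurable_funM; [exact: mcos|exact: mp].
by move=> x _; rewrite /= lee_fin normrM; apply: ler_piMl => //; exact: cos_max.
Qed.

Let isin t th : mu.-integrable setT (fun x => (x * sin (t * x + th) * p x)%:E).
Proof.
apply: (@le_integrable _ _ _ mu _ measurableT _ (fun x => (`|x| * p x)%:E)) => //.
  apply/measurable_EFinP; apply: measurable_funM; last exact: mp.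
  by apply: measurable_funM; [exact: measurable_id|exact: msin].
move=> x _; rewrite /= lee_fin !normrM normr_id; apply: ler_wpM2r => //.
by apply: ler_piMr => //; exact: sin_max.
Qed.

Let phi th t : R := \int[mu]_x (cos (t * x + th) * p x).
Let phi' th t : R := \int[mu]_x (- (x * sin (t * x + th) * p x)).

Let dphi th (t : R) : is_derive t 1 (phi th) (phi' th t).
Proof.
have d1 (a x : R) : is_derive a 1 (fun t : R => cos (t * x + th) * p x)
    (- (x * sin (a * x + th) * p x)).
  have h := is_deriveM' (is_derive_cos_affine x th a) (is_derive_cst (p x) a 1).
  by apply: is_derive_eq h _; rewrite /= mulr0 addr0 mulNr.
have I0 : `]t - 1, t + 1[%classic t by rewrite /= in_itv/=; lra.
pose f (t x : R) := cos (t * x + th) * p x.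
have e1 a x : partial1of2 f a x = - (x * sin (a * x + th) * p x).
  by rewrite partial1of2E; have [_ ->] := d1 a x.
have hub a x : `|partial1of2 f a x| <= `|x| * p x.
  rewrite e1 normrN !normrM (ger0_norm (p_ge0 x)) ler_wpM2r// ler_piMr//.
  exact: sin_max.
have hder a x : derivable (f ^~ x) a 1 by have [] := d1 a x.
have hg0 x : 0 <= `|x| * p x by rewrite mulr_ge0.
have hD := @derivable_under_integral R _ _ mu f setT measurableT t _ _ I0
  (fun a _ => icos a th) (fun a x _ _ => hder a x) _ hg0 integrable_xp
  (fun a x _ _ => hub a x).
have hE := @differentiation_under_integral R _ _ mu f setT measurableT t _ _ I0
  (fun a _ => icos a th) (fun a x _ _ => hder a x) _ hg0 integrable_xp
  (fun a x _ _ => hub a x).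
apply: DeriveDef; first exact: hD.
rewrite -derive1E hE; apply: eq_Rintegral => x _; exact: e1.
Qed.

(** Gaussian integration by parts: p' = - x p / v, so the derivative of sin(t x + th) p(x) combines
    both integrals, and its integral over the line is zero because p vanishes at infinity. *)
Let by_parts th t : phi' th t = - (v * t * phi th t).
Proof.
pose G (x : R) := sin (x * t + th) * p x.
pose g (x : R) := t * (cos (t * x + th) * p x) - v^-1 * (x * sin (t * x + th) * p x).
have dp (x : R) : is_derive x 1 p (- (v^-1 * x * p x)).
  rewrite (_ : p = fun x => normal_peak s * expR (- (2 * v)^-1 * x ^+ 2)); last first.
    by apply/funext => y; exact: pE.
  have h := is_deriveM' (is_derive_cst (normal_peak s) x 1)
    (is_derive_exp_sqr (- (2 * v)^-1) x).
  apply: is_derive_eq h _; rewrite /= mul0r add0r.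
  by move: (expR _) => e; field; rewrite gt_eqF.
have dG (x : R) : is_derive x 1 G (g x).
  have h := is_deriveM' (is_derive_sin_affine t th x) (dp x).
  by apply: is_derive_eq h _; rewrite /g [x * t]mulrC; ring.
have ig : mu.-integrable setT (EFin \o g).
  rewrite /g /comp; under eq_fun do rewrite EFinB.
  by apply: integrableB => //; under eq_fun do rewrite EFinM; exact: integrableZl.
have cg : continuous g.
  have clin : continuous (fun x : R => t * x + th).
    by move=> x; apply: cvgD; [apply: cvgM; [exact: cvg_cst|exact: cvg_id]|exact: cvg_cst].
  have cp : continuous p by apply: continuous_normal_pdf; rewrite gt_eqF.
  have ccos : continuous (fun x : R => cos (t * x + th)).
    move=> x; apply: (@cvg_comp _ _ _ (fun x : R => t * x + th) (@cos R)); first exact: clin.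
    exact: continuous_cos.
  have csin : continuous (fun x : R => sin (t * x + th)).
    move=> x; apply: (@cvg_comp _ _ _ (fun x : R => t * x + th) (@sin R)); first exact: clin.
    exact: continuous_sin.
  move=> x; apply: cvgB.
    by apply: cvgM; [exact: cvg_cst|apply: cvgM; [exact: ccos|exact: cp]].
  apply: cvgM; first exact: cvg_cst.
  by apply: cvgM; [apply: cvgM; [exact: cvg_id|exact: csin]|exact: cp].
have FTC n : (\int[mu]_(x in `[(- n.+1%:R)%R, n.+1%:R]) (g x)%:E =
    (G n.+1%:R)%:E - (G (- n.+1%:R))%:E)%E.
  apply: continuous_FTC2.
  - by rewrite -subr_gt0 opprK addr_gt0.
  - exact: continuous_subspaceT.
  - have cG : continuous G.
      move=> x; apply/differentiable_continuous/derivable1_diffP.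
      by have [] := dG x.
    split=> [x _|//|//].
    + by have [] := dG x.
    + by apply: cvg_at_right_filter; exact: cG.
    + by apply: cvg_at_left_filter; exact: cG.
  - by move=> x _; rewrite derive1E; have [_ ->] := dG x.
pose D (n : nat) : set R := `[- n.+1%:R, n.+1%:R]%classic.
have mD n : measurable (D n) by exact: measurable_itv.
pose gn (n : nat) : R -> R := g \_ (D n).
have lim1 : (\int[mu]_x (gn n x)%:E @[n --> \oo] --> \int[mu]_x (g x)%:E)%E.
  have := @dominated_cvg _ _ _ mu setT measurableT
    (fun n x => (gn n x)%:E) (EFin \o g) (fun x => `|g x|%:E).
  apply => //.
  - move=> n; apply/measurable_EFinP.
    have mg : measurable_fun (D n) g.
      by apply: measurable_funTS; exact: continuous_measurable_fun.
    by have [h _] := @measurable_restrictT _ _ R R _ g (mD n); exact: h.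
  - move=> x _; apply: cvg_EFin; first exact: nearW.
    apply: (@cvg_trans _ (g x @[_ --> \oo])); last exact: cvg_cst.
    apply: near_eq_cvg; near=> n.
    rewrite /= /gn patchE mem_set// /D /= in_itv/= -ler_norml.
    apply: (@le_trans _ _ n%:R); last by rewrite ler_nat.
    by apply/ltW; near: n; exact: nbhs_infty_gtr.
  - exact: integrable_norm ig.
  - move=> n x _; rewrite lee_fin /gn patchE.
    by case: ifP => // _; rewrite normr0.
have e2 n : (\int[mu]_x (gn n x)%:E = (G n.+1%:R - G (- n.+1%:R))%:E)%E.
  rewrite EFinB -FTC [RHS]integral_mkcond; apply: eq_integral => x _.
  by rewrite restrict_EFin.
have Gb x : `|G x| <= p x.
  by rewrite normrM (ger0_norm (p_ge0 x)) ler_piMl// sin_max.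
(* The inequality 1 + y <= exp(y) already gives decay of order 1/n, enough for the boundary
   terms. *)
have pb n : p n.+1%:R <= normal_peak s * (2 * v) * n.+1%:R^-1.
  rewrite pE -mulrA ler_wpM2l ?normal_peak_ge0// mulNr expRN.
  have n0 : (0 : R) < n.+1%:R by rewrite ltr0n.
  have hE : n.+1%:R / (2 * v) <= expR ((2 * v)^-1 * n.+1%:R ^+ 2).
    apply: (@le_trans _ _ ((2 * v)^-1 * n.+1%:R ^+ 2)).
      rewrite mulrC; apply: ler_wpM2l; first by rewrite invr_ge0 ltW// mulr_gt0.
      by rewrite expr2; apply: ler_peMl; [exact: ltW|rewrite ler1n].
    by apply: le_trans (expR_ge1Dx _); rewrite lerDr.
  rewrite invf_ple ?posrE ?expR_gt0 ?mulr_gt0 ?invr_gt0//.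
  by rewrite invrM ?unitfE ?gt_eqF ?invr_gt0 ?mulr_gt0// invrK mulrC mulrC.
have pN x : p (- x) = p x by rewrite !pE sqrrN.
have lim2 : (G n.+1%:R - G (- n.+1%:R)) @[n --> \oo] --> (0 : R).
  apply: norm_cvg0.
  apply: (@squeeze_cvgr _ _ _ _ (fun=> 0)
    (fun n => 2 * (normal_peak s * (2 * v)) * n.+1%:R^-1)).
  - apply: nearW => n; rewrite normr_ge0/= (le_trans (ler_normB _ _))//.
    have := Gb n.+1%:R; have := Gb (- n.+1%:R); have := pb n; rewrite pN.
    by move: (n.+1%:R^-1) => e; lra.
  - exact: cvg_cst.
  - rewrite -[X in _ --> X](mulr0 (2 * (normal_peak s * (2 * v)))).
    by apply: cvgMr; exact: cvg_harmonic.
have I0 : (\int[mu]_x (g x)%:E = 0)%E.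
  apply: (cvg_unique _ lim1) => //.
  apply: (@cvg_trans _ ((G n.+1%:R - G (- n.+1%:R))%:E @[n --> \oo])).
    by apply: near_eq_cvg; apply: nearW => n; rewrite e2.
  by apply: cvg_EFin; [exact: nearW|exact: lim2].
pose J := \int[mu]_x (x * sin (t * x + th) * p x).
have h : t * phi th t - v^-1 * J = 0.
  have <- := @RintegralZl _ _ R mu setT (fun x => cos (t * x + th) * p x) t measurableT (icos t th).
  have <- := @RintegralZl _ _ R mu setT (fun x => x * sin (t * x + th) * p x) v^-1 measurableT (isin t th).
  rewrite -RintegralB//; first by rewrite /Rintegral I0.
  - exact: (integrableZl measurableT t (icos t th)).
  - exact: (integrableZl measurableT v^-1 (isin t th)).
have -> : phi' th t = - J.
  rewrite /phi' -mulN1r.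
  have <- := @RintegralZl _ _ R mu setT (fun x => x * sin (t * x + th) * p x) (-1) measurableT (isin t th).
  by apply: eq_Rintegral => x _; rewrite mulN1r.
congr (- _); move/subr0_eq: h => h.
by rewrite -mulrA h mulrA divff ?mul1r ?gt_eqF.
Unshelve. all: by end_near. Qed.

(** By [by_parts] the differential equation holds exactly, so [gauss_ode] applies with [K = 0]; it
    runs forward from 0, and evenness of the cosine reduces negative [t] to this case. *)
Lemma Ex_cos_normal_prob (t th : R) :
  Ex (normal_prob 0 s) (fun x => cos (t * x + th)) =
  cos th * expR (- (v * t ^+ 2 / 2)).
Proof.
wlog t0 : t th / 0 <= t.
  move=> H; have [/H//|t0] := leP 0 t.
  have := H (- t) (- th); rewrite oppr_ge0 (ltW t0) cosN sqrrN => <-//.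
  by apply: eq_Ex => x; rewrite -cosN; congr cos; ring.
rewrite Ex_normal_prob; last first.
  by apply: bmeas_cos; exact: (mlin t th).
have h := @gauss_ode R (phi th) (phi' th) v 0 t (ltW v0) t0 (dphi th) _.
have : `|phi th t - phi th 0 * expR (- (v * t ^+ 2 / 2))| <= 0 * t.
  by apply: h => u _; rewrite by_parts addrC subrr normr0.
rewrite mul0r normr_le0 subr_eq0 => /eqP; rewrite -/(phi th t) => ->.
congr (_ * _); rewrite /phi.
under eq_Rintegral do rewrite mul0r add0r.
rewrite RintegralZl//.
by rewrite [X in _ * X](_ : _ = 1) ?mulr1// /Rintegral integral_normal_pdf.
Qed.

End NormalCharacteristicFunction.

(** The point mass at [v = 0] obeys the same formula, so degenerate linear combinations need no
    separate treatment later. *)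
Lemma Ex_cos_normal_law (R : realType) (v t th : R) : 0 <= v ->
  Ex (normal_law 0 v) (fun x => cos (t * x + th)) =
  cos th * expR (- (v * t ^+ 2 / 2)).
Proof.
rewrite le_eqVlt => /predU1P[<-|v0]; rewrite /normal_law.
  rewrite eqxx !mul0r oppr0 expR0 mulr1 /Ex /Rintegral.
  rewrite integral_dirac//=; last first.
    apply/measurable_EFinP; apply: bmeas_measurable; apply: bmeas_cos.
    by apply: measurable_funD => //; apply: measurable_funM.
  by rewrite indicT mul1r mulr0 add0r.
rewrite gt_eqF// Ex_cos_normal_prob ?sqrtr_gt0// sqr_sqrtr// ltW//.
Qed.

(** * Convergence in distribution *)

Section MeasurableSets.
Context (d : measure_display) (T : measurableType d) (R : realType).
Implicit Types f g : T -> R.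

Lemma measurable_set_bool (b : T -> bool) : measurable_fun setT b ->
  measurable [set w | b w].
Proof.
move=> mb; have := mb measurableT [set true] I; rewrite setTI.
by congr measurable; apply/seteqP; split => w.
Qed.

Lemma measurable_set_lt f g : measurable_fun setT f -> measurable_fun setT g ->
  measurable [set w | f w < g w].
Proof. by move=> mf mg; apply: measurable_set_bool; exact: measurable_fun_ltr. Qed.

Lemma measurable_set_le f g : measurable_fun setT f -> measurable_fun setT g ->
  measurable [set w | f w <= g w].
Proof. by move=> mf mg; apply: measurable_set_bool; exact: measurable_fun_ler. Qed.

End MeasurableSets.

Section Levy.
Context (R : realType).

Definition line_phase (f : R -> R) : Prop := exists t : R, f = fun x => t * x.

Lemma phase_space_line : phase_space line_phase.
Proof.
split=> [|f g [a ->] [b ->]|f g [a ->] [b ->]].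
- by exists 0; apply/funext => x; rewrite mul0r.
- by exists (a + b); apply/funext => x; rewrite mulrDl.
- by exists (a - b); apply/funext => x; rewrite mulrBl.
Qed.

Lemma le_sin (x y : R) : - (pi / 2) <= x -> x <= y -> y <= pi / 2 -> sin x <= sin y.
Proof.
move=> hx; rewrite le_eqVlt => /predU1P[->//|xy] hy.
apply/ltW; rewrite ltr_sin// in_itv/=.
- by rewrite hx (le_trans (ltW xy)).
- by rewrite hy (le_trans hx (ltW xy)).
Qed.

(** On a bounded window one finite trigonometric polynomial already imitates a decreasing step: the
    gap between [a] and [b] keeps the wave away from 1/2 on both sides, and finitely many iterations
    of the cubic do the rest. *)
Lemma trig_approx_step (a b delta K : R) : a < b -> 0 < delta -> 0 < K ->
  exists2 f : R -> R, trig line_phase f &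
    [/\ forall y, 0 <= f y <= 1,
        forall y, `|y| <= K -> y <= a -> 1 - delta <= f y
      & forall y, `|y| <= K -> b <= y -> f y <= delta].
Proof.
move=> ab delta0 K0.
pose c := (a + b) / 2.
(* This scale keeps (y - c) / L in [-1, 1] for |y| <= K, hence in [-pi/2, pi/2], where the sine
   increases. *)
pose L := K + `|c| + (b - a).
have c0 := normr_ge0 c.
have L0 : 0 < L by rewrite /L; lra.
have pi1 := @pihalf_ge1 R.
pose q := (b - a) / 2 / L.
have q1 : q < 1 by rewrite /q ltr_pdivrMr// mul1r /L; lra.
have q0 : 0 < q by rewrite divr_gt0//; lra.
pose s0 := sin q.
have s00 : 0 < s0 by apply: sin_gt0_pihalf; rewrite q0/= (lt_le_trans q1).
have s01 : s0 <= 1 by exact: sin_le1.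
have Lb y : `|y| <= K -> -1 <= (y - c) / L <= 1.
  rewrite ler_norml => /andP[y1 y2].
  rewrite ler_pdivlMr// ler_pdivrMr// mul1r mulN1r /L.
  have := ler_norm c; have := ler_norm (- c); rewrite normrN => h1 h2.
  by apply/andP; split; lra.
have hlo y : `|y| <= K -> y <= a -> sin ((y - c) / L) <= - s0.
  move=> yK ya; rewrite /s0 -sinN; have /andP[h1 h2] := Lb y yK.
  have h : (y - c) / L <= - q.
    rewrite /q -[leRHS]mulNr; apply: ler_wpM2r; first by rewrite invr_ge0 ltW.
    by rewrite /c; lra.
  by apply: le_sin; lra.
have hhi y : `|y| <= K -> b <= y -> s0 <= sin ((y - c) / L).
  move=> yK yb; rewrite /s0; have /andP[h1 h2] := Lb y yK.
  have h : q <= (y - c) / L.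
    by apply: ler_wpM2r; [rewrite invr_ge0 ltW|rewrite /c; lra].
  by apply: le_sin; lra.
have hz : 0 <= (1 - s0) / 2 < 1 / 2 by apply/andP; split; lra.
have [r /andP[r0 r1] hr] := iter_smoothstep_lo hz.
have [r' /andP[r'0 r'1] hr'] := iter_smoothstep_hi hz.
have [n [hn hn']] : exists n : nat, r ^+ n <= delta /\ r' ^+ n <= delta.
  have cr : r ^+ n @[n --> \oo] --> (0 : R) by apply: cvg_expr; rewrite ger0_norm.
  have cr' : r' ^+ n @[n --> \oo] --> (0 : R) by apply: cvg_expr; rewrite ger0_norm.
  near \oo => n; exists n; split.
  - near: n; move/cvgr0_norm_le: cr => /(_ _ delta0).
    by apply: filterS => m /=; apply: le_trans; exact: ler_norm.
  - near: n; move/cvgr0_norm_le: cr' => /(_ _ delta0).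
    by apply: filterS => m /=; apply: le_trans; exact: ler_norm.
pose g y := iter n (@smoothstep R) (wave c L y).
have tg : trig line_phase g.
  apply: trig_iter; first exact: phase_space_line.
  apply: (@trig_wave _ _ _ id); first exact: phase_space_line.
  by move=> k; exists k.
exists (fun y => 1 + -1 * g y).
  by apply: span_add; [exact: (trig_cst 1 phase_space_line)|exact: span_scale].
have g01 y : 0 <= g y <= 1 by apply: iter_smoothstep_itv; exact: wave_itv.
split=> [y|y yK ya|y yK yb].
- by have /andP[h1 h2] := g01 y; apply/andP; split; lra.
- have := hlo _ yK ya; have := wave_itv c L y; rewrite /wave => /andP[u0 u1] u2.
  have /andP[_] : 0 <= g y <= r ^+ n by apply: hr; rewrite /wave u0/=; lra.
  lra.
- have := hhi _ yK yb; have := wave_itv c L y; rewrite /wave => /andP[u0 u1] u2.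
  have /andP[h _] : 1 - r' ^+ n <= g y <= 1.
    by apply: hr'; rewrite /wave u1 andbT; lra.
  lra.
Unshelve. all: by end_near. Qed.

Lemma probability_tight (mu : probability (measurableTypeR R) R) (delta : R) :
  0 < delta ->
  exists2 K : R, 0 < K & fine (mu [set y | K < `|y|]) <= delta.
Proof.
move=> delta0.
pose A (n : nat) : set R := [set y | n.+1%:R < `|y|].
have mA n : measurable (A n : set (measurableTypeR R)).
  apply: measurable_set_lt; first exact: measurable_cst.
  exact: (@normr_measurable R setT).
have h : mu (A n) @[n --> \oo] --> mu (\bigcap_n A n).
  apply: nonincreasing_cvg_mu => //.
  - by rewrite (le_lt_trans (probability_le1 _ _)) ?ltry.
  - exact: bigcap_measurable.
  - move=> m n mn; apply/subsetPset => y; rewrite /A /=; apply: le_lt_trans.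
    by rewrite ler_nat ltnS.
have A0 : \bigcap_n A n = set0.
  rewrite -subset0 => y /(_ (Num.truncn `|y|) I); rewrite /A/= ltNge => /negP; apply.
  by apply/ltW; exact: truncnS_gt.
rewrite A0 measure0 in h.
have /cvgr0_norm_le/(_ _ delta0)[N _ hN] : fine (mu (A n)) @[n --> \oo] --> (0 : R).
  by apply: fine_cvg.
exists N.+1%:R => //; apply: le_trans (hN N (leqnn N)); exact: ler_norm.
Qed.

Lemma indic1 (U : Type) (A : set U) (w : U) : A w -> (\1_A : U -> R) w = 1.
Proof. by move=> Aw; rewrite indicE mem_set. Qed.

Lemma indic0 (U : Type) (A : set U) (w : U) : ~ A w -> (\1_A : U -> R) w = 0.
Proof. by move=> nAw; rewrite indicE memNset. Qed.

Lemma indic_itv (U : Type) (A : set U) (w : U) : 0 <= (\1_A : U -> R) w <= 1.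
Proof. by rewrite indicE; case: (_ \in _); rewrite ?lexx ?ler01. Qed.

Section CdfSandwich.
Context (d : measure_display) (T : measurableType d) (P : probability T R).
Context (X : T -> R) (f : R -> R) (a b e K : R).
Hypothesis mX : measurable_fun setT X.
Hypothesis bf : bmeas (f \o X).
Hypothesis e0 : 0 <= e.
Hypothesis f01 : forall y, 0 <= f y <= 1.
Hypothesis fa : forall y, `|y| <= K -> y <= a -> 1 - e <= f y.
Hypothesis fb : forall y, `|y| <= K -> b <= y -> f y <= e.

Let mK : measurable [set w | K < `|X w|].
Proof.
apply: measurable_set_lt; first exact: measurable_cst.
exact: (measurableT_comp (@normr_measurable R setT)).
Qed.

Let mle c : measurable [set w | X w <= c].
Proof. by apply: measurable_set_le => //; exact: measurable_cst. Qed.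

Let bI (A : set T) : measurable A -> bmeas (\1_A : T -> R).
Proof. exact: bmeas_indic. Qed.

Let bK : bmeas (fun w => e + (\1_[set w | K < `|X w|] : T -> R) w).
Proof. by apply: bmeasD; [exact: bmeas_cst|exact: bI]. Qed.

(** Outside the window |y| <= K nothing is known of [f] beyond [0 <= f <= 1]; the mass there is
    charged to the last term, which tightness makes small. *)
Lemma cdf_le_Ex : fine (P [set w | X w <= a]) <=
  Ex P (f \o X) + (e + fine (P [set w | K < `|X w|])).
Proof.
set B := [set w | X w <= a]; set A := [set w | K < `|X w|].
have mA : measurable A := mK; have mB : measurable B := mle a.
have bA : bmeas (fun w => e + (\1_A : T -> R) w) := bK.
have e0' := e0.
rewrite -!Ex_indic// -[X in _ + (X + _)](Ex_cst P e).
rewrite -(ExD _ (bmeas_cst _ e) (bI mA)) -(ExD _ bf bA).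
apply: le_Ex; [exact: bI|exact: bmeasD bf bA|move=> w].
have /andP[k0 k1] := indic_itv A w; have /andP[g0 g1] := f01 (X w).
rewrite -[(f \o X) w]/(f (X w)).
have [Xa|Xa] := leP (X w) a; last first.
  have nXa : ~ B w by apply/negP; rewrite -ltNge.
  by rewrite (indic0 nXa); move: ((\1_A : T -> R) w) k0 => u k0; lra.
rewrite (@indic1 _ B)//.
have [Kw|Kw] := ltP K `|X w|; first by rewrite (@indic1 _ A w Kw); lra.
by have := fa Kw Xa; move: ((\1_A : T -> R) w) k0 => u k0; lra.
Qed.

Lemma Ex_le_cdf : Ex P (f \o X) <=
  fine (P [set w | X w <= b]) + (e + fine (P [set w | K < `|X w|])).
Proof.
set B := [set w | X w <= b]; set A := [set w | K < `|X w|].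
have mA : measurable A := mK; have mB : measurable B := mle b.
have bA : bmeas (fun w => e + (\1_A : T -> R) w) := bK.
have e0' := e0.
rewrite -!Ex_indic// -[X in _ + (X + _)](Ex_cst P e).
rewrite -(ExD _ (bmeas_cst _ e) (bI mA)) -(ExD _ (bI mB) bA).
apply: le_Ex; [exact: bf|exact: bmeasD (bI mB) bA|move=> w].
have /andP[k0 k1] := indic_itv A w; have /andP[i0 i1] := indic_itv B w.
have /andP[g0 g1] := f01 (X w).
rewrite -[(f \o X) w]/(f (X w)).
have [Kw|Kw] := ltP K `|X w|; first by rewrite (@indic1 _ A w Kw);
  move: ((\1_B : T -> R) w) i0 => u i0; lra.
move: ((\1_A : T -> R) w) k0 => u k0.
have [Xb|Xb] := leP (X w) b; first by rewrite (@indic1 _ B w Xb); lra.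
by have := fb Kw (ltW Xb); move: ((\1_B : T -> R) w) i0 => v i0; lra.
Qed.

End CdfSandwich.

Section LevySlutsky.
Context (d : nat -> measure_display) (T : forall n, measurableType (d n)).
Unset Implicit Arguments.
Context (P : forall n, probability (T n) R) (W Y : forall n, T n -> R).
Set Implicit Arguments.
Context (mu : probability (measurableTypeR R) R).
Hypothesis mW : forall n, measurable_fun setT (W n).
Hypothesis mY : forall n, measurable_fun setT (Y n).
Hypothesis char_cvg : forall t th : R,
  Ex (P n) (fun w => cos (t * W n w + th)) @[n --> \oo] -->
  Ex mu (fun x => cos (t * x + th)).
Hypothesis W_tight : forall delta : R, 0 < delta -> exists K : R,
  forall n, fine (P n [set w | K < `|W n w|]) <= delta.
Hypothesis Y_close : forall eta delta : R, 0 < eta -> 0 < delta ->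
  \forall n \near \oo, exists2 B : set (T n), measurable B &
    fine (P n B) <= delta /\ forall w, ~ B w -> `|Y n w - W n w| <= eta.

Let bcos n t th : bmeas (fun w => cos (t * W n w + th)).
Proof.
by apply: bmeas_cos; apply: measurable_funD => //; exact: measurable_funM.
Qed.

Let bcosmu t th : bmeas ((fun x : R => cos (t * x + th)) : measurableTypeR R -> R).
Proof.
by apply: bmeas_cos; apply: measurable_funD => //; exact: measurable_funM.
Qed.

Let trig_cvg f : trig line_phase f ->
  [/\ forall n, bmeas (f \o W n), bmeas (f : measurableTypeR R -> R) &
   Ex (P n) (f \o W n) @[n --> \oo] --> Ex mu f].
Proof.
elim=> {f} [f [l [t ->] [th ->]]|f g _ [bf bf' cf] _ [bg bg' cg]|c f _ [bf bf' cf]].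
- by split; [move=> n; exact: bcos|exact: bcosmu|exact: char_cvg].
- split; [by move=> n; exact: bmeasD|exact: bmeasD|].
  rewrite [X in _ --> X](ExD mu bf' bg').
  rewrite (_ : (fun n => _) = fun n => Ex (P n) (f \o W n) + Ex (P n) (g \o W n)).
    exact: cvgD.
  by apply/funext => n; rewrite -ExD.
- split; [by move=> n; exact: bmeasZ|exact: bmeasZ|].
  rewrite [X in _ --> X](ExZ mu c bf').
  rewrite (_ : (fun n => _) = fun n => c * Ex (P n) (f \o W n)).
    exact: cvgMr.
  by apply/funext => n; rewrite -ExZ.
Qed.

Let F (x : R) : R := fine (mu `]-oo, x]%classic).

Let F_id (x : R) : [set y : measurableTypeR R | y <= x] = `]-oo, x]%classic.
Proof. by apply/seteqP; split=> y /=; rewrite in_itv. Qed.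

Let sandwich (a b delta : R) : a < b -> 0 < delta -> \forall n \near \oo,
  fine (P n [set w | W n w <= a]) <= F b + delta /\
  F a <= fine (P n [set w | W n w <= b]) + delta.
Proof.
(* Five errors add up: a step error and a tail mass under each of the two laws, and the difference
   of the two expectations of [f]. *)
move=> ab delta0; pose e := delta / 5; have eE : 5 * e = delta by rewrite /e; field.
have e0 : 0 < e by rewrite divr_gt0.
have [K1 hK1] := W_tight e0.
have [K2 K20 hK2] := probability_tight mu e0.
pose K := Num.max K1 K2.
have K0 : 0 < K by rewrite lt_max K20 orbT.
have [f tf [f01 fa fb]] := trig_approx_step ab e0 K0.
have [bf bf' cf] := trig_cvg tf.
have bfid : bmeas (f \o (id : measurableTypeR R -> R)) by exact: bf'.
have mid : measurable_fun setT (id : measurableTypeR R -> R) by exact: measurable_id.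
move/cvgrPdist_le: cf => /(_ _ e0); apply: filterS => n.
rewrite ler_norml => /andP[h1 h2].
have mn : measurable_fun setT (fun w => `|W n w|).
  exact: (measurableT_comp (@normr_measurable R setT)).
have tW : fine (P n [set w | K < `|W n w|]) <= e.
  apply: le_trans (hK1 n); apply: fine_le; rewrite ?fin_num_measure//.
  - by apply: measurable_set_lt.
  - by apply: measurable_set_lt.
  - apply: le_measure; rewrite ?inE; try by apply: measurable_set_lt.
    by move=> w /=; rewrite gt_max => /andP[].
have mid' := @normr_measurable R setT.
have tmu : fine (mu [set y | K < `|y|]) <= e.
  apply: le_trans hK2; apply: fine_le; rewrite ?fin_num_measure//.
  - by apply: measurable_set_lt.
  - by apply: measurable_set_lt.
  - apply: le_measure; rewrite ?inE; try by apply: measurable_set_lt.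
    by move=> w /=; rewrite gt_max => /andP[].
have u1 := cdf_le_Ex (P n) (@mW n) (bf n) (ltW e0) f01 fa.
have u2 := Ex_le_cdf mu mid bfid (ltW e0) f01 fb.
have l1 := cdf_le_Ex mu mid bfid (ltW e0) f01 fa.
have l2 := Ex_le_cdf (P n) (@mW n) (bf n) (ltW e0) f01 fb.
rewrite !F_id in u2 l1.
have tmu' : fine (mu [set w : measurableTypeR R | K < `|id w|]) <= e := tmu.
rewrite -[fine (mu `]-oo, b]%classic)]/(F b) -[Ex mu (f \o id)]/(Ex mu f) in u2.
rewrite -[fine (mu `]-oo, a]%classic)]/(F a) -[Ex mu (f \o id)]/(Ex mu f) in l1.
move: (Ex mu f) (F a) (F b) (Ex (P n) (f \o W n)) h1 h2 u1 u2 l1 l2 tW tmu tmu' => x1 x2 x3 x4.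
move: (fine (mu [set w : measurableTypeR R | K < `|id w|])) (fine (P n [set w | K < `|W n w|])) => z1 z2.
move: (fine (P n [set w | W n w <= a])) (fine (P n [set w | W n w <= b])) => z3 z4.
move: e0 eE; clear; move=> *.
by split; lra.
Qed.

(** The continuity theorem and Slutsky's lemma in one. Around a continuity point [x], a first shift
    by [eta] replaces [Y] by [W] off the bad event, and a second one leaves [sandwich] the gap
    between abscissae that it requires. *)
Lemma levy_slutsky : cvg_in_distribution P Y mu.
Proof.
split=> // x cx.
have mle (c : R) n (Z : T n -> R) : measurable_fun setT Z -> measurable [set w | Z w <= c].
  by move=> mZ; apply: measurable_set_le => //; exact: measurable_cst.
suff h : fine (P n [set w | Y n w <= x]) @[n --> \oo] --> F x.
  rewrite -(@fineK _ (mu `]-oo, x]%classic)) ?fin_num_measure//.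
  rewrite (_ : (fun n => _) = fun n => (fine (P n [set w | Y n w <= x]))%:E).
    by apply: cvg_EFin; [exact: nearW|exact: h].
  by apply/funext => n; rewrite fineK// fin_num_measure//; exact: mle.
apply/cvgrPdist_le => eps eps0.
have e0 : 0 < eps / 3 by rewrite divr_gt0.
move/cvgrPdist_le: cx => /(_ _ e0) [r /= r0 hr].
pose eta := r / 3; have eta0 : 0 < eta by rewrite divr_gt0.
have rE : r = 3 * eta by rewrite /eta; field.
have Fr (y : R) : `|x - y| < r -> `|F x - F y| <= eps / 3 by exact: hr.
have Fp : F (x + 2 * eta) <= F x + eps / 3.
  have := Fr (x + 2 * eta); rewrite opprD addrA subrr add0r normrN gtr0_norm ?mulr_gt0// => /(_ _).
  by rewrite ler_norml => h; have /andP[] := h ltac:(lra); lra.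
have Fm : F x - eps / 3 <= F (x - 2 * eta).
  have := Fr (x - 2 * eta); rewrite opprB addrC subrK gtr0_norm ?mulr_gt0// => /(_ _).
  by rewrite ler_norml => h; have /andP[] := h ltac:(lra); lra.
have [|] := @sandwich (x + eta) (x + 2 * eta) (eps / 3) _ e0; first lra.
move=> N1 _ hN1.
have [|] := @sandwich (x - 2 * eta) (x - eta) (eps / 3) _ e0; first lra.
move=> N2 _ hN2.
near=> n.
have [s1 _] : fine (P n [set w | W n w <= x + eta]) <= F (x + 2 * eta) + eps / 3 /\
  F (x + eta) <= fine (P n [set w | W n w <= x + 2 * eta]) + eps / 3.
  by apply: hN1; near: n; exact: nbhs_infty_ge.
have [_ s2] : fine (P n [set w | W n w <= x - 2 * eta]) <= F (x - eta) + eps / 3 /\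
  F (x - 2 * eta) <= fine (P n [set w | W n w <= x - eta]) + eps / 3.
  by apply: hN2; near: n; exact: nbhs_infty_ge.
have [B mB [PB hB]] : exists2 B : set (T n), measurable B &
    fine (P n B) <= eps / 3 /\ forall w, ~ B w -> `|Y n w - W n w| <= eta.
  by near: n; exact: Y_close.
have union (A C : set (T n)) : measurable A -> measurable C -> A `<=` B `|` C ->
    fine (P n A) <= fine (P n B) + fine (P n C).
  move=> mA mC AC; rewrite -fineD ?fin_num_measure//.
  apply: fine_le; rewrite ?fin_numD ?fin_num_measure//.
  apply: (@le_trans _ _ (P n (B `|` C))).
    by apply: le_measure; rewrite ?inE//; exact: measurableU.
  exact: measureU2.
have y1 : fine (P n [set w | Y n w <= x]) <= eps / 3 + fine (P n [set w | W n w <= x + eta]).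
  apply: le_trans (union _ [set w | W n w <= x + eta] (mle _ _ _ (@mY n)) (mle _ _ _ (@mW n)) _) _.
    move=> w /= Yx; have [Bw|nB] := pselect (B w); [by left|right=> /=].
    by have := hB _ nB; rewrite ler_norml => /andP[]; lra.
  by rewrite lerD2r.
have y2 : fine (P n [set w | W n w <= x - eta]) <= eps / 3 + fine (P n [set w | Y n w <= x]).
  apply: le_trans (union _ [set w | Y n w <= x] (mle _ _ _ (@mW n)) (mle _ _ _ (@mY n)) _) _.
    move=> w /= Yx; have [Bw|nB] := pselect (B w); [by left|right=> /=].
    by have := hB _ nB; rewrite ler_norml => /andP[]; lra.
  by rewrite lerD2r.
by rewrite ler_norml; apply/andP; split; lra.
Unshelve. all: by end_near. Qed.

End LevySlutsky.
End Levy.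

(** * A central limit theorem for locally dependent variables *)

Section TrigInequalities.
Context (R : realType).
Implicit Types a b x y : R.

Lemma cos_lipschitz x y : `|cos x - cos y| <= `|x - y|.
Proof.
wlog xy : x y / x <= y.
  by move=> H; have [/H//|/ltW/H] := leP x y; rewrite distrC [`|y - x|]distrC.
have [|c _] := @MVT_segment R (@cos R) (fun x => - sin x) x y xy (fun z _ => is_derive_cos z).
  by apply: continuous_subspaceT; exact: continuous_cos.
move=> h; rewrite distrC h normrM normrN [leRHS]distrC ler_piMl// sin_max//.
Qed.

(** The mean value theorem for u -> sin(a - u) + u cos a: its derivative cos a - cos(a - u) is at
    most |u| because the cosine is 1-Lipschitz. *)
Lemma sin_taylor a b : `|sin a - sin (a - b) - b * cos a| <= b ^+ 2.
Proof.
pose f u : R := sin (u * (-1) + a) + u * cos a.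
have df (u : R) : is_derive u 1 f (- cos (u * (-1) + a) + cos a).
  have h1 := is_derive_sin_affine (-1) a u.
  have h2 := is_derive_affine (cos a) 0 u.
  have h := is_deriveD h1 h2.
  rewrite (_ : f = (fun y => sin (y * -1 + a)) + (fun y => y * cos a + 0)); last first.
    by apply/funext => y; rewrite /f -[RHS]/(sin (y * -1 + a) + (y * cos a + 0)) addr0.
  by apply: is_derive_eq h _; rewrite mulN1r.
have cf (x y : R) : {within `[x, y], continuous f}.
  by apply: derivable_within_continuous => t _; have [] := df t.
have key (u c : R) : `|c| <= `|u| -> f u - f 0 = (- cos (c * (-1) + a) + cos a) * u ->
    `|f u - f 0| <= u ^+ 2.
  move=> cu ->; rewrite normrM -[leRHS]real_normK ?num_real// expr2 ler_wpM2r//.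
  rewrite addrC; apply: le_trans (cos_lipschitz _ _) _.
  by rewrite (_ : a - _ = c)//; ring.
have -> : sin a - sin (a - b) - b * cos a = - (f b - f 0).
  by rewrite /f mul0r add0r mul0r addr0 mulrN1 (addrC (- b)); ring.
rewrite normrN; have [b0|b0] := leP 0 b.
  have [c + h] := MVT_segment b0 (fun t _ => df t) (cf 0 b).
  rewrite in_itv/= => /andP[c0 cb]; apply: (key _ c); last by rewrite h subr0.
  by rewrite !ger0_norm.
have [c + h] := MVT_segment (ltW b0) (fun t _ => df t) (cf b 0).
rewrite in_itv/= => /andP[c0 cb]; apply: (key _ c).
  by rewrite !ler0_norm ?lerN2// ltW.
by rewrite -opprB h sub0r mulrN opprK.
Qed.

End TrigInequalities.

Section DerivativeOfCharacteristicFunction.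
Context (d : measure_display) (T : measurableType d) (R : realType).
Context (P : probability T R).

Lemma is_derive_Ex_cos (W : T -> R) (th t : R) : bmeas W ->
  is_derive t 1 (fun t => Ex P (fun w => cos (t * W w + th)))
    (Ex P (fun w => - (W w * sin (t * W w + th)))).
Proof.
move=> bW; have [mW [C hC]] := bW.
have I0 : `]t - 1, t + 1[%classic t by rewrite /= in_itv/=; lra.
pose f (t : R) (w : T) := cos (t * W w + th).
have bf a : bmeas (f a).
  by apply: bmeas_cos; apply: measurable_funD => //; exact: measurable_funM.
have e1 a w : partial1of2 f a w = - (W w * sin (a * W w + th)).
  by rewrite partial1of2E; have [_ ->] := is_derive_cos_affine (W w) th a.
have hub a w : `|partial1of2 f a w| <= `|W w|.
  by rewrite e1 normrN normrM ler_piMr// sin_max.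
have hder a w : derivable (f ^~ w) a 1 by have [] := is_derive_cos_affine (W w) th a.
have iW := bmeas_integrable P (bmeas_norm bW).
have hD := @derivable_under_integral R _ _ P f setT measurableT t _ _ I0
  (fun a _ => bmeas_integrable P (bf a)) (fun a w _ _ => hder a w) _
  (fun w => normr_ge0 (W w)) iW (fun a w _ _ => hub a w).
have hE := @differentiation_under_integral R _ _ P f setT measurableT t _ _ I0
  (fun a _ => bmeas_integrable P (bf a)) (fun a w _ _ => hder a w) _
  (fun w => normr_ge0 (W w)) iW (fun a w _ _ => hub a w).
apply: DeriveDef; first exact: hD.
by rewrite -derive1E hE; apply: eq_Rintegral => w _; exact: e1.
Qed.

(** Cauchy-Schwarz in linear form: 2 |x| <= s + x^2 / s, to be used with [s] of the order of the
    standard deviation. *)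
Lemma Ex_le_sqr (f : T -> R) (s : R) : 0 < s -> bmeas f ->
  Ex P (fun w => `|f w|) <= (s + Ex P (fun w => f w ^+ 2) / s) / 2.
Proof.
move=> s0 bf.
have -> : (s + Ex P (fun w => f w ^+ 2) / s) / 2 =
    Ex P (fun w => s / 2 + (2 * s)^-1 * f w ^+ 2).
  rewrite ExD; [|exact: bmeas_cst|by apply: bmeasZ; exact: bmeasX].
  by rewrite Ex_cst ExZ; [field; rewrite gt_eqF|exact: bmeasX].
apply: le_Ex; [exact: bmeas_norm| |move=> w].
  by apply: bmeasD; [exact: bmeas_cst|apply: bmeasZ; exact: bmeasX].
rewrite -(real_normK (num_real (f w))); move: (`|f w|) => x.
rewrite -subr_ge0 (_ : _ - _ = (2 * s)^-1 * (s - x) ^+ 2).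
  by rewrite mulr_ge0 ?sqr_ge0// invr_ge0 mulr_ge0// ltW.
by field; rewrite gt_eqF.
Qed.

End DerivativeOfCharacteristicFunction.

(** The condition |i - j| <= L, written without truncated subtraction. *)
Definition nearby (L m : nat) (i j : 'I_m) : bool :=
  (i <= j + L)%N && (j <= i + L)%N.

Lemma card_nearby L m (i : 'I_m) : (#|[pred j | nearby L i j]| <= L.*2.+1)%N.
Proof.
rewrite cardE -(size_map val) -(size_iota (i - L) L.*2.+1).
apply: uniq_leq_size.
  by rewrite map_inj_uniq ?enum_uniq//; exact: val_inj.
move=> k /mapP[j]; rewrite mem_enum inE /nearby => /andP[h1 h2] ->.
by rewrite mem_iota /=; lia.
Qed.

Lemma sum_nearby_le (R : realType) L m (i : 'I_m) (F : 'I_m -> R) (v : R) :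
  0 <= v -> (forall j, nearby L i j -> F j <= v) ->
  \sum_(j | nearby L i j) F j <= (L.*2.+1)%:R * v.
Proof.
move=> v0 h; apply: (@le_trans _ _ (\sum_(j | nearby L i j) v)).
  by apply: ler_sum => j; exact: h.
rewrite sumr_const -[leLHS]mulr_natl; apply: ler_wpM2r => //; rewrite ler_nat.
exact: card_nearby.
Qed.

Section SecondMoment.
Context (d : measure_display) (T : measurableType d) (R : realType).
Context (P : probability T R).

(** Each of the [m] rows of second moments has at most 2L + 1 nonzero entries, and each entry is at
    most [v] by 2 x y <= x^2 + y^2. *)
Lemma Ex_sqr_sum_local (L m : nat) (Z : 'I_m -> T -> R) (v : R) :
  (forall i, bmeas (Z i)) ->
  (forall i j, ~~ nearby L i j -> Ex P (fun w => Z i w * Z j w) = 0) ->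
  (forall i, Ex P (fun w => Z i w ^+ 2) <= v) ->
  Ex P (fun w => (\sum_i Z i w) ^+ 2) <= m%:R * ((L.*2.+1)%:R * v).
Proof.
move=> bZ indZ hv.
have [m0|m0] := posnP m.
  subst m; rewrite (eq_Ex P (g := fun=> 0)); first by rewrite Ex_cst mul0r.
  by move=> w; rewrite big_ord0 expr0n.
have v0 : 0 <= v.
  by apply: le_trans (hv (Ordinal m0)); apply: Ex_ge0 => w; exact: sqr_ge0.
have bZZ i j : bmeas (fun w => Z i w * Z j w) by exact: bmeasM.
have -> : Ex P (fun w => (\sum_i Z i w) ^+ 2) =
    \sum_i \sum_j Ex P (fun w => Z i w * Z j w).
  rewrite (eq_Ex P (g := fun w => \sum_i \sum_j Z i w * Z j w)); last first.
    by move=> w; rewrite expr2 big_distrl/=; apply: eq_bigr => i _; rewrite big_distrr.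
  rewrite Ex_sum; last by move=> i _; exact: bmeas_sum.
  by apply: eq_bigr => i _; rewrite Ex_sum.
have hij i j : Ex P (fun w => Z i w * Z j w) <= v.
  apply: (@le_trans _ _ (Ex P (fun w => 1 / 2 * Z i w ^+ 2 + 1 / 2 * Z j w ^+ 2))).
    apply: le_Ex => //; first by apply: bmeasD; apply: bmeasZ; exact: bmeasX.
    by move=> w; have := sqr_ge0 (Z i w - Z j w); nra.
  rewrite ExD ?ExZ; try (by apply: bmeasX); try (by apply: bmeasZ; apply: bmeasX).
  by have := hv i; have := hv j; lra.
apply: (@le_trans _ _ (\sum_(i < m) ((L.*2.+1)%:R * v))); last first.
  by rewrite sumr_const card_ord [leRHS]mulr_natl.
apply: ler_sum => i _.
rewrite (bigID (nearby L i))/= [X in _ + X]big1 ?addr0; last by move=> j; exact: indZ.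
by apply: sum_nearby_le.
Qed.

End SecondMoment.

(* [A I] stands for the bounded functions of the coordinates in [I]; the last
   field is M-dependence. *)
Record local_algebra (d : measure_display) (T : measurableType d) (R : realType)
    (P : probability T R) (M m : nat) (A : pred 'I_m -> (T -> R) -> Prop) : Prop :=
  LocalAlgebra {
    la_bmeas : forall I f, A I f -> bmeas f;
    la_cst : forall I (c : R), A I (fun _ => c);
    la_add : forall I f g, A I f -> A I g -> A I (fun w => f w + g w);
    la_mul : forall I f g, A I f -> A I g -> A I (fun w => f w * g w);
    la_sub : forall (I J : pred 'I_m) f, subpred I J -> A I f -> A J f;
    la_indep : forall (I J : pred 'I_m) f g,
      (forall i j, I i -> J j -> ~~ nearby M i j) -> A I f -> A J g ->
      Ex P (fun w => f w * g w) = Ex P f * Ex P g }.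

Section LocalCLT.
Context (d : measure_display) (T : measurableType d) (R : realType).
Context (P : probability T R) (M m : nat) (A : pred 'I_m -> (T -> R) -> Prop).
Hypothesis LA : local_algebra P M A.

Lemma la_eq I f g : (forall w, f w = g w) -> A I g -> A I f.
Proof. by move=> /funext ->. Qed.

Lemma la_scale I c f : A I f -> A I (fun w => c * f w).
Proof. by move=> Af; apply: (la_mul LA) => //; exact: (la_cst LA). Qed.

Lemma la_sum I (r : seq 'I_m) (Q : pred 'I_m) (F : 'I_m -> T -> R) :
  (forall i, Q i -> A I (F i)) -> A I (fun w => \sum_(i <- r | Q i) F i w).
Proof.
move=> h; elim: r => [|i r IH].
  by apply: la_eq (la_cst LA I 0) => w; rewrite big_nil.
have [Qi|Qi] := boolP (Q i).
  by apply: la_eq (la_add LA (h _ Qi) IH) => w; rewrite big_cons Qi.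
by apply: la_eq IH => w; rewrite big_cons (negbTE Qi).
Qed.

Unset Implicit Arguments.
Context (X : 'I_m -> T -> R).
Hypothesis X_la : forall i, A (pred1 i) (X i).
Hypothesis X_cos : forall i t, A (pred1 i) (fun w => cos (t * X i w)).
Hypothesis X_sin : forall i t, A (pred1 i) (fun w => sin (t * X i w)).
Hypothesis X_le1 : forall i w, `|X i w| <= 1.
Hypothesis X_mean : forall i, Ex P (X i) = 0.
Set Implicit Arguments.

Let bX i : bmeas (X i). Proof. by have := X_la i; apply: (la_bmeas LA). Qed.

(** The addition formulas build these functions from those of single coordinates; each formula uses
    both functions, so they are treated together. *)
Lemma la_trig_sum (I : pred 'I_m) (t th : R) :
  A I (fun w => cos (t * (\sum_(j | I j) X j w) + th)) /\
  A I (fun w => sin (t * (\sum_(j | I j) X j w) + th)).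
Proof.
move: (index_enum _) => r; elim: r => [|i r [IHc IHs]].
  split; [apply: (la_eq (g := fun=> cos th)); last exact: (la_cst LA)
         |apply: (la_eq (g := fun=> sin th)); last exact: (la_cst LA)];
    by move=> w; rewrite big_nil mulr0 add0r.
have [Ii|Ii] := boolP (I i); last first.
  by split; [apply: la_eq IHc|apply: la_eq IHs] => w; rewrite big_cons (negbTE Ii).
have sub1 : subpred (pred1 i) I by move=> j /eqP ->.
have hc := la_sub LA sub1 (X_cos i t); have hs := la_sub LA sub1 (X_sin i t).
split.
  apply: la_eq (la_add LA (la_mul LA hc IHc) (la_scale (-1) (la_mul LA hs IHs))) => w.
  by rewrite big_cons Ii mulrDr -addrA cosD mulN1r.
apply: la_eq (la_add LA (la_mul LA hs IHc) (la_mul LA hc IHs)) => w.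
by rewrite big_cons Ii mulrDr -addrA sinD.
Qed.

Lemma Ex_sqr_sum_mean0 (v : R) : (forall i, Ex P (fun w => X i w ^+ 2) <= v) ->
  Ex P (fun w => (\sum_i X i w) ^+ 2) <= m%:R * ((M.*2.+1)%:R * v).
Proof.
move=> hv; apply: Ex_sqr_sum_local => // i j nij.
rewrite (la_indep LA (I := pred1 i) (J := pred1 j))// ?X_mean ?mul0r//.
by move=> i' j' /eqP -> /eqP ->.
Qed.

Let K : R := (M.*2.+1)%:R.
Context (s : R).
Hypothesis s0 : 0 < s.
Hypothesis sm : s ^+ 2 * m%:R <= 1.

Let N i w := \sum_(j | nearby M i j) X j w.
Let W w := s * \sum_i X i w.
(** A random substitute for the variance of [W]: its mean is that variance, since products of
    distant summands have mean zero. *)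
Let Q w := s ^+ 2 * \sum_i X i w * N i w.

Let K_ge0 : 0 <= K. Proof. exact: ler0n. Qed.

Let N_le i w : `|N i w| <= K.
Proof.
apply: (le_trans (ler_norm_sum _ _ _)).
by rewrite -[leRHS]mulr1; apply: sum_nearby_le.
Qed.

Let bN i : bmeas (N i). Proof. exact: bmeas_sum. Qed.
Let bXN i : bmeas (fun w => X i w * N i w). Proof. exact: bmeasM. Qed.
Let bW : bmeas W. Proof. by apply: bmeasZ; exact: bmeas_sum. Qed.
Let bQ : bmeas Q. Proof. by apply: bmeasZ; exact: bmeas_sum. Qed.

Let barg t th : bmeas (fun w => t * W w + th).
Proof. by apply: bmeasD; [exact: bmeasZ|exact: bmeas_cst]. Qed.
Let bc t th : bmeas (fun w => cos (t * W w + th)).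
Proof. by apply: bmeas_cos; exact: bmeas_measurable. Qed.
Let bs t th : bmeas (fun w => sin (t * W w + th)).
Proof. by apply: bmeas_sin; exact: bmeas_measurable. Qed.

Let X_far i t th :
  Ex P (fun w => X i w * sin (t * W w + th - t * s * N i w)) = 0.
Proof.
pose J j := ~~ nearby M i j.
have hJ := (la_trig_sum J (t * s) th).2.
rewrite (eq_Ex P (g := fun w => X i w * sin (t * s * (\sum_(j | J j) X j w) + th))).
  rewrite (la_indep LA (I := pred1 i) (J := J))// ?X_mean ?mul0r//.
  by move=> i' j /eqP ->.
move=> w; congr (_ * sin _); rewrite /W /N (bigID (nearby M i))/= /J; ring.
Qed.

Let bfar i t th : bmeas (fun w => X i w * sin (t * W w + th - t * s * N i w)).
Proof.
apply: bmeasM => //; apply: bmeas_sin; apply: bmeas_measurable.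
by apply: bmeasB; [exact: barg|exact: bmeasZ].
Qed.

(* Removing the neighbours N_i of X_i from W makes the sine independent of X_i;
   Taylor expansion in N_i produces the term in Q. *)
Let stein_step t th :
  `|Ex P (fun w => W w * sin (t * W w + th)) - t * Ex P (fun w => Q w * cos (t * W w + th))|
  <= s * (t ^+ 2 * K ^+ 2).
Proof.
(* The last sum has mean zero by [X_far]; subtracting it leaves the expectation unchanged and makes
   [D] a sum of Taylor remainders of the sine, bounded pointwise. *)
pose D w := W w * sin (t * W w + th) - t * (Q w * cos (t * W w + th))
  - s * \sum_i X i w * sin (t * W w + th - t * s * N i w).
have b1 : bmeas (fun w => W w * sin (t * W w + th)) by exact: bmeasM.
have b2 : bmeas (fun w => Q w * cos (t * W w + th)) by exact: bmeasM.
have b3 : bmeas (fun w => \sum_i X i w * sin (t * W w + th - t * s * N i w)).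
  by apply: bmeas_sum.
have ED : Ex P D = Ex P (fun w => W w * sin (t * W w + th))
     - t * Ex P (fun w => Q w * cos (t * W w + th)).
  rewrite (ExB P (bmeasB b1 (bmeasZ t b2)) (bmeasZ s b3)) (ExB P b1 (bmeasZ t b2)).
  rewrite (ExZ P t b2) (ExZ P s b3) Ex_sum// [X in s * X]big1 ?mulr0 ?subr0//.
rewrite -ED; apply: Ex_bound.
  by apply: bmeasB; [apply: bmeasB => //; exact: bmeasZ|exact: bmeasZ].
move=> w; set a := t * W w + th.
have -> : D w = s * \sum_i X i w * (sin a - sin (a - t * s * N i w)
    - t * s * N i w * cos a).
  transitivity (s * \sum_i (X i w * sin a - X i w * sin (a - t * s * N i w)
     - t * s * cos a * (X i w * N i w))).
    by rewrite /D -/a {1}/W /Q !sumrB -mulr_suml -mulr_sumr; ring.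
  by congr (_ * _); apply: eq_bigr => i _; ring.
rewrite normrM (gtr0_norm s0) ler_pM2l//.
apply: (le_trans (ler_norm_sum _ _ _)).
apply: (@le_trans _ _ (\sum_(i < m) (t ^+ 2 * s ^+ 2 * K ^+ 2))).
  apply: ler_sum => i _; rewrite normrM.
  apply: (@le_trans _ _ (1 * (t * s * N i w) ^+ 2)).
    by apply: ler_pM => //; exact: sin_taylor.
  rewrite mul1r !exprMn; apply: ler_wpM2l; first by rewrite mulr_ge0 ?sqr_ge0.
  by rewrite -(real_normK (num_real (N i w))) lerXn2r ?nnegrE.
rewrite sumr_const card_ord -[leLHS]mulr_natl.
have -> : m%:R * (t ^+ 2 * s ^+ 2 * K ^+ 2) = (s ^+ 2 * m%:R) * (t ^+ 2 * K ^+ 2) by ring.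
by rewrite ler_piMl// mulr_ge0 ?sqr_ge0.
Qed.

Let C1 : R := (1 + ((3 * M).*2.+1)%:R * (2 * K) ^+ 2) / 2.

(** The product X_i N_i depends on the coordinates within M of i, so two such products are
    independent once their indices are more than 3M apart. Its absolute value is at most K, and
    centring at most doubles this bound. *)
Let Q_conc : Ex P (fun w => `|Q w - Ex P Q|) <= s * C1.
Proof.
pose Z i w := X i w * N i w - Ex P (fun w => X i w * N i w).
have bZ i : bmeas (Z i) by apply: bmeasB => //; exact: bmeas_cst.
have QE w : Q w - Ex P Q = s ^+ 2 * \sum_i Z i w.
  rewrite /Q ExZ; last exact: bmeas_sum.
  by rewrite Ex_sum// -mulrBr -sumrB.
have ZA i : A (nearby M i) (Z i).
  apply: (la_add LA); last exact: (la_cst LA).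
  apply: (la_mul LA).
    by apply: (la_sub LA) (X_la i) => j /eqP ->; rewrite /nearby; lia.
  apply: la_sum => j ij; apply: (la_sub LA) (X_la j) => k /eqP -> //.
have Z0 i : Ex P (Z i) = 0.
  by rewrite /Z ExB ?Ex_cst ?subrr//; exact: bmeas_cst.
have Z2 i : Ex P (fun w => Z i w ^+ 2) <= (2 * K) ^+ 2.
  rewrite (le_trans (ler_norm _))//; apply: Ex_bound; first exact: bmeasX.
  move=> w; rewrite normrX lerXn2r ?nnegrE ?mulr_ge0//.
  have h w' : `|X i w' * N i w'| <= K by rewrite normrM -[leRHS]mul1r ler_pM.
  rewrite mulr_natl mulr2n (le_trans (ler_normB _ _))// lerD//.
  exact: Ex_bound.
have hV := @Ex_sqr_sum_local _ _ _ P (3 * M) m Z _ bZ _ Z2.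
have {}hV : Ex P (fun w => (\sum_i Z i w) ^+ 2) <=
    m%:R * ((3 * M).*2.+1%:R * (2 * K) ^+ 2).
  apply: hV => i j nij.
  rewrite (la_indep LA (I := nearby M i) (J := nearby M j))// ?Z0 ?mul0r//.
  by move=> i' j'; move: nij; rewrite /nearby; lia.
apply: (le_trans (Ex_le_sqr P s0 (bmeasB bQ (bmeas_cst _ (Ex P Q))))).
rewrite /C1 mulrA ler_wpM2r// mulrDr mulr1 lerD2l ler_pdivrMr//.
rewrite (eq_Ex P (g := fun w => s ^+ 4 * (\sum_i Z i w) ^+ 2)); last first.
  by move=> w; rewrite QE; ring.
rewrite ExZ; last by apply: bmeasX; exact: bmeas_sum.
set V := (_ * _ ^+ 2 : R) in hV *.
have V0 : 0 <= V by rewrite mulr_ge0// sqr_ge0.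
apply: (@le_trans _ _ (s ^+ 4 * (m%:R * V))); first by rewrite ler_wpM2l// exprn_ge0// ltW.
have -> : s ^+ 4 * (m%:R * V) = s ^+ 2 * V * (s ^+ 2 * m%:R) by ring.
have -> : s * V * s = s ^+ 2 * V by ring.
by rewrite ler_piMr// mulr_ge0// sqr_ge0.
Qed.

Lemma local_clt (sigma2 e t th : R) : 0 <= sigma2 -> 0 <= t ->
  `|s ^+ 2 * (\sum_i \sum_(j | nearby M i j) Ex P (fun w => X i w * X j w)) - sigma2| <= e ->
  `|Ex P (fun w => cos (t * (s * \sum_i X i w) + th))
    - cos th * expR (- (sigma2 * t ^+ 2 / 2))|
  <= (s * (t ^+ 2 * K ^+ 2) + t * (s * C1 + e)) * t.
Proof.
move=> sig0 t0 he.
have EQ : Ex P Q = s ^+ 2 * (\sum_i \sum_(j | nearby M i j) Ex P (fun w => X i w * X j w)).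
  rewrite /Q ExZ; last exact: bmeas_sum.
  rewrite Ex_sum//; congr (_ * _); apply: eq_bigr => i _.
  rewrite -Ex_sum; last by move=> j _; exact: bmeasM.
  by apply: eq_Ex => w; rewrite mulr_sumr.
rewrite -EQ in he.
have h := @gauss_ode R (fun t => Ex P (fun w => cos (t * W w + th))) _ sigma2
  (s * (t ^+ 2 * K ^+ 2) + t * (s * C1 + e)) t sig0 t0
  (fun u => is_derive_Ex_cos P th u bW).
have : `|Ex P (fun w => cos (t * W w + th)) - Ex P (fun w => cos (0 * W w + th)) *
    expR (- (sigma2 * t ^+ 2 / 2))| <= (s * (t ^+ 2 * K ^+ 2) + t * (s * C1 + e)) * t.
  apply: h => u /andP[u0 ut].
  rewrite ExN; last exact: bmeasM.
  set a := Ex P (fun w => W w * sin (u * W w + th)).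
  set b := Ex P (fun w => Q w * cos (u * W w + th)).
  set c := Ex P (fun w => cos (u * W w + th)).
  have h1 : `|a - u * b| <= s * (u ^+ 2 * K ^+ 2) := stein_step u th.
  have h2 : `|b - Ex P Q * c| <= s * C1.
    rewrite /b /c -ExZ// -ExB; [|exact: bmeasM|exact: bmeasZ].
    apply: le_trans Q_conc.
    have bb : bmeas (fun w => Q w * cos (u * W w + th) - Ex P Q * cos (u * W w + th)).
      by apply: bmeasB; [exact: bmeasM|exact: bmeasZ].
    apply: (le_trans (Ex_norm P bb)); apply: le_Ex.
    - exact: bmeas_norm.
    - by apply: bmeas_norm; apply: bmeasB => //; exact: bmeas_cst.
    - by move=> w; rewrite -mulrBl normrM ler_piMr// cos_max.
  have c1 : `|c| <= 1 by apply: Ex_bound => // w; exact: cos_max.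
  have h3 : `|(Ex P Q - sigma2) * c| <= e.
    by rewrite normrM -[leRHS]mulr1; apply: ler_pM.
  (* The defect in the Gaussian equation splits into the Taylor error, the fluctuation of [Q], and
     the gap between its mean and [sigma2]. *)
  have -> : - a + sigma2 * u * c = - ((a - u * b) + u * ((b - Ex P Q * c) +
     (Ex P Q - sigma2) * c)) by ring.
  rewrite normrN (le_trans (ler_normD _ _))// lerD//.
    rewrite (le_trans h1)// ler_pM2l// ler_wpM2r ?sqr_ge0// lerXn2r ?nnegrE//.
  rewrite normrM (ger0_norm u0) ler_pM// (le_trans (ler_normD _ _))// lerD//.
suff -> : Ex P (fun w => cos (0 * W w + th)) = cos th by [].
by rewrite -[RHS](Ex_cst P); apply: eq_Ex => w; rewrite mul0r add0r.
Qed.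

End LocalCLT.

(** * The Benjamini-Hochberg level *)

Section BHCombinatorics.
Context (R : realType) (q : R) (m : nat) (p : 'I_m -> R).

Definition pcount (t : R) : nat := #|[pred i | p i <= t]|.

Lemma pcount_le_size t : (pcount t <= m)%N.
Proof. by rewrite -[leqRHS]card_ord; exact: max_card. Qed.

Lemma pcount_homo s t : s <= t -> (pcount s <= pcount t)%N.
Proof.
by move=> st; apply/subset_leq_card/fintype.subsetP => i; rewrite !inE => /le_trans; apply.
Qed.

(** Order statistics become counts, which are sums of indicators. The index 0 is left out since its
    order statistic is a convention. *)
Lemma sorted_pvalue_le (j : nat) (t : R) : (0 < j <= m)%N ->
  (sorted_pvalue p j <= t) = (j <= pcount t)%N.
Proof.
case: j => // k /=; rewrite /sorted_pvalue/= => km.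
set s := sort _ _.
have ss : sorted <=%O s by apply: sort_sorted; exact: le_total.
have sz : size s = m by rewrite size_sort size_codom card_ord.
have cE : count (<= t) s = pcount t.
  rewrite (permP (permEl (perm_sort _ _))) /pcount /codom /image_mem count_map.
  rewrite cardE /enum_mem size_filter count_filter; apply: eq_count => i.
  by rewrite /= !inE andbT.
apply/idP/idP => [h|h]; last by apply: nth_count_le => //; rewrite cE.
rewrite -cE leqNgt; apply/negP => h2.
have : t < nth 0 s k by apply: nth_count_gt => //; rewrite -ltnS h2/= sz.
by rewrite ltNge h.
Qed.

Local Notation Rej := (BH_rejections q p).

Lemma BH_rejections_le : (Rej <= m)%N.
Proof. by apply/bigmax_leqP => j _; rewrite -ltnS. Qed.

Lemma BH_rejections_max (j : nat) : 0 <= q -> (j <= m)%N ->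
  (j <= pcount (j%:R * q / m%:R))%N -> (j <= Rej)%N.
Proof.
move=> q0; case: j => // j jm h.
have jm1 : (j.+1 < m.+1)%N by rewrite ltnS.
rewrite /BH_rejections; apply: (@bigop.bigmax_sup _ (Ordinal jm1)) => //=.
by rewrite sorted_pvalue_le// jm.
Qed.

(** Were the count larger, it would itself satisfy the defining inequality, because the bound grows
    with the index; this contradicts maximality. *)
Lemma BH_rejections_count : 0 <= q -> pcount (Rej%:R * q / m%:R) = Rej.
Proof.
move=> q0; set t := _ / _; apply/eqP; rewrite eqn_leq; apply/andP; split.
  rewrite leqNgt; apply/negP => h.
  have := h; rewrite ltnNge => /negP; apply.
  apply: BH_rejections_max => //; first exact: pcount_le_size.
  apply: pcount_homo; rewrite /t; apply: ler_wpM2r; first by rewrite invr_ge0.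
  by rewrite ler_wpM2r// ler_nat ltnW.
have [->//|R0] := posnP Rej.
rewrite -sorted_pvalue_le ?R0 ?BH_rejections_le// /t.
rewrite /BH_rejections.
(* The index 0 always qualifies, so the maximum is attained and its index satisfies the
   inequality. *)
have P0 : sorted_pvalue p (@ord0 m) <= (@ord0 m)%:R * q / m%:R.
  by rewrite /sorted_pvalue/= !mul0r.
rewrite (@bigop.bigmax_eq_arg _ ord0 (fun j : 'I_m.+1 => sorted_pvalue p j <= j%:R * q / m%:R) (fun j => j : nat) P0).
by case: arg_maxnP.
Qed.

Definition BH_level : R := Rej%:R * q / m%:R.

(** The threshold is at most the level and both have [Rej] p-values below them, so no p-value lies
    in between. *)
Lemma BH_threshold_level (i : 'I_m) : 0 <= q -> (forall i, 0 < p i) ->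
  (p i <= BH_threshold q p) = (p i <= BH_level).
Proof.
move=> q0 pp; have cl := BH_rejections_count q0; rewrite -/BH_level in cl.
have [R0|R0] := posnP Rej.
  have -> : BH_threshold q p = 0 by rewrite /BH_threshold R0.
  have -> : BH_level = 0 by rewrite /BH_level R0 !mul0r.
  by [].
have Rm : (0 < Rej <= m)%N by rewrite R0 BH_rejections_le.
have tl : BH_threshold q p <= BH_level.
  by rewrite /BH_threshold sorted_pvalue_le// cl.
have ct : pcount (BH_threshold q p) = Rej.
  apply/eqP; rewrite eqn_leq -{1}cl pcount_homo//=.
  by rewrite -sorted_pvalue_le// /BH_threshold.
have sub : [pred i | p i <= BH_threshold q p] \subset [pred i | p i <= BH_level].
  by apply/fintype.subsetP => k; rewrite !inE => /le_trans; apply.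
have := subset_leqif_card sub.
move=> /leqifP; rewrite -/(pcount _) -/(pcount _) ct cl ltnn.
case: ifP => // /fintype.subsetP h _.
apply/idP/idP => [/le_trans|]; first exact.
by move=> hi; have := h i; rewrite !inE; apply.
Qed.

Definition null_count (h : 'I_m -> bool) (t : R) : nat :=
  #|[pred i | (p i <= t) && ~~ h i]|.

Lemma FDP_level (h : 'I_m -> bool) : 0 <= q -> (forall i, 0 < p i) ->
  FDP q p h = (null_count h BH_level)%:R / (maxn Rej 1)%:R.
Proof.
move=> q0 pp; rewrite /FDP /false_rejections /null_count; congr (_%:R / _).
by apply: eq_card => i; rewrite !inE BH_threshold_level.
Qed.

Lemma BH_level_count : 0 < q -> (0 < m)%N ->
  (pcount BH_level)%:R = m%:R * BH_level / q.
Proof.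
move=> q0 m0; rewrite BH_rejections_count 1?ltW// /BH_level.
by field; rewrite ?gt_eqF ?ltr0n.
Qed.

(** With j the count at [t], the hypothesis says t <= j q / m; the count at j q / m is then at least
    j, and maximality applies. A single point thus certifies a lower bound on the level. *)
Lemma BH_level_ge (t : R) : 0 < q -> (0 < m)%N ->
  m%:R * t / q <= (pcount t)%:R -> t <= BH_level.
Proof.
move=> q0 m0 h.
have mR : (0 : R) < m%:R by rewrite ltr0n.
have tj : t <= (pcount t)%:R * q / m%:R.
  by move: h; rewrite ler_pdivrMr// ler_pdivlMr// mulrC.
apply: (le_trans tj); rewrite /BH_level; apply: ler_wpM2r; first by rewrite invr_ge0.
apply: ler_wpM2r; first exact: ltW.
rewrite ler_nat; apply: BH_rejections_max; first exact: ltW.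
  exact: pcount_le_size.
exact: pcount_homo.
Qed.

End BHCombinatorics.

(** * Measurability of the false discovery proportion *)

Section PatternMeasurability.
Context (d : measure_display) (T : measurableType d) (R : realType).

(* FDP depends on w only through finitely many comparisons. *)
Lemma measurable_fun_pattern (I : finType) (b : I -> T -> bool)
    (G : {ffun I -> bool} -> R) : (forall i, measurable_fun setT (b i)) ->
  measurable_fun setT (fun w => G [ffun i => b i w]).
Proof.
move=> mb.
rewrite (_ : (fun w => _) = fun w => \sum_(c : {ffun I -> bool})
    G c * \prod_i \1_(b i @^-1` [set c i]) w).
  apply: measurable_sum => c; apply: measurable_funM => //.
  apply: measurable_prod => i _; apply: measurable_indic.
  by rewrite -[X in measurable X]setTI; exact: mb.
apply/funext => w; rewrite (bigD1 [ffun i => b i w])//= [X in _ + X]big1 ?addr0.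
  by rewrite big1 ?mulr1// => i _; rewrite indicE mem_set//= ffunE.
move=> c cb; have [i hi] : exists i, b i w != c i.
  apply/existsP; apply: contraR cb; rewrite negb_exists => /forallP h.
  by apply/eqP/ffunP => i; rewrite ffunE; have := h i; rewrite negbK => /eqP.
rewrite (bigD1 i)//= indicE memNset ?mul0r ?mulr0//=.
by move/eqP: hi => hi h; apply: hi; rewrite h.
Qed.

Lemma measurable_FDP (q : R) (m : nat) (p : 'I_m -> T -> R) (h : 'I_m -> T -> bool) :
  0 <= q -> (forall i w, 0 < p i w) ->
  (forall i, measurable_fun setT (p i)) -> (forall i, measurable_fun setT (h i)) ->
  measurable_fun setT (fun w => FDP q (p ^~ w) (h ^~ w)).
Proof.
move=> q0 p0 mp mh.
pose b (x : 'I_m.+1 * 'I_m + 'I_m) (w : T) : bool :=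
  match x with
  | inl (j, i) => p i w <= j%:R * q / m%:R
  | inr i => h i w
  end.
(* The number of rejections read off the table of comparisons; the clause for j = 0 reproduces the
   convention that the order statistic of index 0 is 0. *)
pose rej (c : {ffun 'I_m.+1 * 'I_m + 'I_m -> bool}) : nat :=
  \max_(j < m.+1 | (j == 0 :> nat) || (j <= #|[pred i | c (inl (j, i))]|)%N) j.
pose G (c : {ffun 'I_m.+1 * 'I_m + 'I_m -> bool}) : R :=
  #|[pred i | c (inl (inord (rej c), i)) && ~~ c (inr i)]|%:R / (maxn (rej c) 1)%:R.
rewrite (_ : (fun w => _) = fun w => G [ffun x => b x w]).
  apply: measurable_fun_pattern => -[[j i]|i]; last exact: mh.
  by apply: measurable_fun_ler => //; exact: measurable_cst.
apply/funext => w; rewrite FDP_level//.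
have rE : rej [ffun x => b x w] = BH_rejections q (p ^~ w).
  apply: eq_bigl => j; have [j0|j0] := posnP j.
    by rewrite j0 /sorted_pvalue /= !mul0r lexx.
  rewrite sorted_pvalue_le; last by rewrite j0 -ltnS ltn_ord.
  rewrite /=; congr (_ <= _)%N; apply: eq_card => i.
  by rewrite !inE ffunE.
rewrite /G rE; congr (_%:R / _); apply: eq_card => i.
rewrite !inE !ffunE /= inordK// ltnS; exact: BH_rejections_le.
Qed.

End PatternMeasurability.

(** * The normal tail and the limiting threshold *)

Section MonotoneFromDerivative.
Context (R : realType) (f df : R -> R).
Hypothesis fd : forall x : R, is_derive x 1 f (df x).

Lemma continuous_of_derive : continuous f.
Proof.
by move=> x; apply/differentiable_continuous/derivable1_diffP; have [] := fd x.
Qed.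

Lemma le_of_derive (a b : R) : a <= b -> (forall x, a <= x <= b -> 0 <= df x) ->
  f a <= f b.
Proof.
move=> ab h; rewrite -subr_ge0.
have [c + ->] := MVT_segment ab (fun x _ => fd x)
  (continuous_subspaceT continuous_of_derive).
by rewrite in_itv/= => hc; rewrite mulr_ge0 ?subr_ge0// h.
Qed.

Lemma lt_of_derive (a b : R) : a < b -> (forall x, a < x < b -> 0 < df x) ->
  f a < f b.
Proof.
move=> ab h; rewrite -subr_gt0.
have [c + ->] := MVT ab (fun x _ => fd x)
  (continuous_subspaceT continuous_of_derive).
by rewrite in_itv/= => hc; rewrite mulr_gt0 ?subr_gt0// h.
Qed.

End MonotoneFromDerivative.

Section NormalTail.
Context (R : realType).
Local Notation mu := (@lebesgue_measure R).
Implicit Types x y t : R.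

Let p : R -> R := normal_pdf 0 1.

Let p_gt0 x : 0 < p x.
Proof.
rewrite /p normal_pdfE ?oner_neq0//; apply: mulr_gt0.
  by apply: normal_peak_gt0; exact: oner_neq0.
exact: expR_gt0.
Qed.

Lemma is_derive_Phi x : is_derive x 1 (@Phi R) (normal_pdf 0 1 x).
Proof.
have [] := @continuous_FTC1 R p -oo%O x (x + 1).
- by rewrite ltrDl.
- by apply: (integrableS measurableT) => //; exact: integrable_normal_pdf.
- by rewrite ltNyr.
- by apply: continuous_normal_pdf; exact: oner_neq0.
move=> h1 h2; apply: DeriveDef; first exact: h1.
by rewrite -derive1E -[RHS]h2.
Qed.

Lemma is_derive_Phibar x : is_derive x 1 (@Phibar R) (- normal_pdf 0 1 x).
Proof.
have h := is_deriveB (is_derive_cst (1 : R) x 1) (is_derive_Phi x).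
by apply: is_derive_eq h _; rewrite sub0r.
Qed.

Lemma continuous_Phibar : continuous (@Phibar R).
Proof. exact: continuous_of_derive is_derive_Phibar. Qed.

Lemma Phibar_lt x y : x < y -> Phibar y < Phibar x.
Proof.
move=> xy; rewrite -ltrN2.
have dN (u : R) : is_derive u 1 (fun u => - Phibar u) (p u).
  have h := is_deriveN (is_derive_Phibar u).
  by apply: is_derive_eq h _; rewrite opprK.
by apply: (lt_of_derive dN xy) => u _; exact: p_gt0.
Qed.

Lemma Phibar_ltE x y : (Phibar y < Phibar x) = (x < y).
Proof.
apply/idP/idP; last exact: Phibar_lt.
apply: contraTT; rewrite -!leNgt le_eqVlt => /predU1P[->//|/Phibar_lt/ltW//].
Qed.

Lemma Phibar_leE x y : (Phibar y <= Phibar x) = (x <= y).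
Proof. by rewrite !leNgt Phibar_ltE. Qed.

Lemma Phibar_tail x : Phibar x = fine (normal_prob 0 1 `]x, +oo[).
Proof.
have mI : measurable (`]-oo, x]%classic : set (measurableTypeR R)) by exact: measurable_itv.
have -> : `]x, +oo[%classic = ~` (`]-oo, x]%classic : set (measurableTypeR R)).
  by rewrite setCitvl.
by rewrite probability_setC// fineB// fin_num_measure.
Qed.

Lemma Phibar_gt0 x : 0 < Phibar x.
Proof.
apply: (@le_lt_trans _ _ (Phibar (x + 1))); last by apply: Phibar_lt; rewrite ltrDl.
by rewrite Phibar_tail fine_ge0.
Qed.

Lemma Phibar_lt1 x : Phibar x < 1.
Proof.
apply: (@lt_le_trans _ _ (Phibar (x - 1))); first by apply: Phibar_lt; rewrite ltrBlDr ltrDl.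
by rewrite /Phibar /Phi lerBlDr lerDl fine_ge0.
Qed.

Lemma Phibar_small e : 0 < e -> exists2 x0 : R, 0 < x0 &
  forall x, x0 <= x -> Phibar x <= e /\ 1 - e <= Phibar (- x).
Proof.
move=> e0; have [K K0 hK] := probability_tight (normal_prob 0 1) e0.
have mK : measurable ([set y | K < `|y|] : set (measurableTypeR R)).
  by apply: measurable_set_lt => //; exact: (@normr_measurable R setT).
exists (K + 1) => [|x Kx]; first by rewrite addr_gt0.
have le_tail (B : set (measurableTypeR R)) : measurable B ->
    B `<=` [set y : R | K < `|y|] -> fine (normal_prob 0 1 B) <= e.
  move=> mB BK; rewrite (le_trans _ hK)//; apply: fine_le; rewrite ?fin_num_measure//.
  by apply: le_measure; rewrite ?inE.
split.
  rewrite Phibar_tail; apply: le_tail; first exact: measurable_itv.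
  move=> y /=; rewrite in_itv/= andbT => xy.
  by apply: lt_le_trans (ler_norm _); lra.
rewrite /Phibar lerD2l lerN2 /Phi; apply: le_tail; first exact: measurable_itv.
move=> y /=; rewrite in_itv/= => xy.
by rewrite -normrN; apply: lt_le_trans (ler_norm _); lra.
Qed.

Lemma ivt_continuous (f : R -> R) (a b v : R) : continuous f -> a <= b ->
  Num.min (f a) (f b) <= v <= Num.max (f a) (f b) ->
  exists2 c, a <= c <= b & f c = v.
Proof.
move=> cf ab hv; have [c + fc] := IVT ab (continuous_subspaceT cf) hv.
by rewrite in_itv/= => hc; exists c.
Qed.

Lemma Phibar_surj t : 0 < t < 1 -> exists x : R, Phibar x = t.
Proof.
move=> /andP[t0 t1].
have [x1 x10 h1] := @Phibar_small t t0.
have t10 : 0 < 1 - t by rewrite subr_gt0.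
have [x2 x20 h2] := @Phibar_small (1 - t) t10.
have [a1 _] := h1 _ (lexx _); have [_ a2] := h2 _ (lexx _).
have [||c _ <-] := @ivt_continuous (@Phibar R) (- x2) x1 t continuous_Phibar.
- by lra.
- by rewrite ge_min le_max a1 orbT/=; apply/orP; left; lra.
by exists c.
Qed.

Lemma Phibar_invK x : Phibar_inv (Phibar x) = x%:E.
Proof.
rewrite /Phibar_inv; apply/eqP; rewrite eq_le; apply/andP; split.
  by apply: ereal_inf_lbound; exists x => //=.
by apply: le_ereal_inf_tmp => _ [y /= + <-]; rewrite Phibar_leE lee_fin.
Qed.

(** The exponential factor is the likelihood ratio of N(a, 1) to N(0, 1). *)
Lemma normal_pdf_shift x (a : R) : normal_pdf 0 1 (x - a) =
  normal_pdf 0 1 x * expR (a * x - a ^+ 2 / 2).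
Proof.
rewrite !normal_pdfE ?oner_neq0// -mulrA /normal_fun -expRD; congr (_ * expR _).
by rewrite expr1n; field.
Qed.

End NormalTail.

Section TwoGroupRoot.
Context (R : realType) (q a pi1 : R).
Hypothesis hq : 0 < q < 1.
Hypothesis a0 : 0 < a.
Hypothesis hpi : 0 < pi1 < 1.

(** Solving the equation at t = Phibar x for the nonnull term gives Phibar(x - a) = kappa Phibar x;
    q < 1 makes kappa exceed 1. *)
Let kappa := (q^-1 - (1 - pi1)) / pi1.

Let kappa_gt1 : 1 < kappa.
Proof.
have /andP[q0 q1] := hq; have /andP[p0 p1] := hpi.
have q1i : 1 < q^-1 by rewrite invf_gt1.
by rewrite /kappa ltr_pdivlMr// mul1r; lra.
Qed.

Let h (x : R) := Phibar (x - a) - kappa * Phibar x.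
Let E (x : R) := expR (a * x - a ^+ 2 / 2).

Let dh (x : R) : is_derive x 1 h (normal_pdf 0 1 x * (kappa - E x)).
Proof.
have h1 : is_derive x 1 (fun x => Phibar (x - a)) (- normal_pdf 0 1 (x - a)).
  have hs := is_derive_affine 1 (- a) x.
  have := @is_derive1_comp R (@Phibar R) (fun y : R => y * 1 - a) x _ _
    (is_derive_Phibar _) hs.
  rewrite mulr1 mulr1 (_ : _ \o _ = (fun x => Phibar (x - a)))//.
  by apply/funext => y; rewrite /= mulr1.
have h2 := is_deriveM' (is_derive_cst kappa x 1) (is_derive_Phibar x).
have h3 := is_deriveB h1 h2.
apply: is_derive_eq h3 _.
by rewrite normal_pdf_shift -/(E x) /=; ring.
Qed.

Let E_lt (x y : R) : x < y -> E x < E y.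
Proof. by move=> xy; rewrite /E ltr_expR ltrD2r ltr_pM2l. Qed.

Let E_le (x y : R) : x <= y -> E x <= E y.
Proof. by move=> xy; rewrite /E ler_expR lerD2r ler_pM2l. Qed.

Let pdf_gt0 (x : R) : 0 < normal_pdf 0 1 x.
Proof.
rewrite normal_pdfE ?oner_neq0//; apply: mulr_gt0.
  by apply: normal_peak_gt0; exact: oner_neq0.
exact: expR_gt0.
Qed.

Let x0 := (ln kappa + a ^+ 2 / 2) / a.

Let Ex0 : E x0 = kappa.
Proof.
rewrite /E /x0 (_ : _ - _ = ln kappa).
  by rewrite lnK// posrE (lt_trans _ kappa_gt1).
by field; rewrite gt_eqF.
Qed.

Let h_incr (x y : R) : x < y -> y <= x0 -> h x < h y.
Proof.
move=> xy yx0; apply: (lt_of_derive dh xy) => u /andP[_ uy].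
rewrite mulr_gt0// subr_gt0 -Ex0; apply: E_lt; exact: lt_le_trans uy yx0.
Qed.

Let h_decr (x y : R) : x0 <= x -> x < y -> h y < h x.
Proof.
move=> x0x xy; rewrite -ltrN2.
have dN (u : R) : is_derive u 1 (fun u => - h u) (normal_pdf 0 1 u * (E u - kappa)).
  have hN := is_deriveN (dh u).
  by apply: is_derive_eq hN _; rewrite -mulrN opprB.
apply: (lt_of_derive dN xy) => u /andP[xu _].
rewrite mulr_gt0// subr_gt0 -Ex0; apply: E_lt; exact: le_lt_trans x0x xu.
Qed.

Let h_pos (x : R) : x0 <= x -> 0 < h x.
Proof.
move=> x0x; rewrite ltNge; apply/negP => hx.
have h1 : h (x + 1) < 0 by apply: lt_le_trans hx; apply: h_decr; rewrite ?ltrDl.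
have k0 : 0 < kappa by apply: lt_trans kappa_gt1.
(* With this [e], h y >= - kappa Phibar y >= h(x + 1) / 2 for large y, whereas [h] has already
   decreased below the negative number h(x + 1). *)
pose e := - h (x + 1) / (2 * kappa).
have e0 : 0 < e by apply: divr_gt0; [rewrite oppr_gt0|exact: mulr_gt0].
have [K K0 hK] := Phibar_small e0.
pose y := Num.max K (x + 2).
have Ky : K <= y by rewrite le_max lexx.
have [Py _] := hK y Ky.
have hy : h y < h (x + 1).
  apply: h_decr; first by apply: le_trans x0x _; rewrite lerDl.
  by rewrite /y lt_max; apply/orP; right; rewrite ltrD2l ltr1n.
have h3 := Phibar_gt0 (y - a).
have h4 : kappa * Phibar y <= - h (x + 1) / 2.
  rewrite (_ : _ / 2 = kappa * e); first by rewrite ler_pM2l.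
  by rewrite /e; field; rewrite gt_eqF.
have h5 : h y = Phibar (y - a) - kappa * Phibar y by [].
by move: h1 hy h3 h4; rewrite h5; lra.
Qed.

Let root_ex : exists2 xs, xs < x0 & h xs = 0.
Proof.
have k1 := kappa_gt1; have k0 : 0 < kappa by apply: lt_trans k1.
(* Far to the left Phibar is within this distance of 1, hence above 1 / kappa, which makes [h]
   negative there. *)
have e0 : 0 < (1 - kappa^-1) / 2.
  by rewrite divr_gt0// subr_gt0 invf_lt1.
have [K K0 hK] := Phibar_small e0.
pose y := Num.max K `|x0|.
have Ky : K <= y by rewrite le_max lexx.
have [_ Py] := hK y Ky.
have yx0 : - y <= x0.
  have : `|x0| <= y by rewrite /y le_max lexx orbT.
  by rewrite ler_norml => /andP[].
have Py' : kappa^-1 < Phibar (- y).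
  have : kappa^-1 < 1 by rewrite invf_lt1.
  by move: Py; move: (Phibar _) (kappa^-1) => u v; lra.
have hy : h (- y) < 0.
  have h1 := Phibar_lt1 (- y - a).
  have h2 : 1 < kappa * Phibar (- y) by rewrite mulrC -ltr_pdivrMr// mul1r.
  by rewrite -[h _]/(Phibar (- y - a) - kappa * Phibar (- y)); lra.
have hx0 := h_pos (lexx x0).
have ch : continuous h by exact: continuous_of_derive dh.
have [|c /andP[_ cx] hc] := @ivt_continuous _ h (- y) x0 0 ch yx0.
  by rewrite ge_min le_max (ltW hy) (ltW hx0) orbT.
exists c => //; rewrite lt_neqAle cx andbT; apply/eqP => cx0.
by move: hc; rewrite cx0 => /eqP; rewrite gt_eqF.
Qed.

Let eqn_h (x : R) : (1 - pi1) * Phibar x + pi1 * Phibar (x - a) =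
  Phibar x / q + pi1 * h x.
Proof.
have /andP[p0 p1] := hpi; have /andP[q0 q1] := hq.
by rewrite /h /kappa; field; rewrite !gt_eqF.
Qed.

(* With t = Phibar x the equation for tau reads h x = 0.  The likelihood ratio E is
   increasing, so h increases up to x0 and then decreases to 0, staying positive;
   its root is therefore unique, and h' > 0 there gives the linear gap c. *)
Lemma two_group_root : exists xs : R, exists2 c : R, 0 < c &
  exists2 delta : R, 0 < delta &
  [/\ unique (fun t : R => 0 < t < 1 /\
        t / q = (1 - pi1) * t + pi1 * Phibar (fine (Phibar_inv t) - a)) (Phibar xs),
      forall x, x <= xs -> (1 - pi1) * Phibar x + pi1 * Phibar (x - a) <=
        Phibar x / q - c * (Phibar x - Phibar xs)
    & forall x, xs <= x -> Phibar xs - Phibar x <= delta ->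
        Phibar x / q + c * (Phibar xs - Phibar x) <=
        (1 - pi1) * Phibar x + pi1 * Phibar (x - a)].
Proof.
have /andP[p0 p1] := hpi.
have [xs xs0 hxs] := root_ex.
(* Stopping halfway to [x0] keeps kappa - E at least [c > 0] up to [x1]. Then h' >= c times the
   density, so h + c Phibar is nondecreasing there; both gap inequalities compare it with its value
   at [xs]. *)
pose x1 := (xs + x0) / 2.
have xs1 : xs < x1 by rewrite /x1; lra.
have x10 : x1 < x0 by rewrite /x1; lra.
pose c := kappa - E x1.
have c0 : 0 < c by rewrite subr_gt0 -Ex0; exact: E_lt.
have g_mono (x y : R) : x <= y -> y <= x1 -> h x + c * Phibar x <= h y + c * Phibar y.
  move=> xy yx1.
  have dg (u : R) : is_derive u 1 (fun u => h u + c * Phibar u)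
      (normal_pdf 0 1 u * (E x1 - E u)).
    have h2 := is_deriveM' (is_derive_cst c u 1) (is_derive_Phibar u).
    have h3 := is_deriveD (dh u) h2.
    by apply: is_derive_eq h3 _; rewrite /c /=; ring.
  apply: (le_of_derive dg xy) => u /andP[_ uy].
  by rewrite mulr_ge0 ?(ltW (pdf_gt0 u))// subr_ge0; apply: E_le; exact: le_trans yx1.
exists xs, (pi1 * c); first exact: mulr_gt0.
exists (Phibar xs - Phibar x1); first by rewrite subr_gt0 Phibar_ltE.
split.
- split.
    split; first by rewrite Phibar_gt0 Phibar_lt1.
    by rewrite Phibar_invK/= eqn_h hxs mulr0 addr0.
  move=> t [/Phibar_surj[x <-]]; rewrite Phibar_invK/= eqn_h => hx.
  have {}hx : h x = 0.
    apply/eqP; have : pi1 * h x = 0 by lra.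
    by move/eqP; rewrite mulf_eq0 gt_eqF.
  have xx0 : x < x0.
    by rewrite ltNge; apply/negP => /h_pos; rewrite hx ltxx.
  congr Phibar; apply/eqP; rewrite eq_le !leNgt; apply/andP; split; apply/negP => xx.
    by have := h_incr xx (ltW xs0); rewrite hx hxs ltxx.
  by have := h_incr xx (ltW xx0); rewrite hx hxs ltxx.
- move=> x xxs; rewrite eqn_h lerD2l.
  have := g_mono _ _ xxs (ltW xs1); rewrite hxs => hg.
  rewrite -mulrN -mulrA ler_pM2l//; lra.
- move=> x xsx; rewrite lerD2l lerN2 Phibar_leE => xx1.
  rewrite eqn_h lerD2l -mulrA ler_pM2l//.
  by have := g_mono _ _ xsx xx1; rewrite hxs; lra.
Qed.

End TwoGroupRoot.

(** * Gaussian vectors and the two-group model *)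

Section ChangeOfLaw.
Context (d d' : measure_display) (T : measurableType d) (T' : measurableType d').
Context (R : realType) (P : probability T R) (Q : probability T' R).

Lemma Ex_law (Z : T -> T') (g : T' -> R) : measurable_fun setT Z ->
  (forall B, measurable B -> P (Z @^-1` B) = Q B) -> bmeas g ->
  Ex P (g \o Z) = Ex Q g.
Proof.
move=> mZ hZ bg; rewrite /Ex /Rintegral.
have bgZ : bmeas (g \o Z).
  have [mg [C hC]] := bg; split; first exact: measurableT_comp.
  by exists C => w; exact: hC.
have iP := bmeas_integrable P bgZ.
congr fine.
have -> : (\int[Q]_w (g w)%:E = \int[pushforward P Z]_w (g w)%:E)%E.
  by apply: eq_measure_integral => A mA _; apply/esym; exact: hZ.
rewrite integral_pushforward//.
by apply/measurable_EFinP; exact: (bmeas_measurable bg).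
Qed.

End ChangeOfLaw.

Section GaussianVector.
Context (R : realType) (d : measure_display) (T : measurableType d).
Context (P : probability T R) (m : nat) (S : 'M[R]_m).
Unset Implicit Arguments.
Context (eps : 'I_m -> {RV P >-> R}).
Set Implicit Arguments.
Hypothesis hpsd : psd S.
Hypothesis hG : centered_gaussian_vector eps S.

Definition quad (a b : 'I_m -> R) : R := \sum_i \sum_j a i * S i j * b j.

Definition lin (a : 'I_m -> R) (w : T) : R := \sum_i a i * eps i w.

Let quadE (a : 'I_m -> R) :
  ((\row_i a i) *m S *m (\row_i a i)^T) 0 0 = quad a a.
Proof.
rewrite mxE /quad exchange_big/=; apply: eq_bigr => j _.
rewrite !mxE big_distrl/=; apply: eq_bigr => i _.
by rewrite !mxE.
Qed.

Lemma quad_ge0 a : 0 <= quad a a.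
Proof. by rewrite -quadE; exact: hpsd.2. Qed.

Lemma measurable_lin a : measurable_fun setT (lin a).
Proof.
apply: measurable_sum => i; apply: measurable_funM => //.
Qed.

Lemma lin_law a (B : set R) : measurable B ->
  P (lin a @^-1` B) = normal_law 0 (quad a a) B.
Proof.
move=> mB; rewrite -quadE -(hG (\row_i a i) mB).
congr (P _); apply/seteqP; split=> w /=; rewrite /lin;
  by under eq_bigr do rewrite mxE.
Qed.

Lemma Ex_cos_lin a th :
  Ex P (fun w => cos (lin a w + th)) = cos th * expR (- (quad a a / 2)).
Proof.
have := @Ex_cos_normal_law R (quad a a) 1 th (quad_ge0 a).
rewrite expr1n mulr1 => <-.
rewrite -(@Ex_law _ _ _ (measurableTypeR R) _ P (normal_law 0 (quad a a)) (lin a)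
  (fun x => cos (1 * x + th))).
- by apply: eq_Ex => w; rewrite /= mul1r.
- exact: measurable_lin.
- exact: lin_law.
- by apply: bmeas_cos; apply: measurable_funD => //; exact: measurable_funM.
Qed.

Lemma bmeas_cos_lin a th : bmeas (fun w => cos (lin a w + th)).
Proof. by apply: bmeas_cos; apply: measurable_funD => //; exact: measurable_lin. Qed.

Lemma linD a b w : lin (fun i => a i + b i) w = lin a w + lin b w.
Proof. by rewrite /lin -big_split/=; apply: eq_bigr => i _; rewrite mulrDl. Qed.

Lemma linB a b w : lin (fun i => a i - b i) w = lin a w - lin b w.
Proof. by rewrite /lin -sumrB; apply: eq_bigr => i _; rewrite mulrBl. Qed.

Definition block_phase (I : pred 'I_m) (f : T -> R) : Prop :=
  exists2 a : 'I_m -> R, (forall i, ~~ I i -> a i = 0) & f = lin a.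

Lemma phase_space_block I : phase_space (block_phase I).
Proof.
split=> [|f g [a ha ->] [b hb ->]|f g [a ha ->] [b hb ->]].
- exists (fun=> 0) => //; apply/funext => w; rewrite /lin big1// => i _.
  by rewrite mul0r.
- exists (fun i => a i + b i) => [i Ii|]; first by rewrite ha// hb// addr0.
  by apply/funext => w; rewrite linD.
- exists (fun i => a i - b i) => [i Ii|]; first by rewrite ha// hb// subrr.
  by apply/funext => w; rewrite linB.
Qed.

Lemma block_phase_coord (I : pred 'I_m) i k : I i -> block_phase I (fun w => k * eps i w).
Proof.
move=> Ii; exists (fun j => if j == i then k else 0) => [j nIj|].
  by case: eqP => // ji; rewrite ji Ii in nIj.
apply/funext => w; rewrite /lin (bigD1 i)//= eqxx big1 ?addr0// => j /negbTE ->.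
by rewrite mul0r.
Qed.

Definition orthogonal_blocks (I J : pred 'I_m) : Prop :=
  forall i j, I i -> J j -> S i j = 0.

Lemma quad_orth (I J : pred 'I_m) a b : orthogonal_blocks I J ->
  (forall i, ~~ I i -> a i = 0) -> (forall i, ~~ J i -> b i = 0) -> quad a b = 0.
Proof.
move=> IJ ha hb; rewrite /quad big1// => i _; rewrite big1// => j _.
have [Ii|/ha->] := boolP (I i); last by rewrite !mul0r.
have [Jj|/hb->] := boolP (J j); last by rewrite mulr0.
by rewrite (IJ i j)// mulr0 mul0r.
Qed.

Lemma quadC a b : quad a b = quad b a.
Proof.
rewrite /quad exchange_big/=; apply: eq_bigr => i _; apply: eq_bigr => j _.
have : S^T j i = S j i by rewrite hpsd.1.
rewrite mxE => ->; ring.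
Qed.

Lemma quadDl a b c : quad (fun i => a i + b i) c = quad a c + quad b c.
Proof.
rewrite /quad -big_split/=; apply: eq_bigr => i _; rewrite -big_split/=.
by apply: eq_bigr => j _; ring.
Qed.

Lemma quadBl a b c : quad (fun i => a i - b i) c = quad a c - quad b c.
Proof.
rewrite /quad -sumrB/=; apply: eq_bigr => i _; rewrite -sumrB/=.
by apply: eq_bigr => j _; ring.
Qed.

Lemma quadDr a b c : quad c (fun i => a i + b i) = quad c a + quad c b.
Proof. by rewrite quadC quadDl !(quadC c). Qed.

Lemma quadBr a b c : quad c (fun i => a i - b i) = quad c a - quad c b.
Proof. by rewrite quadC quadBl !(quadC c). Qed.

(** After the product-to-sum formula, the vanishing cross term gives the phases a + b and a - b the
    same variance; the common exponential factors out and the two cosines recombine into a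
    product. *)
Lemma indep_cosgen (I J : pred 'I_m) : orthogonal_blocks I J ->
  indep_class P (cosgen (block_phase I)) (cosgen (block_phase J)).
Proof.
move=> IJ f g [_ [a ha ->] [u ->]] [_ [b hb ->] [v ->]].
have qab := quad_orth IJ ha hb.
have qD : quad (fun i => a i + b i) (fun i => a i + b i) = quad a a + quad b b.
  by rewrite quadDl !quadDr (quadC b a) qab addr0 add0r.
have qB : quad (fun i => a i - b i) (fun i => a i - b i) = quad a a + quad b b.
  by rewrite quadBl !quadBr (quadC b a) qab subr0 sub0r opprK.
have e w : cos (lin a w + u) * cos (lin b w + v) =
   1 / 2 * (cos (lin (fun i => a i + b i) w + (u + v))
    + cos (lin (fun i => a i - b i) w + (u - v))).
  rewrite linD linB.
  have -> : lin a w + lin b w + (u + v) = (lin a w + u) + (lin b w + v) by ring.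
  have -> : lin a w - lin b w + (u - v) = (lin a w + u) - (lin b w + v) by ring.
  by move: (lin a w + u) (lin b w + v) => x y; rewrite cosD cosB; field.
rewrite (eq_Ex P e) ExZ; last by apply: bmeasD; exact: bmeas_cos_lin.
rewrite ExD; [|exact: bmeas_cos_lin|exact: bmeas_cos_lin].
rewrite !Ex_cos_lin qD qB.
have -> : - ((quad a a + quad b b) / 2) = - (quad a a / 2) + - (quad b b / 2) by ring.
by rewrite expRD cosD cosB; field.
Qed.

Lemma bmeas_cosgen_block (I : pred 'I_m) f : cosgen (block_phase I) f -> bmeas f.
Proof. by move=> [_ [a _ ->] [u ->]]; exact: bmeas_cos_lin. Qed.

Lemma indep_blim_block (I J : pred 'I_m) : orthogonal_blocks I J ->
  indep_class P (blim (trig (block_phase I))) (blim (trig (block_phase J))).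
Proof.
move=> IJ; apply: blim_indep.
- exact: span_bmeas (@bmeas_cosgen_block I).
- exact: span_bmeas (@bmeas_cosgen_block J).
- apply: span_indep (indep_cosgen IJ).
  + exact: bmeas_cosgen_block.
  + exact: bmeas_cosgen_block.
Qed.

(** Constraints are listed, so that intersecting events is concatenating lists. *)
Definition tail_event (s : seq ('I_m * R)) : set T :=
  [set w | all (fun x => x.2 <= eps x.1 w) s].

Lemma measurable_tail_event s : measurable (tail_event s).
Proof.
elim: s => [|[i c] s IH].
  by rewrite (_ : tail_event [::] = setT)//; apply/seteqP; split.
rewrite (_ : tail_event _ = [set w | c <= eps i w] `&` tail_event s).
  by apply: measurableI => //; apply: measurable_set_le => //; exact: measurable_cst.
apply/seteqP; split=> w /=; first by move=> /andP[].
by move=> [h1 h2]; apply/andP; split; [exact: h1|exact: h2].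
Qed.

Lemma tail_event_cat s s' : tail_event (s ++ s') = tail_event s `&` tail_event s'.
Proof.
apply/seteqP; split=> w; rewrite /tail_event /= all_cat; first by move=> /andP[].
by move=> [h1 h2]; apply/andP; split; [exact: h1|exact: h2].
Qed.

Lemma blim_tail_event (I : pred 'I_m) s : all (fun x => I x.1) s ->
  blim (trig (block_phase I)) (\1_(tail_event s) : T -> R).
Proof.
have hV := phase_space_block I.
have mulV : mul_closed (blim (trig (block_phase I))).
  by apply: blim_mul; [exact: trig_bounded|exact: trig_mul].
elim: s => [_|[i c] s IH /= /andP[Ii /IH hs]].
  apply: eq_blim (blim_base (trig_cst 1 hV)) => w.
  by rewrite indicE mem_set.
have h1 := blim_step c hV (fun k => block_phase_coord k Ii).
apply: eq_blim (mulV _ _ h1 hs) => w.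
rewrite !indicE /tail_event.
have [ci|ci] := boolP (c <= eps i w).
  rewrite mul1r; congr (_ %:R); congr nat_of_bool.
  by apply/idP/idP => /set_mem /= => [/andP[_ h]|h]; apply/mem_set => //=; rewrite ci.
rewrite mul0r memNset//= => /andP[h _]; by rewrite h in ci.
Qed.

Lemma tail_event_indep (I J : pred 'I_m) s s' : orthogonal_blocks I J ->
  all (fun x => I x.1) s -> all (fun x => J x.1) s' ->
  fine (P (tail_event (s ++ s'))) = fine (P (tail_event s)) * fine (P (tail_event s')).
Proof.
move=> IJ sI sJ.
have ms := measurable_tail_event s; have ms' := measurable_tail_event s'.
rewrite -!Ex_indic//; last exact: measurable_tail_event.
rewrite -(indep_blim_block IJ (blim_tail_event sI) (blim_tail_event sJ)).
by apply: eq_Ex => w; rewrite tail_event_cat indicI.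
Qed.

Lemma tail_event1 i c : S i i = 1 -> fine (P (tail_event [:: (i, c)])) = Phibar c.
Proof.
move=> Sii.
pose a j : R := if j == i then 1 else 0.
have la w : lin a w = eps i w.
  rewrite /lin (bigD1 i)//= /a eqxx mul1r big1 ?addr0// => j /negbTE ->.
  by rewrite mul0r.
have qa : quad a a = 1.
  rewrite /quad (bigD1 i)//= (bigD1 i)//= /a eqxx mul1r mulr1 Sii.
  rewrite [X in 1 + X + _]big1 ?addr0; last by move=> j /negbTE ->; rewrite mulr0.
  by rewrite big1 ?addr0// => k /negbTE ->; rewrite big1// => j _; rewrite !mul0r.
have -> : tail_event [:: (i, c)] = lin a @^-1` `[c, +oo[.
  by apply/seteqP; split=> w; rewrite /tail_event /= andbT in_itv/= andbT la.
rewrite lin_law; last exact: measurable_itv.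
rewrite qa /normal_law oner_eq0 sqrtr1 Phibar_tail.
congr fine.
(* The event is a closed half-line and [Phibar] the mass of the open one; the endpoint is
   Lebesgue-null, hence null for the normal law. *)
rewrite -(@setU1itv _ R +oo%O c false)// measureU//; last first.
  by apply/seteqP; split=> // y /= [->]; rewrite in_itv/= ltxx.
rewrite -[RHS]add0e; congr (_ + _)%E.
have /null_content_dominatesP h := @normal_prob_dominates R 0 1.
by apply: h; [exact: measurable_set1|exact: lebesgue_measure_set1].
Qed.

End GaussianVector.

(** * Bivariate normal tails *)

Section Bivariate.
Context (R : realType).
Local Notation N01 := (normal_prob (0 : R) 1).

Definition N01xN01 : probability (measurableTypeR R * measurableTypeR R)%type R :=
  (N01 \x N01)%E.

Lemma Ex_cos_N01 (t th : R) :
  Ex N01 (fun x => cos (t * x + th)) = cos th * expR (- (t ^+ 2 / 2)).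
Proof. by rewrite Ex_cos_normal_prob// expr1n mul1r. Qed.

Lemma measurable_lin2 (a b th : R) : measurable_fun setT
  (fun z : measurableTypeR R * measurableTypeR R => a * z.1 + b * z.2 + th).
Proof.
apply: measurable_funD => //; apply: measurable_funD.
  by apply: measurable_funM => //; exact: measurable_fst.
by apply: measurable_funM => //; exact: measurable_snd.
Qed.

Lemma Ex_cos_N01xN01 (a b th : R) :
  Ex N01xN01 (fun z => cos (a * z.1 + b * z.2 + th)) =
  cos th * expR (- ((a ^+ 2 + b ^+ 2) / 2)).
Proof.
have bf : bmeas (fun z : measurableTypeR R * measurableTypeR R =>
    cos (a * z.1 + b * z.2 + th)) by exact: bmeas_cos (measurable_lin2 a b th).
have h := integral12_prod_meas1 (bmeas_integrable N01xN01 bf).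
rewrite /Ex /Rintegral -[X in fine X]h /=.
have e1 x : (\int[N01]_y (cos (a * x + b * y + th))%:E)%E =
    (cos (a * x + th) * expR (- (b ^+ 2 / 2)))%:E.
  have bfx : bmeas (fun y : measurableTypeR R => cos (b * y + (a * x + th))).
    by apply: bmeas_cos; apply: measurable_funD => //; exact: measurable_funM.
  rewrite -Ex_cos_N01 /Ex /Rintegral fineK; last first.
    by apply: integrable_fin_num => //; exact: (bmeas_integrable N01 bfx).
  by apply: eq_integral => y _; congr (cos _)%:E; ring.
have bfa : bmeas (fun x : measurableTypeR R => cos (a * x + th)).
  by apply: bmeas_cos; apply: measurable_funD => //; exact: measurable_funM.
transitivity (Ex N01 (fun x => expR (- (b ^+ 2 / 2)) * cos (a * x + th))).
  by rewrite /Ex /Rintegral; congr fine; apply: eq_integral => x _; rewrite mulrC -e1.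
rewrite ExZ// Ex_cos_N01.
have -> : - ((a ^+ 2 + b ^+ 2) / 2) = - (a ^+ 2 / 2) + - (b ^+ 2 / 2) by ring.
by rewrite expRD; ring.
Qed.

Definition plane_phase (f : R * R -> R) : Prop :=
  exists a b : R, f = fun z => a * z.1 + b * z.2.

Lemma phase_space_plane : phase_space plane_phase.
Proof.
split=> [|f g [a [b ->]] [a' [b' ->]]|f g [a [b ->]] [a' [b' ->]]].
- by exists 0, 0; apply/funext => z; rewrite !mul0r addr0.
- by exists (a + a'), (b + b'); apply/funext => z; ring.
- by exists (a - a'), (b - b'); apply/funext => z; ring.
Qed.

Context (d : measure_display) (T : measurableType d).
Context (P : probability T R) (m : nat) (S : 'M[R]_m).
Unset Implicit Arguments.
Context (eps : 'I_m -> {RV P >-> R}).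
Set Implicit Arguments.
Hypothesis hpsd : psd S.
Hypothesis hG : centered_gaussian_vector eps S.

(** Both pairs give the phase a z1 + b z2 the variance a^2 + b^2 + 2 a b r, hence the same
    trigonometric expectations; the quadrant indicator is a product of two steps, so a bounded limit
    of such polynomials. *)
Lemma tail_event2 (i j : 'I_m) (x y r : R) : i != j -> S i i = 1 -> S j j = 1 ->
  S i j = r -> -1 <= r <= 1 ->
  fine (P (tail_event eps [:: (i, x); (j, y)])) =
  fine (binormal_law r [set z : R * R | x <= z.1 /\ y <= z.2]).
Proof.
move=> ij Sii Sjj Sij /andP[r1 r2].
have Sji : S j i = r by rewrite -Sij -[in RHS]hpsd.1 mxE.
pose X1 (w : T) : R * R := (eps i w, eps j w).
pose s := Num.sqrt (1 - r ^+ 2).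
pose X2 (z : measurableTypeR R * measurableTypeR R) : R * R := (z.1, r * z.1 + s * z.2).
have s2 : s ^+ 2 = 1 - r ^+ 2 by rewrite sqr_sqrtr//; nra.
pose a2 (a b : R) (k : 'I_m) : R := if k == i then a else if k == j then b else 0.
have la a b w : lin eps (a2 a b) w = a * eps i w + b * eps j w.
  rewrite /lin (bigD1 i)//= (bigD1 j) 1?eq_sym//= /a2 eqxx (eq_sym j) (negbTE ij) eqxx.
  by rewrite big1 ?addr0// => k /andP[/negbTE -> /negbTE ->]; rewrite mul0r.
have qa a b : quad S (a2 a b) (a2 a b) = a ^+ 2 + b ^+ 2 + 2 * a * b * r.
  have inner k : \sum_l a2 a b k * S k l * a2 a b l = a2 a b k * (S k i * a + S k j * b).
    rewrite (bigD1 i)//= (bigD1 j) 1?eq_sym//= {2 4}/a2 eqxx (eq_sym j) (negbTE ij) eqxx.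
    rewrite big1 ?addr0; first ring.
    by move=> l /andP[/negbTE li /negbTE lj]; rewrite {2}/a2 li lj mulr0.
  rewrite /quad (eq_bigr _ (fun k _ => inner k)).
  rewrite (bigD1 i)//= (bigD1 j) 1?eq_sym//= {1 2}/a2 eqxx (eq_sym j) (negbTE ij) eqxx.
  rewrite Sii Sjj Sij Sji big1 ?addr0; first ring.
  by move=> l /andP[/negbTE li /negbTE lj]; rewrite /a2 li lj mul0r.
have b1 f : cosgen plane_phase f -> bmeas (f \o X1).
  move=> [_ [a [b ->]] [th ->]]; apply: eq_bmeas (bmeas_cos_lin eps (a2 a b) th) => w.
  by rewrite /= la.
have b2 f : cosgen plane_phase f -> bmeas (f \o X2).
  move=> [_ [a [b ->]] [th ->]].
  apply: eq_bmeas (bmeas_cos (measurable_lin2 (a + b * r) (b * s) th)) => z.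
  by rewrite /=; congr cos; ring.
have e12 f : cosgen plane_phase f -> Ex P (f \o X1) = Ex N01xN01 (f \o X2).
  move=> [_ [a [b ->]] [th ->]].
  rewrite (eq_Ex P (g := fun w => cos (lin eps (a2 a b) w + th))); last first.
    by move=> w; rewrite /= la.
  have q2 : (a + b * r) ^+ 2 + (b * s) ^+ 2 = a ^+ 2 + b ^+ 2 + 2 * a * b * r.
    by rewrite exprMn s2; ring.
  rewrite (Ex_cos_lin hpsd hG) qa.
  rewrite (eq_Ex N01xN01 (g := fun z => cos ((a + b * r) * z.1 + (b * s) * z.2 + th))).
    by rewrite Ex_cos_N01xN01 q2.
  by move=> z; rewrite /=; congr cos; ring.
have hV := phase_space_plane.
have mulV : mul_closed (blim (trig plane_phase)).
  by apply: blim_mul; [exact: trig_bounded|exact: trig_mul].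
have st1 : blim (trig plane_phase) (fun z => (x <= z.1)%R%:R).
  by apply: blim_step => // k; exists k, 0; apply/funext => z; rewrite mul0r addr0.
have st2 : blim (trig plane_phase) (fun z => (y <= z.2)%R%:R).
  by apply: blim_step => // k; exists 0, k; apply/funext => z; rewrite mul0r add0r.
have [_ _ h] := blim_eq_law (span_eq_law b1 b2 e12) (mulV _ _ st1 st2).
have mte := measurable_tail_event eps [:: (i, x); (j, y)].
rewrite -Ex_indic//.
have -> : Ex P \1_(tail_event eps [:: (i, x); (j, y)]) =
    Ex P ((fun z => (x <= z.1)%R%:R * (y <= z.2)%R%:R) \o X1).
  apply: eq_Ex => w; rewrite indicE /tail_event /X1 /=.
  have [h1|h1] := boolP (x <= eps i w); last first.
    by rewrite mul0r memNset//= => /andP[h2 _]; rewrite h2 in h1.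
  have [h2|h2] := boolP (y <= eps j w).
    by rewrite mulr1 mem_set//= h1 h2.
  by rewrite mulr0 memNset//= => /and3P[_ h3 _]; rewrite h3 in h2.
rewrite h.
pose B : set (measurableTypeR R * measurableTypeR R) :=
  [set z | x <= z.1] `&` [set z | y <= r * z.1 + s * z.2].
have mB : measurable B.
  apply: measurableI; apply: measurable_set_le; try exact: measurable_cst.
    exact: measurable_fst.
  apply: eq_measurable_fun (measurable_lin2 r s 0) => z _.
  by rewrite addr0.
have -> : binormal_law r [set z : R * R | x <= z.1 /\ y <= z.2] = N01xN01 B by [].
rewrite -Ex_indic//; apply: eq_Ex => z; rewrite indicE /B /X2 /=.
have [h1|h1] := boolP (x <= z.1); last first.
  by rewrite mul0r memNset//= => -[h2 _]; rewrite h2 in h1.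
have [h2|h2] := boolP (y <= r * z.1 + s * z.2).
  by rewrite mulr1 mem_set.
by rewrite mulr0 memNset//= => -[_ h3]; rewrite h3 in h2.
Qed.

End Bivariate.

Lemma span_mono (T : Type) (R : realType) (G G' : (T -> R) -> Prop) f :
  (forall g, G g -> G' g) -> span G f -> span G' f.
Proof.
move=> GG'; elim=> {f} [f /GG'|f g _ h1 _ h2|c f _ h]; first exact: span_gen.
  exact: span_add.
exact: span_scale.
Qed.

Lemma card_nil (I : finType) : #|([::] : seq I)| = 0%N.
Proof. exact: eq_card0. Qed.

Lemma card_seq1 (I : finType) (i : I) : #|[:: i]| = 1%N.
Proof. by rewrite -(card1 i); apply: eq_card => j; rewrite !inE. Qed.

Section Toeplitz.
Context (R : realType) (M : nat) (rho : nat -> R) (m : nat).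
Local Notation S := (toeplitz_corr M rho m).

Lemma toeplitz_diag i : S i i = 1.
Proof.
rewrite mxE eqxx big_nat_cond big1 ?addr0// => l /andP[/andP[l0 _] _].
by rewrite subrr absz0 eq_sym (gtn_eqF l0) mulr0.
Qed.

Lemma toeplitz_lag (i j : 'I_m) (l : nat) : (0 < l <= M)%N -> (i + l = j)%N ->
  S i j = rho l /\ S j i = rho l.
Proof.
move=> /andP[l0 lM] ij.
have ne : i != j by rewrite -val_eqE /=; lia.
have d1 : `|i%:Z - j%:Z|%N = l by lia.
have d2 : `|j%:Z - i%:Z|%N = l by lia.
have key : \sum_(1 <= k < M.+1) rho k * (l == k)%:R = rho l.
  rewrite (bigD1_seq l) ?mem_index_iota ?iota_uniq ?l0 ?ltnS//= eqxx mulr1.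
  by rewrite big1 ?addr0// => k kl; rewrite eq_sym (negbTE kl) mulr0.
by rewrite !mxE (negbTE ne) eq_sym (negbTE ne) d1 d2 key !add0r.
Qed.

Lemma toeplitz_far (i j : 'I_m) : ~~ nearby M i j -> S i j = 0.
Proof.
move=> nij; have ne : i != j.
  by apply: contra nij => /eqP ->; rewrite /nearby leq_addr.
rewrite mxE (negbTE ne) add0r big_nat_cond big1// => l /andP[/andP[l0 lM] _].
rewrite (_ : (_ == l) = false) ?mulr0//; apply/negbTE.
by move: nij; rewrite /nearby; lia.
Qed.

End Toeplitz.

(** * Events of the two-group model and the algebra that they span *)

Section TwoGroupModel.
Context (R : realType) (d : measure_display) (T : measurableType d).
Context (P : probability T R) (pi1 : R) (M : nat) (rho : nat -> R) (m : nat).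
Unset Implicit Arguments.
Context (H : 'I_m -> {RV P >-> bool}) (eps : 'I_m -> {RV P >-> R}).
Set Implicit Arguments.
Local Notation S := (toeplitz_corr M rho m).
Hypothesis hpi : 0 <= pi1 <= 1.
Hypothesis hpsd : psd S.
Hypothesis hmodel : two_group_model pi1 S H eps.

Definition heads_event (k : seq 'I_m) : set T := [set w | all (fun i => H i w) k].

Lemma measurable_heads_event k : measurable (heads_event k).
Proof.
elim: k => [|i k IH].
  by rewrite (_ : heads_event [::] = setT)//; apply/seteqP; split.
rewrite (_ : heads_event _ = [set w | H i w] `&` heads_event k).
  by apply: measurableI => //; exact: measurable_set_bool.
apply/seteqP; split=> w /=; first by move=> /andP[].
by move=> [h1 h2]; apply/andP; split; [exact: h1|exact: h2].
Qed.

Lemma heads_event_cat k l : heads_event (k ++ l) = heads_event k `&` heads_event l.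
Proof.
apply/seteqP; split=> w; rewrite /heads_event /= all_cat; first by move=> /andP[].
by move=> [h1 h2]; apply/andP; split; [exact: h1|exact: h2].
Qed.

(** The exponent counts distinct indices, since a repeated index constrains only once. *)
Lemma heads_event_prob (k : seq 'I_m) : P (heads_event k) = (pi1 ^+ #|k|)%:E.
Proof.
have [hB hI _ _] := hmodel.
pose A i : set bool := if i \in k then [set true] else setT.
have mA i : measurable (A i) by [].
have -> : heads_event k = \bigcap_(i in [set: 'I_m]) (H i @^-1` A i).
  apply/seteqP; split=> w /=.
    move=> /allP h i _; rewrite /A /preimage/=; case: ifP => // ik /=.
    exact: h.
  move=> h; apply/allP => i ik; have := h i I.
  by rewrite /A /preimage/= ik.
rewrite (hI A mA).
have e i : P (H i @^-1` A i) = (if i \in k then pi1 else 1)%:E.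
  have := hB i (A i); rewrite /distribution /pushforward => ->.
  rewrite bernoulli_probE// /A; case: ifP => _.
    rewrite !diracE mem_set//= memNset//=.
    by rewrite mule0 adde0 mule1.
  by rewrite !diracT !mule1 -EFinD; congr EFin; rewrite addrC subrK.
rewrite (eq_bigr _ (fun i _ => e i)) prodEFin; congr EFin.
by rewrite -big_mkcond/= prodr_const.
Qed.

Lemma model_event_prob k s : fine (P (heads_event k `&` tail_event eps s)) =
  pi1 ^+ #|k| * fine (P (tail_event eps s)).
Proof.
have [_ _ _ hV] := hmodel.
pose A : set (m.-tuple bool) := [set t | all (fun i => tnth t i) k].
pose B : set (m.-tuple R) := [set t | all (fun x => x.2 <= tnth t x.1) s].
have mA : measurable A.
  rewrite /A; elim: k {A} => [|i k IH] /=.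
    by rewrite (_ : mkset _ = setT)//; apply/seteqP; split.
  rewrite (_ : mkset _ = [set t : m.-tuple bool | tnth t i] `&`
     [set t | all (fun i => tnth t i) k]).
    by apply: measurableI => //; apply: measurable_set_bool; exact: measurable_tnth.
  apply/seteqP; split=> w /=; first by move=> /andP[].
  by move=> [h1 h2]; apply/andP; split; [exact: h1|exact: h2].
have mB : measurable B.
  rewrite /B; elim: s {B} => [|[i c] s IH] /=.
    by rewrite (_ : mkset _ = setT)//; apply/seteqP; split.
  rewrite (_ : mkset _ = [set t : m.-tuple R | c <= tnth t i] `&`
     [set t | all (fun x => x.2 <= tnth t x.1) s]).
    apply: measurableI => //; apply: measurable_set_le; first exact: measurable_cst.
    exact: measurable_tnth.
  apply/seteqP; split=> w /=; first by move=> /andP[].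
  by move=> [h1 h2]; apply/andP; split; [exact: h1|exact: h2].
have := hV A B mA mB => /=.
have -> : (fun w => [tuple H i w | i < m]) @^-1` A = heads_event k.
  rewrite predeqE => w.
  rewrite -[X in X <-> _]/(is_true (all (fun i => tnth [tuple H i w | i < m] i) k)).
  by rewrite (eq_all (a2 := fun i => H i w))// => i; rewrite tnth_mktuple.
have -> : (fun w => [tuple eps i w | i < m]) @^-1` B = tail_event eps s.
  rewrite predeqE => w.
  rewrite -[X in X <-> _]/(is_true (all (fun x => x.2 <= tnth [tuple eps i w | i < m] x.1) s)).
  by rewrite (eq_all (a2 := fun x => x.2 <= eps x.1 w))// => x; rewrite tnth_mktuple.
move=> ->; rewrite heads_event_prob fineM ?fin_num_measure//.
exact: measurable_tail_event.
Qed.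

(** Only conditions H = 1 and lower bounds on the noise are imposed. Such events are stable under
    intersection, their probabilities factor, and the indicator of a null hypothesis is a difference
    of two of them. *)
Definition model_ind (k : seq 'I_m) (s : seq ('I_m * R)) : T -> R :=
  \1_(heads_event k `&` tail_event eps s).

Lemma measurable_model_event k s : measurable (heads_event k `&` tail_event eps s).
Proof.
by apply: measurableI; [exact: measurable_heads_event|exact: measurable_tail_event].
Qed.

Lemma Ex_model_ind k s :
  Ex P (model_ind k s) = pi1 ^+ #|k| * fine (P (tail_event eps s)).
Proof. by rewrite Ex_indic ?model_event_prob//; exact: measurable_model_event. Qed.

Lemma bmeas_model_ind k s : bmeas (model_ind k s).
Proof. exact/bmeas_indic/measurable_model_event. Qed.

Lemma model_indM k s l u w :
  model_ind k s w * model_ind l u w = model_ind (k ++ l) (s ++ u) w.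
Proof.
by rewrite /model_ind heads_event_cat tail_event_cat setIACA [in RHS]indicI.
Qed.

Lemma model_indE k s w :
  model_ind k s w = (all (fun i => H i w) k && all (fun x => x.2 <= eps x.1 w) s)%:R.
Proof.
rewrite /model_ind indicE; congr (nat_of_bool _)%:R.
apply/idP/idP => [/set_mem[h1 h2]|/andP[h1 h2]]; first by apply/andP.
by apply/mem_set; split.
Qed.

Definition model_gen (I : pred 'I_m) (f : T -> R) : Prop :=
  exists2 k, all I k & exists2 s, all (fun x => I x.1) s & f = model_ind k s.

Definition model_alg (I : pred 'I_m) := span (model_gen I).

Let bmeas_model_gen I f : model_gen I f -> bmeas f.
Proof. by move=> [k _ [s _ ->]]; exact: bmeas_model_ind. Qed.

Lemma local_model_alg : local_algebra P M model_alg.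
Proof.
split.
- by move=> I; apply: span_bmeas; exact: bmeas_model_gen.
- move=> I c.
  have h : model_gen I (model_ind [::] [::]) by exists [::] => //; exists [::].
  by apply: eq_span (span_scale c (span_gen h)) => w; rewrite model_indE mulr1.
- by move=> I f g; exact: span_add.
- move=> I; apply: span_mul => f g [k kI [s sI ->]] [l lI [u uI ->]].
  apply: eq_span (fun w => model_indM k s l u w) _; apply: span_gen.
  by exists (k ++ l); rewrite ?all_cat ?kI//; exists (s ++ u); rewrite ?all_cat ?sI.
- move=> I J f IJ; apply: span_mono => _ [k kI [s sI ->]].
  exists k; first exact: sub_all kI.
  by exists s => //; apply: sub_all sI => x; exact: IJ.
- move=> I J f g IJ.
  have Sfar : orthogonal_blocks S I J.
    by move=> i j Ii Jj; apply: toeplitz_far; exact: IJ.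
  move: f g; apply: span_indep; [exact: bmeas_model_gen|exact: bmeas_model_gen|].
  move=> _ _ [k kI [s sI ->]] [l lJ [u uJ ->]].
  have [_ _ hG _] := hmodel.
  rewrite (eq_Ex P (fun w => model_indM k s l u w)) !Ex_model_ind.
  rewrite (tail_event_indep hpsd hG Sfar sI uJ).
  (* An index is nearby itself, so lists supported by far blocks share none and the numbers of
     distinct indices add. *)
  have -> : #|k ++ l| = (#|k| + #|l|)%N.
    rewrite -cardUI (eq_card (B := [predU k & l])); last first.
      by move=> i; rewrite !inE mem_cat.
    rewrite [X in (_ + X)%N](_ : _ = 0%N) ?addn0//.
    apply: eq_card0 => i; rewrite !inE; apply/negbTE/negP => /andP[ik il].
    have := IJ i i (allP kI _ ik) (allP lJ _ il).
    by rewrite /nearby leq_addr.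
  by rewrite exprD; ring.
Qed.

Definition null_ind (x : R) (i : 'I_m) (w : T) : R := (~~ H i w && (x <= eps i w))%:R.

Definition rej_ind (a x : R) (i : 'I_m) (w : T) : R :=
  (x <= a * (H i w)%:R + eps i w)%R%:R.

Lemma null_indE x i w :
  null_ind x i w = model_ind [::] [:: (i, x)] w + (-1) * model_ind [:: i] [:: (i, x)] w.
Proof.
rewrite /null_ind !model_indE/= !andbT.
by case: (H i w) => /=; case: (x <= _) => /=; ring.
Qed.

Lemma rej_indE a x i w :
  rej_ind a x i w = model_ind [:: i] [:: (i, x - a)] w + null_ind x i w.
Proof.
rewrite /rej_ind /null_ind !model_indE/= !andbT.
case: (H i w) => /=; last by rewrite mulr0 !add0r.
by rewrite mulr1 addr0 lerBlDl.
Qed.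

Lemma alg_null x i : model_alg (pred1 i) (null_ind x i).
Proof.
apply: eq_span (fun w => null_indE x i w) _; apply: span_add; last apply: span_scale;
  apply: span_gen; [exists [::] => //|exists [:: i]; rewrite /= ?eqxx//];
  by exists [:: (i, x)]; rewrite //= eqxx.
Qed.

Lemma alg_rej a x i : model_alg (pred1 i) (rej_ind a x i).
Proof.
apply: eq_span (fun w => rej_indE a x i w) _; apply: span_add; last exact: alg_null.
apply: span_gen; exists [:: i]; rewrite /= ?eqxx//.
by exists [:: (i, x - a)]; rewrite //= eqxx.
Qed.

Let tail1 i c : fine (P (tail_event eps [:: (i, c)])) = Phibar c.
Proof.
have [_ _ hG _] := hmodel.
by apply: (tail_event1 hG); exact: toeplitz_diag.
Qed.

Lemma Ex_null x i : Ex P (null_ind x i) = (1 - pi1) * Phibar x.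
Proof.
rewrite (eq_Ex P (null_indE x i)) ExD; [|exact: bmeas_model_ind|].
  rewrite ExZ; last exact: bmeas_model_ind.
  by rewrite !Ex_model_ind tail1 card_nil card_seq1 expr0 expr1; ring.
by apply: bmeasZ; exact: bmeas_model_ind.
Qed.

Lemma bmeas_null x i : bmeas (null_ind x i).
Proof. exact: (la_bmeas local_model_alg (alg_null x i)). Qed.

Lemma Ex_rej a x i : Ex P (rej_ind a x i) =
  (1 - pi1) * Phibar x + pi1 * Phibar (x - a).
Proof.
rewrite (eq_Ex P (rej_indE a x i)) ExD; [|exact: bmeas_model_ind|exact: bmeas_null].
by rewrite Ex_model_ind Ex_null tail1 card_seq1 expr1 addrC.
Qed.

Lemma Ex_null_pair x i j : i != j ->
  Ex P (fun w => null_ind x i w * null_ind x j w) =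
  (1 - pi1) ^+ 2 * fine (P (tail_event eps [:: (i, x); (j, x)])).
Proof.
move=> ij; pose s := [:: (i, x); (j, x)].
rewrite (eq_Ex P (g := fun w => model_ind [::] s w + ((-1) * model_ind [:: j] s w
   + ((-1) * model_ind [:: i] s w + model_ind [:: i; j] s w)))); last first.
  move=> w; rewrite /null_ind !model_indE/= !andbT.
  case: (H i w) => /=; case: (H j w) => /=; case: (x <= eps i w) => /=;
    case: (x <= eps j w) => /=; ring.
have b k := bmeas_model_ind k s.
have bz k := bmeasZ (-1) (b k).
rewrite ExD ?ExD ?ExD ?ExZ //; try (by repeat apply: bmeasD).
rewrite !Ex_model_ind card_nil !card_seq1 expr0 expr1.
have -> : #|[:: i; j]| = 2%N by apply/card_uniqP; rewrite /= inE ij.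
by ring.
Qed.

Lemma null_pair_lag x (i j : 'I_m) (l : nat) :
  (0 < l <= M)%N -> -1 < rho l < 1 -> (i + l = j)%N ->
  Ex P (fun w => null_ind x i w * null_ind x j w) =
  (1 - pi1) ^+ 2 * (rho_tilde (Phibar x) (Phibar x) (rho l) + Phibar x ^+ 2).
Proof.
move=> lM /andP[r1 r2] ij; have [_ _ hG _] := hmodel.
have ne : i != j by rewrite -val_eqE /=; case/andP: lM; lia.
have [Sij _] := toeplitz_lag rho lM ij.
rewrite Ex_null_pair//; congr (_ * _).
rewrite (tail_event2 hpsd hG x x ne (toeplitz_diag _ _ _) (toeplitz_diag _ _ _) Sij); last first.
  by rewrite !ltW.
rewrite /rho_tilde Phibar_invK.
have -> : [set z : R * R | (x%:E <= z.1%:E)%E /\ (x%:E <= z.2%:E)%E] =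
    [set z | x <= z.1 /\ x <= z.2].
  by apply/seteqP; split=> z /=; rewrite !lee_fin.
by rewrite -expr2 subrK.
Qed.

End TwoGroupModel.

(** * Localising the threshold *)

Section BadEvents.
Context (R : realType) (d : measure_display) (T : measurableType d).
Context (P : probability T R).

(** Only the exceptional set is measurable, not [Q], which may therefore quantify over a continuum
    of levels. *)
Definition off_bad_event (b : R) (Q : T -> Prop) : Prop :=
  exists2 B : set T, measurable B & fine (P B) <= b /\ forall w, ~ B w -> Q w.

Lemma off_bad_eventT (Q : T -> Prop) : (forall w, Q w) -> off_bad_event 0 Q.
Proof. by move=> h; exists set0 => //; rewrite measure0. Qed.

Lemma off_bad_event_and (b1 b2 : R) (Q1 Q2 : T -> Prop) :
  off_bad_event b1 Q1 -> off_bad_event b2 Q2 ->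
  off_bad_event (b1 + b2) (fun w => Q1 w /\ Q2 w).
Proof.
move=> [B1 m1 [p1 q1]] [B2 m2 [p2 q2]].
exists (B1 `|` B2); first exact: measurableU.
split; last by move=> w nB; split; [apply: q1|apply: q2] => Bw; apply: nB; [left|right].
apply: (@le_trans _ _ (fine (P B1) + fine (P B2))); last exact: lerD.
rewrite -fineD ?fin_num_measure//.
apply: fine_le; rewrite ?fin_numD ?fin_num_measure//; first exact: measurableU.
exact: measureU2.
Qed.

Lemma off_bad_event_mono (b b' : R) (Q Q' : T -> Prop) : b <= b' ->
  (forall w, Q w -> Q' w) -> off_bad_event b Q -> off_bad_event b' Q'.
Proof.
move=> bb QQ [B mB [pB qB]]; exists B => //; split; first exact: le_trans bb.
by move=> w /qB/QQ.
Qed.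

Lemma off_bad_event_cheb (F : T -> R) (v l : R) : bmeas F -> 0 < l ->
  Ex P (fun w => F w ^+ 2) <= v -> off_bad_event (v / l ^+ 2) (fun w => `|F w| < l).
Proof.
move=> bF l0 hv; exists [set w | l <= `|F w|].
  apply: measurable_set_le; first exact: measurable_cst.
  exact: bmeas_measurable (bmeas_norm bF).
split; last by move=> w /negP; rewrite -ltNge.
have mB : measurable [set w | l <= `|F w|].
  apply: measurable_set_le; first exact: measurable_cst.
  exact: bmeas_measurable (bmeas_norm bF).
apply: le_trans (Ex_markov (f := fun w => F w ^+ 2) (a := l ^+ 2) P mB _ _ _ _) _.
- exact: bmeasX.
- exact: exprn_gt0.
- by move=> w; exact: sqr_ge0.
- by move=> w /= lF; rewrite -(real_normK (num_real (F w))) lerXn2r ?nnegrE// ltW.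
- by rewrite ler_pM2r// invr_gt0 exprn_gt0.
Qed.

Lemma off_bad_event_all (n : nat) (b : R) (Q : nat -> T -> Prop) :
  (forall j, (j < n)%N -> off_bad_event b (Q j)) ->
  off_bad_event (n%:R * b) (fun w => forall j, (j < n)%N -> Q j w).
Proof.
elim: n => [|n IH] h; first by rewrite mul0r; apply: off_bad_eventT.
have h1 := IH (fun j jn => h j (ltnW jn)).
apply: off_bad_event_mono (off_bad_event_and h1 (h n (ltnSn n))).
  by rewrite -natr1 mulrDl mul1r.
by move=> w [q1 q2] j; rewrite ltnS leq_eqVlt => /predU1P[->//|/q1].
Qed.

End BadEvents.

Section Localisation.
Context (R : realType) (d : measure_display) (T : measurableType d).
Context (P : probability T R) (q a pi1 : R) (M : nat) (rho : nat -> R) (m : nat).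
Unset Implicit Arguments.
Context (H : 'I_m -> {RV P >-> bool}) (eps : 'I_m -> {RV P >-> R}).
Set Implicit Arguments.
Local Notation S := (toeplitz_corr M rho m).
Hypothesis hq : 0 < q < 1.
Hypothesis hpi : 0 < pi1 < 1.
Hypothesis hpsd : psd S.
Hypothesis hmodel : two_group_model pi1 S H eps.
Hypothesis m0 : (0 < m)%N.

Let K : R := (M.*2.+1)%:R.
Let hpi' : 0 <= pi1 <= 1. Proof. by have /andP[h1 h2] := hpi; rewrite !ltW. Qed.
Let LA := local_model_alg hpi' hpsd hmodel.

Definition pval (i : 'I_m) (w : T) : R := pvalue a (H i w) (eps i w).
Definition ipb (t : R) : R := fine (Phibar_inv t).
(** The mean proportion of p-values at most [t] for 0 < t < 1; the equation for tau is Gmix t = t /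
    q. *)
Definition Gmix (t : R) : R := (1 - pi1) * t + pi1 * Phibar (ipb t - a).

Lemma ipbK (t : R) : 0 < t < 1 -> Phibar (ipb t) = t.
Proof. by move=> /Phibar_surj[x <-]; rewrite /ipb Phibar_invK. Qed.

Lemma pval_gt0 i w : 0 < pval i w. Proof. exact: Phibar_gt0. Qed.

Lemma pcount_sum t w : 0 < t < 1 ->
  (pcount (pval ^~ w) t)%:R = \sum_i rej_ind H eps a (ipb t) i w.
Proof.
move=> ht; rewrite /pcount -sum1_card natr_sum big_mkcond/=; apply: eq_bigr => i _.
rewrite inE /pval /pvalue -[in X in _ <= X](ipbK ht) Phibar_leE /rej_ind.
by case: ifP.
Qed.

Lemma null_count_sum t w : 0 < t < 1 ->
  (null_count (pval ^~ w) (H ^~ w) t)%:R = \sum_i null_ind H eps (ipb t) i w.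
Proof.
move=> ht; rewrite /null_count -sum1_card natr_sum big_mkcond/=; apply: eq_bigr => i _.
rewrite inE /pval /pvalue -[in X in _ <= X](ipbK ht) Phibar_leE /null_ind.
by case: (H i w) => /=; rewrite ?andbF ?andbT// mulr0 add0r; case: ifP.
Qed.

Definition ZR (t : R) (w : T) : R :=
  \sum_i (rej_ind H eps a (ipb t) i w - Gmix t).

Definition ZV (t : R) (w : T) : R :=
  \sum_i (null_ind H eps (ipb t) i w - (1 - pi1) * t).

Lemma ZR_E t w : 0 < t < 1 -> ZR t w = (pcount (pval ^~ w) t)%:R - m%:R * Gmix t.
Proof.
by move=> ht; rewrite pcount_sum// /ZR sumrB sumr_const card_ord -[_ *+ m]mulr_natl.
Qed.

Lemma ZV_E t w : 0 < t < 1 ->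
  ZV t w = (null_count (pval ^~ w) (H ^~ w) t)%:R - m%:R * ((1 - pi1) * t).
Proof.
by move=> ht; rewrite null_count_sum// /ZV sumrB sumr_const card_ord -[_ *+ m]mulr_natl.
Qed.

Let bN t i := bmeas_null hpi' hpsd hmodel (ipb t) i.

Let alg_c i (f : T -> R) c : model_alg H eps (pred1 i) f ->
  model_alg H eps (pred1 i) (fun w => f w - c).
Proof. by move=> hf; apply: (la_add LA) => //; exact: (la_cst LA). Qed.

Lemma bmeas_ZR t : bmeas (ZR t).
Proof.
apply: bmeas_sum => i _; apply: bmeasB; last exact: bmeas_cst.
exact: (la_bmeas LA (alg_rej H eps a (ipb t) i)).
Qed.

Lemma bmeas_ZV t : bmeas (ZV t).
Proof. by apply: bmeas_sum => i _; apply: bmeasB; [exact: bN|exact: bmeas_cst]. Qed.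

Lemma Ex_ZR_sqr t : 0 < t < 1 -> Ex P (fun w => ZR t w ^+ 2) <= m%:R * K.
Proof.
move=> ht; rewrite -[K]mulr1.
pose X i w := rej_ind H eps a (ipb t) i w - Gmix t.
have XA i : model_alg H eps (pred1 i) (X i) by apply: alg_c; exact: alg_rej.
have br i : bmeas (rej_ind H eps a (ipb t) i).
  exact: (la_bmeas LA (alg_rej H eps a (ipb t) i)).
have Er i : Ex P (rej_ind H eps a (ipb t) i) = Gmix t.
  by rewrite (Ex_rej hpi' hpsd hmodel) ipbK.
apply: (Ex_sqr_sum_mean0 LA XA) => i.
  by rewrite ExB ?Ex_cst ?Er ?subrr//; exact: bmeas_cst.
have hG : 0 <= Gmix t <= 1.
  rewrite -(Er i) Ex_ge0/=; last by move=> w; rewrite ler0n.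
  rewrite -[leRHS](Ex_cst P 1); apply: le_Ex => //; first exact: bmeas_cst.
  by move=> w; rewrite /rej_ind lern1 leq_b1.
rewrite -[leRHS](Ex_cst P 1); apply: le_Ex.
- by apply: bmeasX; apply: bmeasB => //; exact: bmeas_cst.
- exact: bmeas_cst.
- move=> w; rewrite /X /rej_ind; case/andP: hG => g0 g1.
  by case: (ipb t <= _); rewrite /=; nra.
Qed.

(** Each increment is a centred indicator, so its variance is at most its mean, linear in |t - s|.
    This smallness is what allows a union bound over a fine mesh. *)
Lemma Ex_ZV_incr t s : 0 < t < 1 -> 0 < s < 1 ->
  Ex P (fun w => (ZV t w - ZV s w) ^+ 2) <= m%:R * (K * `|t - s|).
Proof.
wlog st : t s / s <= t.
  move=> W ht hs; have [/W|/ltW/W] := leP s t; first exact.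
  move=> /(_ hs ht); rewrite distrC; apply: le_trans.
  by rewrite le_eqVlt; apply/orP; left; apply/eqP; apply: eq_Ex => w; rewrite -sqrrN opprB.
move=> ht hs.
pose X i w := (null_ind H eps (ipb t) i w - null_ind H eps (ipb s) i w)
  - (1 - pi1) * (t - s).
have XA i : model_alg H eps (pred1 i) (X i).
  apply: alg_c; apply: (la_add LA); first exact: alg_null.
  apply: la_eq (la_scale LA (-1) (alg_null H eps (ipb s) i)) => w.
  by rewrite mulN1r.
have Ed i : Ex P (fun w => null_ind H eps (ipb t) i w - null_ind H eps (ipb s) i w)
    = (1 - pi1) * (t - s).
  by rewrite ExB// !(Ex_null hpi' hmodel) !ipbK// mulrBr.
have bd i : bmeas (fun w => null_ind H eps (ipb t) i w - null_ind H eps (ipb s) i w).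
  exact: bmeasB.
rewrite (eq_Ex P (g := fun w => (\sum_i X i w) ^+ 2)); last first.
  by move=> w; congr (_ ^+ 2); rewrite /ZV -sumrB; apply: eq_bigr => i _; rewrite /X; ring.
apply: (Ex_sqr_sum_mean0 LA XA) => i.
  by rewrite ExB ?Ex_cst ?Ed ?subrr//; exact: bmeas_cst.
have ts0 : 0 <= t - s by rewrite subr_ge0.
rewrite (ger0_norm ts0).
have ip : ipb t <= ipb s by rewrite -Phibar_leE !ipbK.
set e := (1 - pi1) * (t - s).
have /andP[p0 p1] := hpi.
have e0 : 0 <= e by rewrite mulr_ge0//; lra.
(* For an indicator b, (b - e)^2 = (1 - 2 e) b + e^2, whose mean is e - e^2 when b has mean e. *)
apply: (@le_trans _ _ (Ex P (fun w => (1 - 2 * e) *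
   (null_ind H eps (ipb t) i w - null_ind H eps (ipb s) i w) + e ^+ 2))).
  apply: le_Ex.
  - by apply: bmeasX; apply: bmeasB => //; exact: bmeas_cst.
  - by apply: bmeasD; [exact: bmeasZ|exact: bmeas_cst].
  - move=> w; rewrite /X -/e.
    have -> : null_ind H eps (ipb t) i w - null_ind H eps (ipb s) i w =
       (~~ H i w && (ipb t <= eps i w) && (eps i w < ipb s))%:R.
      rewrite /null_ind; case: (H i w) => /=; first by rewrite subrr.
      case: (leP (ipb s) (eps i w)) => h.
        by rewrite (le_trans ip h) /= subrr.
      by rewrite andbT subr0.
    by case: (_ && _) => /=; lra.
rewrite ExD ?Ex_cst ?ExZ//; [|exact: bmeasZ|exact: bmeas_cst].
rewrite Ed -/e.
have h1 : e <= t - s by rewrite /e ler_piMl//; lra.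
have := sqr_ge0 e; nra.
Qed.

Lemma Ex_ZV_sqr t : 0 < t < 1 -> Ex P (fun w => ZV t w ^+ 2) <= m%:R * K.
Proof.
move=> ht; rewrite -[K]mulr1.
pose X i w := null_ind H eps (ipb t) i w - (1 - pi1) * t.
have XA i : model_alg H eps (pred1 i) (X i) by apply: alg_c; exact: alg_null.
have Er i : Ex P (null_ind H eps (ipb t) i) = (1 - pi1) * t.
  by rewrite (Ex_null hpi' hmodel) ipbK.
have /andP[p0 p1] := hpi; have /andP[t0 t1] := ht.
apply: (Ex_sqr_sum_mean0 LA XA) => i.
  by rewrite ExB ?Ex_cst ?Er ?subrr//; exact: bmeas_cst.
have hG : 0 <= (1 - pi1) * t <= 1 by apply/andP; split; nra.
rewrite -[leRHS](Ex_cst P 1); apply: le_Ex.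
- by apply: bmeasX; apply: bmeasB => //; exact: bmeas_cst.
- exact: bmeas_cst.
- move=> w; rewrite /X /null_ind; case/andP: hG => g0 g1.
  by case: (_ && _); rewrite /=; nra.
Qed.

End Localisation.

Lemma truncn_bounds (R : realType) (x : R) : 0 <= x ->
  (Num.truncn x)%:R <= x < (Num.truncn x)%:R + 1.
Proof. by move=> x0; rewrite natr1; exact: truncn_itv. Qed.

Section LocalisedLevel.
Context (R : realType) (d : measure_display) (T : measurableType d).
Context (P : probability T R) (q a pi1 : R) (M : nat) (rho : nat -> R) (m : nat).
Unset Implicit Arguments.
Context (H : 'I_m -> {RV P >-> bool}) (eps : 'I_m -> {RV P >-> R}).
Set Implicit Arguments.
Local Notation S := (toeplitz_corr M rho m).
Hypothesis hq : 0 < q < 1.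
Hypothesis hpi : 0 < pi1 < 1.
Hypothesis hpsd : psd S.
Hypothesis hmodel : two_group_model pi1 S H eps.
Hypothesis m0 : (0 < m)%N.

Let K : R := (M.*2.+1)%:R.
Local Notation p := (pval a H eps).
Local Notation G := (Gmix a pi1).
Local Notation ZR := (ZR a pi1 H eps).
Local Notation ZV := (ZV pi1 H eps).
Local Notation level w := (BH_level q (p ^~ w)).

Context (tau c delta : R).
Hypothesis htau : 0 < tau < 1.
Hypothesis c0 : 0 < c.
Hypothesis Gup : forall t, tau <= t < 1 -> G t <= t / q - c * (t - tau).
Hypothesis Glow : forall t, 0 < t <= tau -> tau - t <= delta ->
  t / q + c * (tau - t) <= G t.

Let mR : (0 : R) < m%:R. Proof. by rewrite ltr0n. Qed.
Let q0 : 0 < q. Proof. by have /andP[] := hq. Qed.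

(** At tau - r the mean count exceeds m (tau - r) / q by at least m c r. One Chebyshev bound keeps
    the fluctuation below this margin, and [BH_level_ge] concludes. *)
Lemma level_lower (r : R) : 0 < r -> r < tau -> r <= delta ->
  off_bad_event P (m%:R * K / (m%:R * (c * r)) ^+ 2) (fun w => tau - r <= level w).
Proof.
move=> r0 rt rd; have /andP[t0 t1] := htau.
have hs : 0 < tau - r < 1 by apply/andP; split; lra.
have hv := Ex_ZR_sqr a hpi hpsd hmodel hs.
have l0 : 0 < m%:R * (c * r) by rewrite !mulr_gt0.
apply: off_bad_event_mono (off_bad_event_cheb (bmeas_ZR a hpi hpsd hmodel _) l0 hv) => //.
move=> w; rewrite ZR_E// ltr_norml => /andP[h _].
apply: BH_level_ge => //.
have := Glow (t := tau - r); rewrite subKr => hG.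
have {}hG : (tau - r) / q + c * r <= G (tau - r) by apply: hG => //; apply/andP; split; lra.
have : m%:R * ((tau - r) / q + c * r) <= m%:R * G (tau - r) by rewrite ler_pM2l.
rewrite mulrDr mulrA; lra.
Qed.

Lemma level_le_q w : level w <= q.
Proof.
rewrite /BH_level ler_pdivrMr// [leRHS]mulrC; apply: ler_wpM2r; first exact: ltW.
by rewrite ler_nat BH_rejections_le.
Qed.

(** An upper bound must exclude every larger level at once, hence a grid. If the level t lies just
    below the grid point u, monotonicity makes the count at u at least m t / q >= m (u - r) / q,
    while its mean is at most m (u / q - c (u - tau)). The loss r / q from the mesh and the
    fluctuation r cannot offset c (u - tau) once u - tau is at least (k0 + 1) r. *)
Lemma level_upper (r : R) (n k0 : nat) : 0 < r -> r < 1 - q ->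
  q^-1 + 1 <= c * k0.+1%:R -> 1 - tau <= n%:R * r ->
  off_bad_event P (n%:R * (m%:R * K / (m%:R * r) ^+ 2))
    (fun w => level w < tau + k0%:R * r).
Proof.
move=> r0 rq hk hn; have /andP[t0 t1] := htau; have /andP[_ q1] := hq.
(* The shift by one makes [u k] the right end of the cell containing the level; since the level is
   at most q and r < 1 - q, that point stays below 1. *)
pose u (j : nat) : R := tau + j.+1%:R * r.
pose Q (j : nat) w := u j < 1 -> `|ZR (u j) w| < m%:R * r.
have b0 : 0 <= m%:R * K / (m%:R * r) ^+ 2.
  by apply: divr_ge0; [rewrite mulr_ge0// ler0n|exact: sqr_ge0].
have hQ j : (j < n)%N -> off_bad_event P (m%:R * K / (m%:R * r) ^+ 2) (Q j).
  move=> _; have [uj1|uj] := leP 1 (u j).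
    apply: off_bad_event_mono b0 _ (off_bad_eventT P (Q := Q j) _) => // w.
    by rewrite /Q ltNge uj1.
  have hs : 0 < u j < 1 by rewrite uj andbT /u addr_gt0// mulr_gt0.
  have l0 : 0 < m%:R * r by rewrite mulr_gt0.
  have h := off_bad_event_cheb (bmeas_ZR a hpi hpsd hmodel _) l0 (Ex_ZR_sqr a hpi hpsd hmodel hs).
  by apply: off_bad_event_mono h => // w hw _.
apply: off_bad_event_mono (off_bad_event_all hQ) => // w hw.
rewrite ltNge; apply/negP => ht; set t := level w in ht.
have tq : t <= q := level_le_q w.
have tt : 0 <= (t - tau) / r.
  by rewrite divr_ge0 ?(ltW r0)// subr_ge0 (le_trans _ ht)// lerDl mulr_ge0// ltW.
have /andP[k1 k2] := truncn_bounds tt; set k := Num.truncn _ in k1 k2.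
have k0k : (k0 <= k)%N.
  rewrite -ltnS -(ltr_nat R) -natr1; apply: le_lt_trans k2.
  by rewrite ler_pdivlMr//; lra.
move: k1 k2; rewrite ler_pdivlMr// ltr_pdivrMr// => k1 k2.
have kn : (k < n)%N.
  rewrite -(ltr_nat R) -(ltr_pM2r r0); apply: le_lt_trans k1 _.
  by apply: lt_le_trans hn; lra.
have uE : u k = tau + k%:R * r + r by rewrite /u -natr1; ring.
have u1 : u k < 1.
  by rewrite uE; lra.
have := hw k kn u1.
have tu : t <= u k by rewrite uE; lra.
have hu : 0 < u k < 1 by rewrite u1 andbT (lt_le_trans t0)// uE; have : 0 <= k%:R * r by [rewrite mulr_ge0// ltW]; lra.
rewrite ZR_E// ltr_norml => /andP[_ h].
have hc : (pcount (p ^~ w) t <= pcount (p ^~ w) (u k))%N by exact: pcount_homo.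
have hc' : m%:R * t / q <= (pcount (p ^~ w) (u k))%:R.
  by rewrite -(BH_level_count (p ^~ w) q0 m0) ler_nat.
have hG : G (u k) <= u k / q - c * (u k - tau).
  by apply: Gup; rewrite u1 andbT uE; have : 0 <= k%:R * r by [rewrite mulr_ge0// ltW]; lra.
have hG' : m%:R * G (u k) <= m%:R * (u k / q - c * (u k - tau)) by rewrite ler_pM2l.
have h2 : m%:R * (t / q) < m%:R * (u k / q - c * (u k - tau) + r).
  by rewrite mulrDr mulrA; lra.
rewrite ltr_pM2l// in h2.
have h3 : (u k - r) / q <= t / q by rewrite ler_pM2r ?invr_gt0// uE; lra.
have h4 : c * (k.+1%:R * r) < r / q + r.
  have e1 : u k - tau = k.+1%:R * r by rewrite /u addrC addKr.
  by rewrite -e1; move: h2 h3; rewrite mulrBl; lra.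
have h5 : c * k.+1%:R < q^-1 + 1.
  rewrite -(ltr_pM2r r0) -mulrA (lt_le_trans h4)// mulrDl mul1r.
  by rewrite [r / q]mulrC.
have h6 : c * k0.+1%:R <= c * k.+1%:R by rewrite ler_pM2l// ler_nat ltnS.
by have := le_trans (le_trans hk h6) (ltW h5); move=> _; lra.
Qed.

Lemma null_count_homo w s t : s <= t ->
  (null_count (p ^~ w) (H ^~ w) s <= null_count (p ^~ w) (H ^~ w) t)%N.
Proof.
move=> st; apply/subset_leq_card/fintype.subsetP => i.
by rewrite !inE => /andP[/le_trans h ->]; rewrite h.
Qed.

Lemma ZV_sandwich w s t u : 0 < s < 1 -> 0 < t < 1 -> 0 < u < 1 -> s <= t <= u ->
  ZV s w - m%:R * (t - s) <= ZV t w <= ZV u w + m%:R * (u - t).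
Proof.
move=> hs ht hu /andP[st tu]; rewrite !(ZV_E a)//.
have h1 := null_count_homo w st; have h2 := null_count_homo w tu.
rewrite -(ler_nat R) in h1; rewrite -(ler_nat R) in h2.
have /andP[p0 p1] := hpi.
have e1 : m%:R * ((1 - pi1) * (t - s)) <= m%:R * (t - s).
  by rewrite ler_pM2l// ler_piMl//; lra.
have e2 : m%:R * ((1 - pi1) * (u - t)) <= m%:R * (u - t).
  by rewrite ler_pM2l// ler_piMl//; lra.
by apply/andP; split; lra.
Qed.

(** Chebyshev controls the mesh points; between two of them the count is monotone, so only the drift
    can intervene, and it is at most m e per cell. *)
Lemma ZV_increment (e l : R) (J : nat) : 0 < e -> 0 < l ->
  J.+1%:R * e < tau -> J.+1%:R * e < 1 - tau ->
  off_bad_event P (J.+1.*2%:R * (m%:R * (K * (J.+1%:R * e)) / l ^+ 2))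
    (fun w => forall t, `|t - tau| <= J%:R * e -> `|ZV t w - ZV tau w| <= l + m%:R * e).
Proof.
move=> e0 l0 h1 h2; have /andP[t0 t1] := htau.
(* Indices run from 0 to 2J + 1: one point more than the window on the right, for the upper
   neighbour of its last point. *)
pose u (j : nat) : R := tau + (j%:R - J%:R) * e.
have ub j : (j < J.+1.*2)%N -> `|u j - tau| <= J.+1%:R * e.
  move=> hj; rewrite /u addrC addKr normrM (gtr0_norm e0) ler_pM2r//.
  rewrite ler_norml; apply/andP; split.
    by rewrite lerBrDr -natr1 addrC; have : (0 : R) <= j%:R by []; lra.
  by rewrite lerBlDr -natrD ler_nat addSn addnn -ltnS -doubleS.
have uin j : (j < J.+1.*2)%N -> 0 < u j < 1.
  by move/ub; rewrite ler_norml => /andP[h3 h4]; apply/andP; split; lra.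
have hQ j : (j < J.+1.*2)%N ->
    off_bad_event P (m%:R * (K * (J.+1%:R * e)) / l ^+ 2)
      (fun w => `|ZV (u j) w - ZV tau w| < l).
  move=> hj; apply: off_bad_event_cheb => //.
    by apply: bmeasB; exact: (bmeas_ZV hpi hpsd hmodel).
  apply: le_trans (Ex_ZV_incr hpi hpsd hmodel (uin j hj) htau) _.
  by rewrite ler_pM2l// ler_wpM2l// ub.
apply: off_bad_event_mono (off_bad_event_all hQ) => // w hw t ht.
have x0 : 0 <= (t - tau) / e + J%:R.
  move: ht; rewrite ler_norml => /andP[h3 _].
  by rewrite -lerBlDr sub0r ler_pdivlMr// mulNr.
have /andP[k1 k2] := truncn_bounds x0; set k := Num.truncn _ in k1 k2.
have kJ : (k <= J.*2)%N.
  rewrite -(ler_nat R); apply: le_trans k1 _.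
  rewrite -addnn natrD lerD2r ler_pdivrMr//.
  by move: ht; rewrite ler_norml => /andP[].
have uk : u k <= t.
  move: k1; rewrite -lerBlDr ler_pdivlMr// /u; lra.
have uk1 : t <= u k.+1.
  have : (t - tau) / e < k%:R + 1 - J%:R by lra.
  by rewrite ltr_pdivrMr// /u -natr1; lra.
have hk : (k < J.+1.*2)%N by rewrite doubleS ltnS leqW.
have hk1 : (k.+1 < J.+1.*2)%N by rewrite doubleS !ltnS.
have := hw k hk; have := hw k.+1 hk1; rewrite !ltr_norml => /andP[a1 a2] /andP[b1 b2].
have tin : 0 < t < 1.
  have /andP[z1 _] := uin k hk; have /andP[_ z2] := uin k.+1 hk1.
  by apply/andP; split; lra.
have stu : u k <= t <= u k.+1 by rewrite uk.
have /andP[s1 s2] := ZV_sandwich w (uin k hk) tin (uin k.+1 hk1) stu.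
have ue : u k.+1 = u k + e by rewrite /u -natr1; ring.
have m1 : m%:R * (t - u k) <= m%:R * e by rewrite ler_pM2l// lerBlDl -ue.
have m2 : m%:R * (u k.+1 - t) <= m%:R * e by rewrite ler_pM2l// ue lerBlDr [e + t]addrC lerD2r.
move: s1 s2 a1 a2 b1 b2 m1 m2; move: (ZV t w) (ZV tau w) (ZV (u k) w) (ZV (u k.+1) w) => x1 x2 x3 x4.
move: (m%:R * _) (m%:R * _) (m%:R * _) => y1 y2 y3 *.
by rewrite ler_norml; apply/andP; split; lra.
Qed.

Lemma ratio_diff (t z z0 y k : R) : 0 < tau -> tau / 2 <= t ->
  `|z - z0| <= y -> `|t - tau| <= k -> forall L, `|z0| <= L ->
  `|q * z / t - q * z0 / tau| <= q * (2 * y / tau + 2 * L * k / tau ^+ 2).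
Proof.
move=> t0 tt hz ht L hL.
have tp : 0 < t by apply: lt_le_trans tt; rewrite divr_gt0.
have -> : q * z / t - q * z0 / tau = q * ((z - z0) / t + z0 * (tau - t) / (t * tau)).
  by field; rewrite !gt_eqF.
rewrite normrM gtr0_norm// ler_pM2l//; apply: le_trans (ler_normD _ _) _.
have it : t^-1 <= 2 / tau by rewrite -[2 / tau]invf_div lef_pV2// posrE divr_gt0.
apply: lerD.
  rewrite normrM normfV (gtr0_norm tp).
  apply: (@le_trans _ _ (y * (2 / tau))); last by rewrite mulrCA mulrA.
  by apply: ler_pM => //; rewrite invr_ge0 ltW.
rewrite normrM normfV (gtr0_norm (mulr_gt0 tp t0)) normrM [`|tau - t|]distrC.
apply: (@le_trans _ _ (L * k * (2 / tau * tau^-1))); last first.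
  by rewrite le_eqVlt; apply/orP; left; apply/eqP; field; rewrite gt_eqF.
apply: ler_pM => //.
- by rewrite invr_ge0 mulr_ge0// ltW.
- exact: ler_pM.
by rewrite invfM ler_pM2r// invr_gt0.
Qed.

(** The four probabilities bound the failures of the lower and upper localisation, of the comparison
    of ZV with its value at tau, and of |ZV tau| < s L. On the remaining event the estimate is
    deterministic. *)
Lemma FDP_close (s r e y L : R) (n k0 J : nat) :
  0 < s -> s ^+ 2 = m%:R -> 0 < r -> r < tau -> r <= delta -> r < 1 - q ->
  (0 < k0)%N -> q^-1 + 1 <= c * k0.+1%:R -> 1 - tau <= n%:R * r ->
  k0%:R * r <= tau / 2 -> k0%:R * r <= J%:R * e ->
  0 < y -> s * e = y -> J.+1%:R * e < tau -> J.+1%:R * e < 1 - tau -> 0 < L ->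
  off_bad_event P (m%:R * K / (m%:R * (c * r)) ^+ 2
     + n%:R * (m%:R * K / (m%:R * r) ^+ 2)
     + J.+1.*2%:R * (m%:R * (K * (J.+1%:R * e)) / (s * y) ^+ 2)
     + m%:R * K / (s * L) ^+ 2)
   (fun w => `| s * (FDP q (p ^~ w) (H ^~ w) - (1 - pi1) * q)
                - q * (s^-1 * ZV tau w) / tau|
             <= q * (2 * (2 * y) / tau + 2 * L * (k0%:R * r) / tau ^+ 2)).
Proof.
move=> s0 sm r0 rt rd rq k00 hk hn hkr hkJ y0 se J1 J2 L0.
have /andP[t0 t1] := htau; have /andP[_ q1] := hq.
have e0 : 0 < e by rewrite -(pmulr_rgt0 _ s0) se.
have sy : 0 < s * y by rewrite mulr_gt0.
have sL : 0 < s * L by rewrite mulr_gt0.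
have B1 := level_lower r0 rt rd.
have B2 := level_upper r0 rq hk hn.
have B3 := ZV_increment e0 sy J1 J2.
have B4 := off_bad_event_cheb (bmeas_ZV hpi hpsd hmodel tau) sL (Ex_ZV_sqr hpi hpsd hmodel htau).
have := off_bad_event_and (off_bad_event_and (off_bad_event_and B1 B2) B3) B4.
apply: off_bad_event_mono => // w [[[h1 h2] h3] h4].
set t := level w in h1 h2.
have rk : r <= k0%:R * r by rewrite ler_peMl// ?ler1n// ltW.
have htt : `|t - tau| <= k0%:R * r by rewrite ler_norml; apply/andP; split; lra.
have t2 : tau / 2 <= t by lra.
have tp : 0 < t by apply: lt_le_trans t2; rewrite divr_gt0.
have tq : t <= q := level_le_q w.
have ht : 0 < t < 1 by rewrite tp (le_lt_trans tq).
have h5 := h3 t (le_trans htt hkJ).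
have mE : m%:R * e = s * y by rewrite -sm expr2 -mulrA se.
have hz : `|s^-1 * ZV t w - s^-1 * ZV tau w| <= 2 * y.
  rewrite -mulrBr normrM gtr0_norm ?invr_gt0// ler_pdivrMl//.
  by apply: le_trans h5 _; rewrite mE; lra.
have hz0 : `|s^-1 * ZV tau w| <= L.
  by rewrite normrM gtr0_norm ?invr_gt0// ler_pdivrMl// ltW.
have := ratio_diff t0 t2 hz htt hz0; congr (`|_ - _| <= _).
(* With m t / q rejections, the drift m pi0 t of the null count contributes exactly pi0 q to the
   proportion, for whatever level t occurs; what remains is q ZV(t) / (m t). *)
have RE : (BH_rejections q (p ^~ w))%:R = m%:R * t / q.
  by rewrite /t /BH_level; field; rewrite !gt_eqF.
have R1 : (0 < BH_rejections q (p ^~ w))%N by rewrite -(ltr_nat R) RE divr_gt0// mulr_gt0.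
rewrite FDP_level//; last 2 first.
- exact: ltW.
- by move=> i; exact: pval_gt0.
rewrite (maxn_idPl R1) RE -/t (ZV_E a)// -sm.
by field; rewrite !gt_eqF.
Qed.

End LocalisedLevel.

(** * The limit law of the null count *)

Section LagSums.
Context (R : realType) (M : nat).

Lemma sum_lag_pairs (m l : nat) :
  \sum_(i < m) \sum_(j < m) (i + l == j)%N%:R = (m - l)%:R :> R.
Proof.
have inner (i : 'I_m) : \sum_(j < m) (i + l == j)%N%:R = (i + l < m)%N%:R :> R.
  have [h|h] := ltnP (i + l) m; last first.
    by rewrite big1// => j _; rewrite gtn_eqF// (leq_trans (ltn_ord j)).
  rewrite (bigD1 (Ordinal h))//= eqxx big1 ?addr0// => j.
  by rewrite -val_eqE/= eq_sym => /negbTE ->.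
rewrite (eq_bigr _ (fun i _ => inner i)).
elim: m {inner} => [|m IH]; first by rewrite big_ord0 sub0n.
rewrite big_ord_recl/= (eq_bigr (fun i : 'I_m => (i + l < m)%N%:R)).
  rewrite IH -natrD; congr _%:R; rewrite add0n ltnS.
  by case: leqP => h /=; lia.
by move=> i _; rewrite /bump /= addSn ltnS.
Qed.

Lemma sum_single_lag (g : nat -> R) (k : nat) :
  \sum_(1 <= l < M.+1) g l * (k == l)%:R = if (0 < k <= M)%N then g k else 0.
Proof.
case: ifP => hk; last first.
  rewrite big_nat big1// => l hl; have [kl|_] := eqVneq k l; last by rewrite mulr0.
  by move: hk; rewrite kl ltnS in hl *; rewrite hl.
rewrite (bigD1_seq k)/= ?iota_uniq ?mem_index_iota ?ltnS// eqxx mulr1.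
by rewrite big1 ?addr0// => l lk; rewrite eq_sym (negbTE lk) mulr0.
Qed.

Lemma nearby_split (m : nat) (g : nat -> R) (c : R) (i j : 'I_m) :
  (if nearby M i j then if i == j then c else g (maxn i j - minn i j)%N else 0) =
  c * (i == j)%:R + \sum_(1 <= l < M.+1) g l * ((i + l == j)%N%:R + (j + l == i)%N%:R).
Proof.
under eq_bigr do rewrite mulrDr.
rewrite big_split/=.
have E (a b : nat) : \sum_(1 <= l < M.+1) g l * (a + l == b)%N%:R =
    if (a < b <= a + M)%N then g (b - a)%N else 0.
  have [ab|ab] := leqP a b.
    rewrite (eq_bigr (fun l => g l * (b - a == l)%N%:R)).
      by rewrite sum_single_lag subn_gt0 leq_subLR.
    move=> l _; congr (_ * _); congr (_%:R); lia.
  rewrite big1 => [|l _]; first by case: ifP => // /andP[]; lia.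
  by rewrite gtn_eqF ?mulr0// ltn_addr.
rewrite !E -val_eqE /= /nearby.
have [ij|ij|ij] := ltngtP (i : nat) j.
- by rewrite mulr0 /= add0r addr0 (leq_trans (ltnW ij) (leq_addr _ _)).
- by rewrite mulr0 /= !add0r (leq_trans (ltnW ij) (leq_addr _ _)) andbT.
- by rewrite mulr1 /= !addr0 ij leq_addr.
Qed.

(** The lag l occurs m - l times on each side of the diagonal; the missing l terms form a correction
    that does not grow with m. *)
Lemma sum_nearby_lags (m : nat) (g : nat -> R) (c : R) (F : 'I_m -> 'I_m -> R) :
  (M < m)%N -> (forall i, F i i = c) ->
  (forall (i j : 'I_m) l, (0 < l <= M)%N -> (i + l = j)%N -> F i j = g l /\ F j i = g l) ->
  \sum_i \sum_(j | nearby M i j) F i j =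
  m%:R * (c + 2 * \sum_(1 <= l < M.+1) g l) - 2 * \sum_(1 <= l < M.+1) l%:R * g l.
Proof.
move=> Mm Fc Fg.
have FE (i j : 'I_m) : (if nearby M i j then F i j else 0) =
    c * (i == j)%:R + \sum_(1 <= l < M.+1) g l * ((i + l == j)%N%:R + (j + l == i)%N%:R).
  rewrite -nearby_split; case: ifP => // /andP[h1 h2].
  case: eqVneq => [->//|]; rewrite -val_eqE/= => ij.
  have [lt|lt|e] := ltngtP (i : nat) j; last by rewrite e eqxx in ij.
  - by apply: (Fg i j _ _ _).1; lia.
  - by apply: (Fg j i _ _ _).2; lia.
have -> : \sum_i \sum_(j | nearby M i j) F i j = \sum_(i < m) (\sum_(j < m) c * (i == j)%:R
    + \sum_(1 <= l < M.+1) \sum_(j < m) g l * ((i + l == j)%N%:R + (j + l == i)%N%:R)).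
  apply: eq_bigr => i _; rewrite big_mkcond/= (eq_bigr _ (fun j _ => FE i j)) big_split/=.
  by congr (_ + _); exact: exchange_big.
rewrite big_split/= [X in _ + X]exchange_big/=.
have -> : \sum_(i < m) \sum_(j < m) c * (i == j)%:R = m%:R * c.
  rewrite (eq_bigr (fun=> c)); first by rewrite sumr_const card_ord mulr_natl.
  move=> i _; rewrite (bigD1 i)//= eqxx mulr1 big1 ?addr0// => j.
  by rewrite eq_sym => /negbTE ->; rewrite mulr0.
have -> : \sum_(1 <= l < M.+1) \sum_(i < m) \sum_(j < m)
      g l * ((i + l == j)%N%:R + (j + l == i)%N%:R) =
    \sum_(1 <= l < M.+1) (m%:R * (2 * g l) - 2 * (l%:R * g l)).
  apply: eq_big_nat => l /andP[_ lM].
  under eq_bigr do rewrite -mulr_sumr big_split.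
  rewrite -mulr_sumr big_split/= sum_lag_pairs.
  rewrite [X in _ + X]exchange_big/= sum_lag_pairs natrB; first by ring.
  by rewrite ltnS in lM; exact: leq_trans lM (ltnW Mm).
by rewrite big_split/= sumrN -!mulr_sumr; ring.
Qed.

End LagSums.

Section NullCountCLT.
Context (R : realType) (d : measure_display) (T : measurableType d).
Context (P : probability T R) (pi1 : R) (M : nat) (rho : nat -> R) (m : nat).
Unset Implicit Arguments.
Context (H : 'I_m -> {RV P >-> bool}) (eps : 'I_m -> {RV P >-> R}).
Set Implicit Arguments.
Local Notation S := (toeplitz_corr M rho m).
Hypothesis hpi : 0 < pi1 < 1.
Hypothesis hrho : forall l : nat, (1 <= l <= M)%N -> -1 < rho l < 1.
Hypothesis hpsd : psd S.
Hypothesis hmodel : two_group_model pi1 S H eps.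
Hypothesis Mm : (M < m)%N.
Context (tau : R).
Hypothesis htau : 0 < tau < 1.

Let K : R := (M.*2.+1)%:R.
Let pi0 : R := 1 - pi1.
Let hpi' : 0 <= pi1 <= 1. Proof. by have /andP[h1 h2] := hpi; rewrite !ltW. Qed.
Let LA := local_model_alg hpi' hpsd hmodel.
Let N i w := null_ind H eps (ipb tau) i w.
Let X i w := N i w - pi0 * tau.
Local Notation g l := (pi0 ^+ 2 * rho_tilde tau tau (rho l)).

(** The limiting variance of V(tau) / sqrt m: pi0 tau - (pi0 tau)^2 is the variance of one null
    indicator, and pi0^2 [rho_tilde] the covariance of two of them at a given lag. *)
Definition null_variance : R :=
  pi0 * tau - (pi0 * tau) ^+ 2
  + 2 * \sum_(1 <= l < M.+1) pi0 ^+ 2 * rho_tilde tau tau (rho l).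

(** The edge effect: indices near both ends have fewer neighbours, which changes the variance of the
    sum by a constant. *)
Definition lag_bias : R :=
  `|2 * \sum_(1 <= l < M.+1) l%:R * (pi0 ^+ 2 * rho_tilde tau tau (rho l))|.

Let bN i : bmeas (N i). Proof. exact: (bmeas_null hpi' hpsd hmodel). Qed.
Let bX i : bmeas (X i).
Proof. by apply: bmeasB; [exact: bN|exact: bmeas_cst]. Qed.
Let EN i : Ex P (N i) = pi0 * tau.
Proof. by rewrite /N (Ex_null hpi' hmodel) ipbK. Qed.
Let X_mean i : Ex P (X i) = 0.
Proof. by rewrite ExB ?Ex_cst ?EN ?subrr//; exact: bmeas_cst. Qed.

Let X_cov i j : Ex P (fun w => X i w * X j w) =
  Ex P (fun w => N i w * N j w) - (pi0 * tau) ^+ 2.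
Proof.
have bNN := bmeasM (bN i) (bN j).
rewrite (eq_Ex P (g := fun w => N i w * N j w + ((- (pi0 * tau)) * N i w
   + ((- (pi0 * tau)) * N j w + (pi0 * tau) ^+ 2)))); last by move=> w; rewrite /X; ring.
have b1 i' := bmeasZ (- (pi0 * tau)) (bN i').
have bc := bmeas_cst T ((pi0 * tau) ^+ 2).
rewrite ExD//; last by do 2! apply: bmeasD => //.
rewrite ExD//; last exact: bmeasD.
by rewrite ExD// Ex_cst !ExZ// !EN; ring.
Qed.

Let cov_sum : \sum_i \sum_(j | nearby M i j) Ex P (fun w => X i w * X j w) =
  m%:R * null_variance - 2 * \sum_(1 <= l < M.+1) l%:R * g l.
Proof.
rewrite (sum_nearby_lags (g := fun l => g l) (c := pi0 * tau - (pi0 * tau) ^+ 2))//.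
  move=> i; rewrite X_cov (eq_Ex P (g := N i)) ?EN// => w.
  by rewrite /N /null_ind; case: (_ && _); rewrite /= ?mulr0 ?mulr1.
move=> i j l lM ij.
have h : Ex P (fun w => X i w * X j w) = g l.
  by rewrite X_cov (null_pair_lag hpi' hpsd hmodel _ lM (hrho lM) ij) ipbK// -/pi0; ring.
by split=> //; rewrite -h; apply: eq_Ex => w; rewrite mulrC.
Qed.

Let X_la i : model_alg H eps (pred1 i) (X i).
Proof. by apply: (la_add LA); [exact: alg_null|exact: (la_cst LA)]. Qed.

(** X_i takes two values, so every function of it is affine in the indicator. *)
Let X_fun (f : R -> R) i : model_alg H eps (pred1 i) (fun w => f (X i w)).
Proof.
apply: (la_eq (g := fun w => f (- (pi0 * tau))
   + (f (1 - pi0 * tau) - f (- (pi0 * tau))) * N i w)).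
  move=> w; rewrite /X /N /null_ind; case: (_ && _) => /=.
    by rewrite mulr1 [RHS]addrC subrK.
  by rewrite mulr0 addr0 sub0r.
apply: (la_add LA); first exact: (la_cst LA).
by apply: (la_scale LA); exact: alg_null.
Qed.

Let X_le1 i w : `|X i w| <= 1.
Proof.
have /andP[p0 p1] := hpi; have /andP[t0 t1] := htau.
have hp : 0 < pi0 by rewrite /pi0; lra.
have hp1 : pi0 < 1 by rewrite /pi0; lra.
have h0 : 0 <= pi0 * tau <= 1 by apply/andP; split; nra.
case/andP: h0 => h0 h1.
by rewrite /X /N /null_ind; case: (_ && _) => /=; rewrite ler_norml; apply/andP; split; lra.
Qed.

Context (s : R).
Hypothesis s0 : 0 < s.
Hypothesis sm : s ^+ 2 * m%:R = 1.

Let m0 : (0 : R) < m%:R. Proof. by rewrite ltr0n; exact: leq_trans Mm. Qed.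

Let cov_close : `|s ^+ 2 * (\sum_i \sum_(j | nearby M i j) Ex P (fun w => X i w * X j w))
  - null_variance| <= s ^+ 2 * lag_bias.
Proof.
rewrite cov_sum mulrBr mulrA sm mul1r addrAC subrr add0r normrN normrM.
by rewrite (ger0_norm (sqr_ge0 s)).
Qed.

(** The near-diagonal sum of covariances is the second moment of the whole sum, hence nonnegative,
    and [cov_close] compares it with the limit. *)
Lemma null_variance_ge : - (s ^+ 2 * lag_bias) <= null_variance.
Proof.
have : 0 <= \sum_i \sum_(j | nearby M i j) Ex P (fun w => X i w * X j w).
  have -> : \sum_i \sum_(j | nearby M i j) Ex P (fun w => X i w * X j w) =
      Ex P (fun w => (\sum_i X i w) ^+ 2).
    rewrite (eq_Ex P (g := fun w => \sum_i \sum_j X i w * X j w)); last first.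
      by move=> w; rewrite expr2 mulr_suml; apply: eq_bigr => i _; rewrite mulr_sumr.
    rewrite Ex_sum; last by move=> i _; apply: bmeas_sum => j _; exact: bmeasM.
    apply: eq_bigr => i _; rewrite Ex_sum; last by move=> j _; exact: bmeasM.
    rewrite [RHS](bigID (nearby M i))/= [X in _ + X]big1 ?addr0// => j ij.
    rewrite (la_indep LA (I := pred1 i) (J := pred1 j)) ?X_mean ?mulr0//.
    by move=> i' j' /eqP -> /eqP ->.
  by apply: Ex_ge0 => w; exact: sqr_ge0.
move=> h; have h2 : 0 <= s ^+ 2 * (\sum_i \sum_(j | nearby M i j) Ex P (fun w => X i w * X j w)).
  by rewrite mulr_ge0// sqr_ge0.
by have := cov_close; rewrite ler_norml => /andP[_ h3]; lra.
Qed.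

Lemma null_clt (t th : R) : 0 <= null_variance -> 0 <= t ->
  `|Ex P (fun w => cos (t * (s * ZV pi1 H eps tau w) + th))
    - cos th * expR (- (null_variance * t ^+ 2 / 2))|
  <= s * (t ^+ 2 * K ^+ 2 + t * ((1 + ((3 * M).*2.+1)%:R * (2 * K) ^+ 2) / 2 + s * lag_bias)) * t.
Proof.
move=> v0 t0.
have sm1 : s ^+ 2 * m%:R <= 1 by rewrite sm.
apply: le_trans (local_clt LA X_la (fun i u => X_fun (fun x => cos (u * x)) i)
  (fun i u => X_fun (fun x => sin (u * x)) i) X_le1 X_mean s0 sm1 th v0 t0 cov_close) _.
by rewrite le_eqVlt; apply/orP; left; apply/eqP; rewrite -/K; ring.
Qed.

End NullCountCLT.

(** * Asymptotics *)

Lemma near_div_le (R : realType) (A e : R) : 0 < e ->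
  \forall x \near +oo, A / x <= e.
Proof.
move=> e0; near=> x; have x0 : 0 < x by near: x; exact: nbhs_pinfty_gt.
rewrite ler_pdivrMr// -ler_pdivrMl//.
Unshelve. all: by end_near. Qed.

Lemma near_div_lt (R : realType) (A e : R) : 0 < e ->
  \forall x \near +oo, A / x < e.
Proof.
move=> e0; near=> x; apply: (@le_lt_trans _ _ (e / 2)); last by lra.
by near: x; apply: near_div_le; rewrite divr_gt0.
Unshelve. all: by end_near. Qed.

(* With x = m^(1/14): r = m^(-2/7) localises the level, and e = y / sqrt m is the
   mesh on which V is compared with V(tau). *)
Lemma mesh_choice (R : realType) (q tau c delta K y u b : R) (k0 : nat) :
  q < 1 -> 0 < tau < 1 -> 0 < c -> 0 < delta -> 0 <= K -> 0 < y -> 0 < u -> 0 < b ->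
  \forall x \near +oo, let r := x ^- 4 in let e := y / x ^+ 7 in let N := x ^+ 14 in
    0 < x /\ exists n J : nat,
    [/\ [/\ r < tau, r <= delta & r < 1 - q],
        1 - tau <= n%:R * r, [/\ k0%:R * r <= u & k0%:R * r <= J%:R * e],
        [/\ J.+1%:R * e < tau & J.+1%:R * e < 1 - tau] &
        N * K / (N * (c * r)) ^+ 2 + n%:R * (N * K / (N * r) ^+ 2)
          + J.+1.*2%:R * (N * (K * (J.+1%:R * e)) / (x ^+ 7 * y) ^+ 2) <= b].
Proof.
move=> q1 /andP[t0 t1] c0 d0 K0 y0 u0 b0.
(* The window k0 r spans k0 x^3 / y mesh steps; the 2 pays for rounding up and for the extra point,
   both at most x^3. *)
pose A : R := k0%:R / y + 2.
have k00 : (0 : R) <= k0%:R by [].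
have A0 : 0 < A by rewrite /A ltr_wpDl// divr_ge0// ltW.
near=> x; pose r := x ^- 4; pose e := y / x ^+ 7; pose N := x ^+ 14.
rewrite -!/r -!/e -!/N.
have x1 : 1 <= x by near: x; exact: nbhs_pinfty_ge.
have x0 : 0 < x by lra.
have xn n : 1 <= x ^+ n by exact: exprn_ege1.
have xn0 n : 0 < x ^+ n by exact: exprn_gt0.
have r0 : 0 < r by rewrite invr_gt0.
have rx : r <= 1 / x.
  by rewrite mul1r lef_pV2 ?posrE//; exact: ler_eXnr.
have e0 : 0 < e by rewrite divr_gt0.
have h1 : 1 / x < tau by near: x; exact: near_div_lt.
have h2 : 1 / x <= delta by near: x; exact: near_div_le.
have h3 : 1 / x < 1 - q by near: x; apply: near_div_lt; lra.
have h4 : k0%:R / x <= u by near: x; exact: near_div_le.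
have h5 : A * y / x < tau by near: x; exact: near_div_lt.
have h6 : A * y / x < 1 - tau by near: x; apply: near_div_lt; lra.
have h7 : (K / c ^+ 2 + 2 * K + 2 * A ^+ 2 * K / y) / x <= b by near: x; exact: near_div_le.
split=> //.
have /andP[n1 n2] := truncn_bounds (ltW (xn0 4)).
set n := Num.truncn _ in n1 n2.
have J0 : 0 <= k0%:R * x ^+ 3 / y by apply: divr_ge0; [apply: mulr_ge0 => //; exact: ltW|exact: ltW].
have /andP[J1 J2] := truncn_bounds J0.
set J := Num.truncn _ in J1 J2.
exists n.+1, J.+1.
have eE : e = y / x ^+ 3 * r by rewrite /e /r; field; rewrite gt_eqF.
have JA : J.+2%:R <= A * x ^+ 3.
  rewrite -!natr1 /A mulrDl mulrAC -addrA; apply: lerD => //.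
  by rewrite mulr_natl mulr2n; apply: lerD.
have Je : J.+2%:R * e <= A * y / x.
  have -> : A * y / x = A * x ^+ 3 * (y / x ^+ 4) by field; rewrite gt_eqF.
  apply: ler_pM => //; first exact: ltW.
  rewrite /e ler_pM2l// lef_pV2 ?posrE//.
  exact: ler_weXn2l.
have nx : n.+1%:R <= 2 * x ^+ 4 by rewrite -natr1 mulr_natl mulr2n lerD.
split; first split; first exact: le_lt_trans rx h1.
- exact: le_trans rx h2.
- exact: le_lt_trans rx h3.
- apply: (@le_trans _ _ 1); first by rewrite lerBlDr lerDl ltW.
  by rewrite /r ler_pdivlMr// mul1r -natr1 ltW.
- split.
    by apply: le_trans h4; rewrite ler_wpM2l// -[leRHS]mul1r.
  rewrite eE mulrA ler_pM2r// -ler_pdivrMr ?divr_gt0// invf_div mulrA.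
  by rewrite -natr1 ltW.
- by split; apply: le_lt_trans Je _.
apply: le_trans h7.
rewrite (mulrDl (_ + _)) (mulrDl (K / _)); apply: lerD; first apply: lerD.
- have -> : N * K / (N * (c * r)) ^+ 2 = K / c ^+ 2 * x ^- 6.
    by rewrite /N /r; field; rewrite !gt_eqF.
  apply: ler_wpM2l; first by rewrite divr_ge0// sqr_ge0.
  by rewrite lef_pV2 ?posrE//; exact: ler_eXnr.
- have -> : N * K / (N * r) ^+ 2 = K / x ^+ 6 by rewrite /N /r; field; rewrite !gt_eqF.
  apply: (@le_trans _ _ (2 * x ^+ 4 * (K / x ^+ 6))).
    by apply: ler_wpM2r => //; rewrite divr_ge0// ltW.
  have -> : 2 * x ^+ 4 * (K / x ^+ 6) = 2 * K * x ^- 2 by field; rewrite !gt_eqF.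
  apply: ler_wpM2l; first by rewrite mulr_ge0.
  by rewrite lef_pV2 ?posrE//; exact: ler_eXnr.
- have -> : J.+2.*2%:R * (N * (K * (J.+2%:R * e)) / (x ^+ 7 * y) ^+ 2) =
      2 * J.+2%:R ^+ 2 * (K / (y * x ^+ 7)).
    by rewrite -muln2 natrM /N /e; field; rewrite !gt_eqF.
  apply: (@le_trans _ _ (2 * (A * x ^+ 3) ^+ 2 * (K / (y * x ^+ 7)))).
    apply: ler_wpM2r; first by rewrite divr_ge0// mulr_ge0// ltW.
    by rewrite ler_pM2l// ler_pXn2r// nnegrE// ltW// mulr_gt0.
  by rewrite le_eqVlt; apply/orP; left; apply/eqP; field; rewrite !gt_eqF.
Unshelve. all: by end_near. Qed.

(** Passes from large reals x to large integers m through x = m^(1/k), which makes the fractional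
    powers of m integer powers of x. *)
Lemma near_root (R : realType) (k : nat) (Q : R -> Prop) : (0 < k)%N ->
  (\forall x \near +oo, Q x) ->
  \forall m \near \oo, exists2 x : R, Q x & x ^+ k = m%:R.
Proof.
move=> k0 [X [_ hX]]; pose X' := Num.max X 0.
have X'0 : 0 <= X' by rewrite le_max lexx orbT.
near=> m.
have mX : X' ^+ k < m%:R by near: m; exact: nbhs_infty_gtr.
have kR : (k%:R : R) != 0 by rewrite pnatr_eq0 -lt0n.
have xk : (m%:R `^ k%:R^-1) ^+ k = m%:R :> R.
  by rewrite -powR_mulrn ?powR_ge0// -powRrM mulVf// powRr1.
exists (m%:R `^ k%:R^-1) => //; apply: hX.
apply: (@le_lt_trans _ _ X'); first by rewrite le_max lexx.
rewrite ltNge; apply/negP => h.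
have : m%:R <= X' ^+ k by rewrite -xk lerXn2r// nnegrE powR_ge0.
by rewrite leNgt mX.
Unshelve. all: by end_near. Qed.

Lemma near_sqrt_inv (R : realType) (e : R) : 0 < e ->
  \forall m \near \oo, (Num.sqrt m%:R)^-1 <= e.
Proof.
move=> e0; near=> m.
have m0 : (0 : R) < m%:R by near: m; exact: nbhs_infty_gtr.
have mE : e ^- 2 <= m%:R by near: m; exact: nbhs_infty_ger.
rewrite -[e]invrK lef_pV2 ?posrE ?invr_gt0 ?sqrtr_gt0//.
rewrite -(ler_pXn2r (n := 2))// ?nnegrE ?invr_ge0 ?sqrtr_ge0 ?(ltW e0)//.
by rewrite sqr_sqrtr ?(ltW m0)// exprVn.
Unshelve. all: by end_near. Qed.

Section Asymptotics.
Context (R : realType) (q a pi1 : R) (M : nat) (rho : nat -> R).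
Unset Implicit Arguments.
Context (d : nat -> measure_display) (T : forall m, measurableType (d m)).
Context (P : forall m, probability (T m) R).
Context (H : forall m, 'I_m -> {RV (P m) >-> bool}).
Context (eps : forall m, 'I_m -> {RV (P m) >-> R}).
Hypothesis hq : 0 < q < 1.
Hypothesis hpi : 0 < pi1 < 1.
Hypothesis hrho : forall l : nat, (1 <= l <= M)%N -> -1 < rho l < 1.
Hypothesis hpsd : forall m : nat, (M < m)%N -> psd (toeplitz_corr M rho m).
Hypothesis hmodel : forall m : nat,
  two_group_model pi1 (toeplitz_corr M rho m) (H m) (eps m).
Context (tau c delta : R).
Hypothesis htau : 0 < tau < 1.
Hypothesis c0 : 0 < c.
Hypothesis delta0 : 0 < delta.
Hypothesis Gup : forall t, tau <= t < 1 -> Gmix a pi1 t <= t / q - c * (t - tau).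
Hypothesis Glow : forall t, 0 < t <= tau -> tau - t <= delta ->
  t / q + c * (tau - t) <= Gmix a pi1 t.
Set Implicit Arguments.

Let K : R := (M.*2.+1)%:R.
Local Notation sq m := (Num.sqrt (m%:R : R)).
Local Notation V := (null_variance pi1 M rho tau).
Local Notation B := (lag_bias pi1 M rho tau).

Unset Implicit Arguments.
Definition scaled_FDP (m : nat) (w : T m) : R :=
  sq m * (FDP q (fun i => pval a (H m) (eps m) i w) (fun i => H m i w) - (1 - pi1) * q).

(** The value 0 for m <= M is a filler: the matrix is assumed positive semidefinite only beyond M,
    while measurability and tightness are asked for every m. *)
Definition linear_FDP (m : nat) (w : T m) : R :=
  if (M < m)%N then q * ((sq m)^-1 * ZV pi1 (H m) (eps m) tau w) / tau else 0.
Set Implicit Arguments.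

Let q0 : 0 < q. Proof. by have /andP[] := hq. Qed.
Let t0 : 0 < tau. Proof. by have /andP[] := htau. Qed.

Let sq_gt0 m : (M < m)%N -> 0 < sq m.
Proof. by move=> Mm; rewrite sqrtr_gt0 ltr0n; exact: leq_trans Mm. Qed.

Let sq_inv m : (M < m)%N -> (sq m)^-1 ^+ 2 * m%:R = 1.
Proof.
move=> Mm; rewrite exprVn sqr_sqrtr// mulVf// pnatr_eq0 -lt0n; exact: leq_trans Mm.
Qed.

(** Letting m grow in [null_variance_ge] removes the edge effect. *)
Lemma null_variance_ge0 : 0 <= V.
Proof.
rewrite leNgt; apply/negP => V0.
have e0 : 0 < - V / (2 * (B + 1)).
  by rewrite divr_gt0 ?oppr_gt0// mulr_gt0// ltr_wpDl// normr_ge0.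
have [m [Mm m1 me]] : exists m, [/\ (M < m)%N, (sq m)^-1 <= 1 & (sq m)^-1 <= - V / (2 * (B + 1))].
  near \oo => m; exists m; split.
  - by near: m; exact: nbhs_infty_gt.
  - by near: m; exact: near_sqrt_inv.
  - by near: m; exact: near_sqrt_inv.
have := null_variance_ge hpi hrho (hpsd m Mm) (hmodel m) Mm htau (sq_inv Mm).
have B0 : 0 <= B by exact: normr_ge0.
have s0 : 0 <= (sq m)^-1 by rewrite invr_ge0 sqrtr_ge0.
have h1 : (sq m)^-1 ^+ 2 * B <= (sq m)^-1 * (B + 1).
  rewrite expr2 -mulrA ler_wpM2l//; apply: (@le_trans _ _ B); last by lra.
  exact: ler_piMl.
have h2 : (sq m)^-1 * (B + 1) <= - V / 2.
  rewrite -ler_pdivlMr ?ltr_wpDl//; apply: le_trans me _.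
  by rewrite invfM mulrA.
move: V0 h1 h2; move: V (_ * B) (_ * (B + 1)) => v x y *; lra.
Unshelve. all: by end_near. Qed.

Lemma measurable_linear_FDP m : measurable_fun setT (linear_FDP m).
Proof.
rewrite /linear_FDP; have [Mm|_] := ltnP M m; last exact: measurable_cst.
apply: bmeas_measurable.
have bz := bmeas_ZV hpi (hpsd m Mm) (hmodel m) tau.
apply: (eq_bmeas (g := fun w => (q * (sq m)^-1 / tau) * ZV pi1 (H m) (eps m) tau w)).
  by move=> w; ring.
exact: bmeasZ.
Qed.

Lemma measurable_scaled_FDP m : measurable_fun setT (scaled_FDP m).
Proof.
apply: measurable_funM; first exact: measurable_cst.
apply: measurable_funB; last exact: measurable_cst.
apply: measurable_FDP => //.
- exact: ltW.
- by move=> i w; exact: Phibar_gt0.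
move=> i; rewrite /pval /pvalue.
apply: (@measurableT_comp _ _ _ _ _ _ (@Phibar R)); first exact: (continuous_measurable_fun (@continuous_Phibar R)).
apply: measurable_funD => //; apply: measurable_funM; first exact: measurable_cst.
rewrite (_ : (fun w => _) = \1_(H m i @^-1` [set true])).
  by apply: measurable_indic; rewrite -[X in measurable X]setTI; exact: measurable_funP.
apply/funext => w; rewrite indicE; case E: (H m i w); first by rewrite mem_set.
by rewrite memNset//= E.
Qed.

Lemma linear_FDP_tight (dl : R) : 0 < dl ->
  exists L : R, forall m, fine (P m [set w | L < `|linear_FDP m w|]) <= dl.
Proof.
(* [v] bounds the second moment uniformly in m; L = v / dl + 1 is at least 1, so L^2 >= L >= v / dl
   and the Chebyshev quotient v / L^2 is at most [dl]. *)
move=> dl0; pose v := (q / tau) ^+ 2 * K.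
have v0 : 0 <= v by rewrite mulr_ge0 ?sqr_ge0.
pose L := v / dl + 1.
have vL : 0 <= v / dl by rewrite divr_ge0// ltW.
have L0 : 0 < L by rewrite ltr_wpDl.
exists L => m; have mW := @measurable_linear_FDP m.
have mS : measurable [set w | L < `|linear_FDP m w|].
  apply: measurable_set_lt; first exact: measurable_cst.
  by apply: measurableT_comp mW.
have [Mm|Mm] := leqP m M.
  have -> : [set w | L < `|linear_FDP m w|] = set0.
    by rewrite -subset0 => w /=; rewrite /linear_FDP ltnNge Mm/= normr0 ltNge ltW.
  by rewrite measure0 ltW.
have bz := bmeas_ZV hpi (hpsd m Mm) (hmodel m) tau.
pose k := q * (sq m)^-1 / tau.
have WE w : linear_FDP m w = k * ZV pi1 (H m) (eps m) tau w.
  by rewrite /linear_FDP Mm /k; ring.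
have b2 : bmeas (fun w => k ^+ 2 * ZV pi1 (H m) (eps m) tau w ^+ 2).
  by apply: bmeasZ; exact: bmeasX.
apply: le_trans (Ex_markov (f := fun w => k ^+ 2 * ZV pi1 (H m) (eps m) tau w ^+ 2)
  (a := L ^+ 2) (P m) mS b2 _ _ _) _.
- exact: exprn_gt0.
- by move=> w; rewrite mulr_ge0// sqr_ge0.
- move=> w /= h; rewrite -exprMn -WE -(real_normK (num_real (linear_FDP m w))).
  by rewrite lerXn2r ?nnegrE// ltW.
rewrite ExZ; last exact: bmeasX.
have hv := Ex_ZV_sqr hpi (hpsd m Mm) (hmodel m) htau.
rewrite ler_pdivrMr ?exprn_gt0//.
apply: (@le_trans _ _ v).
  have -> : v = k ^+ 2 * (m%:R * K).
    have -> : k ^+ 2 * (m%:R * K) = v * ((sq m)^-1 ^+ 2 * m%:R) by rewrite /k /v; ring.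
    by rewrite sq_inv// mulr1.
  by apply: ler_wpM2l => //; exact: sqr_ge0.
have -> : v = dl * (v / dl) by field; rewrite gt_eqF.
rewrite ler_pM2l// /L; nra.
Qed.

Lemma linear_FDP_cvg (t th : R) :
  Ex (P m) (fun w => cos (t * linear_FDP m w + th)) @[m --> \oo] -->
  Ex (normal_law 0 ((q / tau) ^+ 2 * V)) (fun x => cos (t * x + th)).
Proof.
wlog tge0 : t th / 0 <= t.
  move=> W; have [/W//|tl] := leP 0 t.
  have cN x : cos (t * x + th) = cos (- t * x + - th) by rewrite mulNr -opprD cosN.
  have -> : (fun m => Ex (P m) (fun w => cos (t * linear_FDP m w + th))) =
      (fun m => Ex (P m) (fun w => cos (- t * linear_FDP m w + - th))).
    by apply/funext => m; apply: eq_Ex => w; exact: cN.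
  have -> : Ex (normal_law 0 ((q / tau) ^+ 2 * V)) (fun x => cos (t * x + th)) =
      Ex (normal_law 0 ((q / tau) ^+ 2 * V)) (fun x => cos (- t * x + - th)).
    by apply: eq_Ex => x; exact: cN.
  by apply: W; rewrite oppr_ge0 ltW.
have V0 := null_variance_ge0.
rewrite Ex_cos_normal_law; last by rewrite mulr_ge0// sqr_ge0.
pose u := t * (q / tau).
have u0 : 0 <= u by rewrite mulr_ge0// divr_ge0// ltW.
pose D : R := (u ^+ 2 * K ^+ 2 + u * ((1 + ((3 * M).*2.+1)%:R * (2 * K) ^+ 2) / 2 + B)) * u.
apply/cvgrPdist_le => e e0.
near=> m.
have Mm : (M < m)%N by near: m; exact: nbhs_infty_gt.
have s1 : (sq m)^-1 <= 1 by near: m; exact: near_sqrt_inv.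
have sD : (sq m)^-1 <= e / (`|D| + 1).
  by near: m; apply: near_sqrt_inv; rewrite divr_gt0// ltr_wpDl.
have s0 : 0 < (sq m)^-1 by rewrite invr_gt0 sq_gt0.
rewrite distrC (eq_Ex (P m) (g := fun w => cos (u * ((sq m)^-1 * ZV pi1 (H m) (eps m) tau w) + th))); last first.
  by move=> w; rewrite /linear_FDP Mm /u; congr (cos (_ + _)); ring.
have -> : (q / tau) ^+ 2 * V * t ^+ 2 / 2 = V * u ^+ 2 / 2 by rewrite /u; ring.
apply: le_trans (null_clt hpi hrho (hpsd m Mm) (hmodel m) Mm htau s0 (sq_inv Mm) th V0 u0) _.
apply: (@le_trans _ _ ((sq m)^-1 * D)).
  rewrite /D -/K -mulrA ler_pM2l// ler_wpM2r// lerD2l ler_wpM2l// lerD2l.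
  by rewrite ler_piMl// normr_ge0.
apply: (@le_trans _ _ ((sq m)^-1 * (`|D| + 1))).
  by rewrite ler_pM2l//; have := ler_norm D; lra.
by rewrite -ler_pdivlMr// ltr_wpDl.
Unshelve. all: by end_near. Qed.

Lemma scaled_FDP_close (eta dl : R) : 0 < eta -> 0 < dl ->
  \forall m \near \oo, off_bad_event (P m) dl
    (fun w => `|scaled_FDP m w - linear_FDP m w| <= eta).
Proof.
move=> eta0 dl0; have /andP[_ q1] := hq.
have K0 : 0 <= K by rewrite ler0n.
(* This [y] makes the increment term of [FDP_close] equal to eta / 2, and the second bound in [u]
   keeps the other term below eta / 2. Likewise [L] takes dl / 2 of the probability and the mesh the
   other half. *)
pose y := eta * tau / (8 * q).
have y0 : 0 < y by rewrite divr_gt0 ?mulr_gt0.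
pose L := 2 * K / dl + 1.
have KL : 0 <= 2 * K / dl by rewrite divr_ge0 ?(ltW dl0)// mulr_ge0.
have L0 : 0 < L by rewrite ltr_wpDl.
have KL2 : K / L ^+ 2 <= dl / 2.
  rewrite ler_pdivrMr ?exprn_gt0//.
  have -> : K = dl / 2 * (2 * K / dl) by field; rewrite gt_eqF.
  by rewrite ler_pM2l ?divr_gt0// /L; nra.
(* [k0] depends on q and c only, so the window k0 r still shrinks with r. *)
pose k0 := (Num.truncn ((q^-1 + 1) / c)).+1.
have hk : q^-1 + 1 <= c * k0.+1%:R.
  have x0 : 0 <= (q^-1 + 1) / c by rewrite divr_ge0 ?(ltW c0)// addr_ge0// invr_ge0 ltW.
  have /andP[_ h] := truncn_bounds x0.
  rewrite -ler_pdivrMl// mulrC; apply: le_trans (ltW h) _.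
  by rewrite natr1 ler_nat.
pose u := Num.min (tau / 2) (eta * tau ^+ 2 / (4 * q * L)).
have u0 : 0 < u by rewrite lt_min !divr_gt0 ?mulr_gt0 ?exprn_gt0.
have dl2 : 0 < dl / 2 by rewrite divr_gt0.
have mesh := near_root (k := 14) isT (mesh_choice k0 q1 htau c0 delta0 K0 y0 u0 dl2).
move: (nbhs_infty_gt M) mesh; apply: filterS2 => m Mm.
move=> [x [x0 [n [J [[r1 r2 r3] hn [hku hkJ] [J1 J2] hb]]]] xm].
have m0 : (0 < m)%N by exact: leq_trans Mm.
have s0 : 0 < x ^+ 7 by exact: exprn_gt0.
have sm : (x ^+ 7) ^+ 2 = m%:R by rewrite -exprM.
have sE : sq m = x ^+ 7 by rewrite -sm sqrtr_sqr gtr0_norm.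
have r0 : 0 < x ^- 4 by rewrite invr_gt0 exprn_gt0.
have hku' : k0%:R * x ^- 4 <= tau / 2 by apply: le_trans hku _; rewrite ge_min lexx.
have se : x ^+ 7 * (y / x ^+ 7) = y by field; rewrite gt_eqF.
have := FDP_close hq hpi (hpsd m Mm) (hmodel m) m0 htau c0 Gup Glow s0 sm r0 r1 r2 r3
  (ltn0Sn _) hk hn hku' hkJ y0 se J1 J2 L0.
apply: off_bad_event_mono.
  have -> : dl = dl / 2 + dl / 2 by lra.
  apply: lerD; first by rewrite -xm.
  have -> : m%:R * M.*2.+1%:R / (x ^+ 7 * L) ^+ 2 = K / L ^+ 2.
    by rewrite -sm; field; rewrite !gt_eqF.
  by [].
move=> w; rewrite /scaled_FDP /linear_FDP Mm sE => h; apply: le_trans h _.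
have hk2 : k0%:R * x ^- 4 <= eta * tau ^+ 2 / (4 * q * L).
  by apply: le_trans hku _; rewrite ge_min lexx orbT.
have -> : eta = q * (2 * (2 * y) / tau + 2 * L * (eta * tau ^+ 2 / (4 * q * L)) / tau ^+ 2).
  by rewrite /y; field; rewrite !gt_eqF.
rewrite ler_pM2l// lerD2l ler_pM2r ?invr_gt0 ?exprn_gt0// ler_pM2l// mulr_gt0//.
Qed.

End Asymptotics.

Unset Implicit Arguments.
Set Strict Implicit.

Theorem corollary4p3 (R : realType) (q muA pi1 : R) (M : nat) (rho : nat -> R)
  (d : nat -> measure_display) (T : forall m, measurableType (d m))
  (P : forall m, probability (T m) R)
  (H : forall m, 'I_m -> {RV (P m) >-> bool})
  (eps : forall m, 'I_m -> {RV (P m) >-> R})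
  (hq : 0 < q < 1) (hmuA : 0 < muA) (hpi1 : 0 < pi1 < 1) (hM : (0 < M)%N)
  (hrho : forall l : nat, (1 <= l <= M)%N -> -1 < rho l < 1)
  (hpsd : forall m : nat, (M < m)%N -> psd (toeplitz_corr M rho m))
  (hmodel : forall m : nat,
    two_group_model pi1 (toeplitz_corr M rho m) (H m) (eps m)) :
  let pi0 := 1 - pi1 in
  exists tau : R,
    unique (fun t : R => 0 < t < 1 /\
      t / q = pi0 * t + pi1 * Phibar (fine (Phibar_inv t) - muA)) tau /\
    cvg_in_distribution P
      (fun m w =>
        Num.sqrt m%:R *
        (FDP q (fun i : 'I_m => pvalue muA (H m i w) (eps m i w))
               (fun i : 'I_m => H m i w)
         - pi0 * q))
      (normal_law 0
        (pi0 ^+ 2 * q ^+ 2 / tau ^+ 2 *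
         (tau / pi0 - tau ^+ 2
          + 2 * \sum_(1 <= l < M.+1) rho_tilde tau tau (rho l)))).
Proof.
move=> pi0.
have [xs [c c0 [delta delta0 [tauU up low]]]] := two_group_root hq hmuA hpi1.
set tau := Phibar xs in tauU up low.
exists tau; split; first exact: tauU.
have htau : 0 < tau < 1 by case: tauU => [[]].
have /andP[t0 _] := htau; have /andP[_ p1] := hpi1.
have pi00 : 0 < pi0 by rewrite subr_gt0.
(* The gap inequalities of [two_group_root] are read at x = [ipb t], which reverses the order
   between thresholds and levels. *)
have Gup t : tau <= t < 1 -> Gmix muA pi1 t <= t / q - c * (t - tau).
  move=> /andP[tt t1]; have ht : 0 < t < 1 by rewrite t1 andbT (lt_le_trans t0).
  by have := up (ipb t); rewrite -Phibar_leE !(ipbK ht); apply.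
have Glow t : 0 < t <= tau -> tau - t <= delta -> t / q + c * (tau - t) <= Gmix muA pi1 t.
  move=> /andP[tp tt] td; have /andP[_ t1] := htau.
  have ht : 0 < t < 1 by rewrite tp (le_lt_trans tt).
  by have := low (ipb t); rewrite -Phibar_leE !(ipbK ht); apply.
have -> : pi0 ^+ 2 * q ^+ 2 / tau ^+ 2 *
    (tau / pi0 - tau ^+ 2 + 2 * \sum_(1 <= l < M.+1) rho_tilde tau tau (rho l)) =
    (q / tau) ^+ 2 * null_variance pi1 M rho tau.
  by rewrite /null_variance -/pi0 -mulr_sumr; field; rewrite !gt_eqF.
apply: (@levy_slutsky R d T P (linear_FDP R q pi1 M d T P H eps tau) (scaled_FDP R q muA pi1 d T P H eps)).
- by move=> m; exact: (measurable_linear_FDP q hpi1 hpsd hmodel tau).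
- by move=> m; exact: (measurable_scaled_FDP muA pi1 H eps hq).
- by move=> t th; exact: (linear_FDP_cvg hq hpi1 hrho hpsd hmodel htau).
- by move=> dl dl0; exact: (linear_FDP_tight q hpi1 hpsd hmodel htau).
- move=> eta dl eta0 dl0.
  exact: (scaled_FDP_close hq hpi1 hpsd hmodel htau c0 delta0 Gup Glow eta0 dl0).
Qed.
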